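(* The optimal control problem \[ \begin{aligned} &\min_{(y,u,v)\in\mathcal Y\times H^1(\Omega)\times H^1(\Omega)}\ \tfrac12\|D[y]-y_{\mathrm d}\|_{\mathcal D}^2+J(u,v)\\ &\text{subject to}\quad A[y]-B[u]-C[v]=0,\qquad (u,v)\in\mathbb C \end{aligned} \] possesses an optimal solution, i.e. there exists a feasible triple $(\bar y,\bar u,\bar v)\in\mathcal Y\times H^1(\Omega)\times H^1(\Omega)$ at which the objective is minimal among all feasible triples.
   Context: All spaces are real. $\Omega\subset\mathbb R^d$ is a nonempty bounded domain satisfying the cone condition. $H^1(\Omega)$ is the space of $L^2(\Omega)$ functions whose first-order weak derivatives are in $L^2(\Omega)$, with norm $\|y\|_{H^1(\Omega)}=(\|y\|_{L^2(\Omega)}^2+\sum_{i=1}^d\|\partial_{x_i}y\|_{L^2(\Omega)}^2)^{1/2}$. $\mathcal D$ (observation space) and $\mathcal Y$ (state space) are Hilbert spaces, $y_{\mathrm d}\in\mathcal D$ is fixed, and for a Banach space $\mathcal X$, $\mathcal X^\star$ denotes its topological dual. $A:\mathcal Y\to\mathcal Y^\star$ is a bounded linear isomorphism (bounded inverse); $B,C:H^1(\Omega)\to\mathcal Y^\star$ and $D:\mathcal Y\to\mathcal D$ are arbitrary bounded linear operators. For constants $\alpha_1,\alpha_2\ge 0$ and $\varepsilon>0$, \[ J(u,v):=\tfrac{\alpha_1}{2}\|u\|_{L^2(\Omega)}^2+\tfrac{\alpha_2}{2}\|v\|_{L^2(\Omega)}^2+\tfrac{\varepsilon}{2}\big(\|u\|_{H^1(\Omega)}^2+\|v\|_{H^1(\Omega)}^2\big),\qquad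 u,v\in H^1(\Omega). \] The complementarity set is $\mathbb C:=\{(w,z)\in H^1(\Omega)^2 : w(x)\ge 0,\ z(x)\ge 0,\ w(x)z(x)=0\text{ for a.e. }x\in\Omega\}$. *)

(* Defs.v *)
From HB Require Import structures.
From mathcomp Require Import all_boot all_order all_algebra.
From mathcomp Require Import all_classical all_reals all_analysis.
From mathcomp Require Import measurable_realfun ess_sup_inf.

Set Implicit Arguments.
Unset Strict Implicit.
Unset Printing Implicit Defensive.

Import Order.TTheory GRing.Theory Num.Theory.
Import numFieldNormedType.Exports.

Local Open Scope classical_set_scope.
Local Open Scope ring_scope.

(* Matrices, in particular the row vectors 'rV[R]_d standing for R^d, carry
   the Borel sigma-algebra of their topology. *)
Definition borel_display : measure_display. Proof. exact. Qed.

Section borel_mx.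
Variables (R : realType) (m n : nat).
Let B := <<s @open 'M[R]_(m, n) >>.
Let B0 : B set0. Proof. exact: sigma_algebra0. Qed.
Let BC A : B A -> B (~` A). Proof. exact: sigma_algebraC. Qed.
Let BU (F : (set 'M[R]_(m, n))^nat) :
  (forall i, B (F i)) -> B (\bigcup_i F i).
Proof. exact: sigma_algebra_bigcup. Qed.
HB.instance Definition _ :=
  @isMeasurable.Build borel_display 'M[R]_(m, n) B B0 BC BU.

Lemma open_measurable_mx (U : set 'M[R]_(m, n)) : open U -> measurable U.
Proof. exact: sub_sigma_algebra. Qed.

Lemma open_bigcup_rat_ball (U : set 'M[R]_(m, n)) : open U ->
  U = \bigcup_(p : 'M[rat]_(m, n) * nat) [set x |
    ball (map_mx ratr p.1 : 'M[R]_(m, n)) p.2.+1%:R^-1 `<=` U /\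
    ball (map_mx ratr p.1 : 'M[R]_(m, n)) p.2.+1%:R^-1 x].
Proof.
move=> oU; apply/seteqP; split; last by move=> x [p _ [pU]] /pU.
move=> x Ux.
have /nbhs_ballP[e /= e0 eU] : nbhs x U by exact: open_nbhs_nbhs.
have e20 : 0 < e / 2 by rewrite divr_gt0.
have [k ke] : exists k : nat, k.+1%:R^-1 < e / 2.
  near \oo => k; exists k; near: k; exact: near_infty_natSinv_lt (PosNum e20).
have q_ i j : exists q : rat, ball (x i j) k.+1%:R^-1 (ratr q).
  have k0 : 0 < k.+1%:R^-1 :> R by rewrite invr_gt0.
  have [|q] := @rat_in_itvoo R (x i j - k.+1%:R^-1) (x i j + k.+1%:R^-1).
    by rewrite ltrD2l gtrN.
  rewrite in_itv/= => xq; exists q.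
  by rewrite -ball_normE /ball_ /= distrC ltr_distl.
pose Q := \matrix_(i, j) sval (cid (q_ i j)).
have Qx : ball (map_mx ratr Q : 'M[R]_(m, n)) k.+1%:R^-1 x.
  split=> [|i j]; first by rewrite invr_gt0.
  by rewrite !mxE; apply: ball_sym; case: cid.
exists (Q, k) => //=; split => // y yQ; apply: eU.
rewrite (splitr e); apply: ball_triangle (le_ball (ltW ke) yQ).
by apply: ball_sym; exact: le_ball (ltW ke) _ Qx.
Unshelve. all: by end_near. Qed.

Lemma measurable_fun_mx d (T : measurableType d) (f : T -> 'M[R]_(m, n)) :
  (forall i j, measurable_fun setT (fun x => f x i j)) -> measurable_fun setT f.
Proof.
move=> mf; apply: (@measurability _ _ _ _ _ _ (@open 'M[R]_(m, n))) => //.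
move=> _ [U oU <-]; rewrite setTI (open_bigcup_rat_ball oU) preimage_bigcup.
apply: countable_bigcupT_measurable => // p.
have [pU|npU] := pselect
  (ball (map_mx ratr p.1 : 'M[R]_(m, n)) p.2.+1%:R^-1 `<=` U); last first.
  rewrite [X in measurable X](_ : _ = set0)//.
  by apply/seteqP; split => // x /= [].
rewrite [X in measurable X](_ : _ = \bigcap_(ij in [set: 'I_m * 'I_n])
    ((fun x => f x ij.1 ij.2) @^-1`
     ball (ratr (p.1 ij.1 ij.2) : R) p.2.+1%:R^-1)).
  apply: fin_bigcap_measurable => // ij _.
  rewrite -[X in measurable X]setTI; apply: mf => //.
  exact: measurable_ball.
apply/seteqP; split => x /=.
  by move=> [_ [_ fp]] ij _ /=; have := fp ij.1 ij.2; rewrite mxE.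
move=> fp; split => //; split => [|i j]; first by rewrite invr_gt0.
by rewrite mxE; exact: (fp (i, j)).
Qed.

Lemma continuous_measurable_mx (f : 'M[R]_(m, n) -> R) :
  continuous f -> measurable_fun setT f.
Proof.
move=> cf; apply: (measurability _ (RGenOpens.measurableE R)).
move=> _ [_ [a [b ->] <-]]; rewrite setTI; apply: open_measurable_mx.
by apply: open_comp; [move=> x _; exact: cf|exact: interval_open].
Qed.

Lemma measurable_entry i j :
  measurable_fun setT (fun x : 'M[R]_(m, n) => x i j).
Proof. exact: continuous_measurable_mx (@coord_continuous _ _ _ _ _). Qed.
End borel_mx.

Section cons_row.
Variables (R : realType) (n : nat).

Definition cons_row (p : R * 'rV[R]_n) : 'rV[R]_n.+1 := row_mx p.1%:M p.2.

Definition uncons_row (x : 'rV[R]_n.+1) : R * 'rV[R]_n :=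
  (x ord0 ord0, @rsubmx R 1 1 n x).

Lemma cons_row0 p : cons_row p ord0 ord0 = p.1.
Proof.
rewrite /cons_row mxE; case: splitP => [j _|j /= /eqP//].
by rewrite (ord1 j) mxE eqxx mulr1n.
Qed.

Lemma cons_rowS p i : cons_row p ord0 (lift ord0 i) = p.2 ord0 i.
Proof.
rewrite /cons_row mxE; case: splitP => [j|j /=].
  by rewrite (ord1 j).
by rewrite /bump /= => -[ij]; congr (p.2 _ _); apply: val_inj.
Qed.

Lemma rsubmxS (x : 'rV[R]_n.+1) i :
  @rsubmx R 1 1 n x ord0 i = x ord0 (lift ord0 i).
Proof. by rewrite mxE; congr (x _ _); apply: val_inj. Qed.

Lemma cons_rowK : cancel cons_row uncons_row.
Proof.
move=> p; rewrite /uncons_row cons_row0 [RHS]surjective_pairing; congr pair.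
by apply/rowP => i; rewrite rsubmxS cons_rowS.
Qed.

Lemma measurable_cons_row : measurable_fun setT cons_row.
Proof.
apply: measurable_fun_mx => i j; rewrite (ord1 i).
case: (unliftP ord0 j) => [k ->|->].
  under eq_fun do rewrite cons_rowS.
  apply: (measurableT_comp (measurable_entry _ _)); exact: measurable_snd.
under eq_fun do rewrite cons_row0.
exact: measurable_fst.
Qed.

Lemma measurable_uncons_row : measurable_fun setT uncons_row.
Proof.
apply: measurable_fun_pair; first exact: measurable_entry.
apply: measurable_fun_mx => i j.
under eq_fun do rewrite mxE.
exact: measurable_entry.
Qed.

Variable mu : {sigma_finite_measure set 'rV[R]_n -> \bar R}.

Definition lebesgue_cons : set 'rV[R]_n.+1 -> \bar R :=
  pushforward (@lebesgue_measure R \x mu)%E cons_row.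

Let cons0 : lebesgue_cons set0 = 0%E.
Proof. by rewrite /lebesgue_cons /pushforward preimage_set0 measure0. Qed.

Let cons_ge0 A : (0 <= lebesgue_cons A)%E.
Proof. by rewrite /lebesgue_cons /pushforward measure_ge0. Qed.

Let cons_sigma_additive : semi_sigma_additive lebesgue_cons.
Proof.
have mf := measurable_cons_row.
move=> F mF tF mUF; rewrite /lebesgue_cons /pushforward preimage_bigcup.
apply: measure_semi_sigma_additive.
- by move=> k; rewrite -[X in measurable X]setTI; exact: mf.
- apply/trivIsetP => /= i j _ _ ij; rewrite -preimage_setI.
  by move/trivIsetP : tF => /(_ _ _ _ _ ij) ->//; rewrite preimage_set0.
- by rewrite -preimage_bigcup -[X in measurable X]setTI; exact: mf.
Qed.

HB.instance Definition _ := isMeasure.Build _ _ _ lebesgue_cons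
  cons0 cons_ge0 cons_sigma_additive.

Let cons_sigma_finite : sigma_finite setT lebesgue_cons.
Proof.
have /sigma_finiteP[F [FT ndF Foo]] := sigma_finiteT (@lebesgue_measure R).
have /sigma_finiteP[G [GT ndG Goo]] := sigma_finiteT mu.
exists (fun k => uncons_row @^-1` (F k `*` G k)).
  rewrite -preimage_bigcup (_ : \bigcup_k _ = setT) ?preimage_setT//.
  apply/seteqP; split => // -[t x] _.
  have [i _ Fit] : (\bigcup_k F k) t by rewrite -FT.
  have [j _ Gjx] : (\bigcup_k G k) x by rewrite -GT.
  exists (maxn i j) => //; split.
    by move: (t) Fit; exact/subsetPset/ndF/leq_maxl.
  by move: (x) Gjx; exact/subsetPset/ndG/leq_maxr.
move=> k; have [mF Fk] := Foo k; have [mG Gk] := Goo k; split.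
  rewrite -[X in measurable X]setTI.
  by apply: measurable_uncons_row => //; exact: measurableX.
rewrite /lebesgue_cons /pushforward (_ : _ @^-1` _ = F k `*` G k).
  by rewrite product_measure1E// lte_mul_pinfty// ge0_fin_numE.
by apply/funext => p; rewrite /preimage /mkset cons_rowK.
Qed.

HB.instance Definition _ := Measure_isSigmaFinite.Build _ _ _ lebesgue_cons
  cons_sigma_finite.

End cons_row.

(* d-dimensional Lebesgue measure on Borel sets, as an iterated product of the
   one-dimensional one; lebesgue_rV_box gives its value on boxes. *)
Fixpoint lebesgue_rV (R : realType) (n : nat) :
    {sigma_finite_measure set 'rV[R]_n -> \bar R} :=
  match n with
  | 0 => dirac (0 : 'rV[R]_0)
  | n'.+1 => lebesgue_cons (lebesgue_rV R n')
  end.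

Lemma measurable_box (R : realType) n (a b : 'rV[R]_n) :
  measurable [set x : 'rV[R]_n | forall i, a ord0 i <= x ord0 i <= b ord0 i].
Proof.
rewrite [X in measurable X](_ : _ = \bigcap_(i in [set: 'I_n])
    ((fun x : 'rV[R]_n => x ord0 i) @^-1` `[a ord0 i, b ord0 i])); last first.
  apply/seteqP; split => x /= h i; first by move=> _; rewrite /= in_itv/= h.
  by have := h i Logic.I; rewrite /= in_itv.
apply: fin_bigcap_measurable => // i _.
by rewrite -[X in measurable X]setTI; exact: measurable_entry.
Qed.

Lemma lebesgue_rV_box (R : realType) n (a b : 'rV[R]_n) :
  (forall i, a ord0 i <= b ord0 i) ->
  lebesgue_rV R n [set x | forall i, a ord0 i <= x ord0 i <= b ord0 i] =
  (\prod_i (b ord0 i - a ord0 i))%:E.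
Proof.
elim: n a b => [a b _|n IH a b ab].
  rewrite big_ord0 /= diracE mem_set//= => i; by case: i.
have boxE :
  @cons_row R n @^-1` [set x | forall i, a ord0 i <= x ord0 i <= b ord0 i] =
  (`[a ord0 ord0, b ord0 ord0]%classic : set R) `*`
  [set x : 'rV[R]_n | forall i, (@rsubmx R 1 1 n a) ord0 i <= x ord0 i <=
                     (@rsubmx R 1 1 n b) ord0 i].
  apply/seteqP; split => -[t x] /=.
    move=> h; split => [|i].
      by have := h ord0; rewrite in_itv/= cons_row0.
    by have := h (lift ord0 i); rewrite !rsubmxS cons_rowS.
  move=> [t_ x_] i; case: (unliftP ord0 i) => [j ->|->].
    by have := x_ j; rewrite !rsubmxS cons_rowS.
  by move: t_; rewrite in_itv/= cons_row0.
transitivity ((@lebesgue_measure R \x lebesgue_rV R n)%E (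
  (`[a ord0 ord0, b ord0 ord0]%classic : set R) `*`
  [set x : 'rV[R]_n | forall i, (@rsubmx R 1 1 n a) ord0 i <= x ord0 i <=
                     (@rsubmx R 1 1 n b) ord0 i])).
  by rewrite -boxE.
rewrite product_measure1E//; last exact: measurable_box.
rewrite IH => [|i]; last by rewrite !rsubmxS; exact: ab.
have leb1 : @lebesgue_measure R `[a ord0 ord0, b ord0 ord0]%classic =
    (b ord0 ord0 - a ord0 ord0)%:E.
  rewrite lebesgue_measure_itv/= lte_fin.
  have [//|ba] := ltP (a ord0 ord0) (b ord0 ord0).
  by rewrite (@le_anti _ _ (a ord0 ord0) (b ord0 ord0)) ?ab// subrr.
rewrite big_ord_recl EFinM; congr (_ * _)%E; first exact: leb1.
by under eq_bigr do rewrite !rsubmxS.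
Qed.

Lemma eq_ae_Lnorm d (T : measurableType d) (R : realType)
    (mu : {measure set T -> \bar R}) (p : \bar R) (f g : T -> R) :
  (1 <= p)%E -> measurable_fun setT f -> measurable_fun setT g ->
  f = g %[ae mu] -> ('N[mu]_p[EFin \o f] = 'N[mu]_p[EFin \o g])%E.
Proof.
move=> p1 mf mg fg; rewrite unlock; case: p p1 => [r r1| _|//].
  congr (_ `^ _)%E; apply: ae_eq_integral => //.
  - apply: (measurableT_comp (measurable_poweR r)).
    by apply: measurableT_comp => //; exact/measurable_EFinP.
  - apply: (measurableT_comp (measurable_poweR r)).
    by apply: measurableT_comp => //; exact/measurable_EFinP.
  by apply: filterS fg => x + _ /= => ->.
case: ifPn => // _; apply: eq_ess_sup.
by apply: filterS fg => x /= ->.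
Qed.

(* MathComp-Analysis defines L^p (LspaceType: classes of measurable functions
   modulo a.e. equality) without its vector space structure, which is added
   here by transport from LfunType. *)
Section Lspace_lmodule.
Context d (T : measurableType d) (R : realType).
Variables (mu : {measure set T -> \bar R}) (p : \bar R) (p1 : (1 <= p)%E).

HB.instance Definition _ := gen_eqMixin (LspaceType mu p1).
HB.instance Definition _ := gen_choiceMixin (LspaceType mu p1).

Definition Lfun_mfun (f : LfunType mu p1) : {mfun T >-> measurableTypeR R} :=
  HB.pack (f : T -> measurableTypeR R)
   (isMeasurableFun.Build _ _ T (measurableTypeR R) f (measurable_funPT f)).

Definition Lfun_aeclass (f : LfunType mu p1) :
    {mfun_ mu, T >-> measurableTypeR R} :=
  \pi_({mfun_ mu, T >-> measurableTypeR R})%qT (Lfun_mfun f).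

Lemma Lspace_inj (u v : LspaceType mu p1) :
  u = v :> {mfun_ mu, T >-> measurableTypeR R} -> u = v.
Proof.
case: u v => [u [[uf]]] [v [[vf]]] /= uv; case: _ / uv in vf *.
by rewrite (Prop_irrelevance uf vf).
Qed.

Lemma aeclass_repr (f : {mfun T >-> measurableTypeR R}) :
  ((\pi_({mfun_ mu, T >-> measurableTypeR R})%qT f :
    {mfun_ mu, T >-> measurableTypeR R}) : T -> R) = f %[ae mu].
Proof.
rewrite /aqEqMfun_to_fun.
have : (repr (\pi_({mfun_ mu, T >-> measurableTypeR R})%qT f) = f
    %[mod {mfun_ mu, T >-> measurableTypeR R}])%qT.
  by rewrite reprK.
by move/eqmodP/asboolP.
Qed.

Lemma Lfun_aeclass_finite (f : LfunType mu p1) :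
  finite_norm mu p (Lfun_aeclass f : T -> R).
Proof.
rewrite /finite_norm (@eq_ae_Lnorm _ _ _ mu p _ f) //.
- exact: Lfunction_finite.
- exact: (measurable_funPT (repr (Lfun_aeclass f))).
- exact: aeclass_repr.
Qed.

Definition Lclass (f : LfunType mu p1) : LspaceType mu p1 :=
  HB.pack (Lfun_aeclass f)
    (isFinLebesgue.Build _ _ _ mu p p1 _ (Lfun_aeclass_finite f)).

Lemma Lspace_Lfun (u : LspaceType mu p1) : (u : T -> R) \in Lfun mu p.
Proof.
rewrite inE; apply/andP; split; rewrite inE /=.
  exact: (measurable_funPT (repr (u : {mfun_ mu, T >-> measurableTypeR R}))).
exact: Lebesgue_finite.
Qed.

Definition Lrepr (u : LspaceType mu p1) : LfunType mu p1 :=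
  Lfun_Sub p1 (Lspace_Lfun u).

Lemma Lclass_eq (f g : LfunType mu p1) : f = g %[ae mu] -> Lclass f = Lclass g.
Proof. by move=> fg; apply: Lspace_inj; apply/eqmodP/asboolP. Qed.

Lemma LreprK : cancel Lrepr Lclass.
Proof.
move=> u; apply: Lspace_inj => /=; rewrite /Lfun_aeclass.
rewrite -[RHS]reprK; apply/eqmodP/asboolP; exact: ae_eq_refl.
Qed.

Lemma LclassK f : (Lrepr (Lclass f) : T -> R) = f %[ae mu].
Proof. exact: aeclass_repr. Qed.


Lemma Lspace_eqP (u v : LspaceType mu p1) :
  u = v <-> (u : T -> R) = (v : T -> R) %[ae mu].
Proof.
split=> [->|uv]; first exact: ae_eq_refl.
by rewrite -(LreprK u) -(LreprK v); apply: Lclass_eq.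
Qed.

Let L := LspaceType mu p1.
Let zero : L := Lclass 0.
Let opp (u : L) : L := Lclass (- Lrepr u).
Let add (u v : L) : L := Lclass (Lrepr u + Lrepr v).
Let scale (a : R) (u : L) : L := Lclass (a *: Lrepr u).

Let addE f g : Lclass (f + g) = add (Lclass f) (Lclass g).
Proof.
apply: Lclass_eq; apply: filterS2 (LclassK f) (LclassK g) => x + + _ /=.
move=> /(_ Logic.I) fx /(_ Logic.I) gx.
by rewrite -[RHS]/(Lrepr (Lclass f) x + Lrepr (Lclass g) x) fx gx.
Qed.

Let scaleE a f : Lclass (a *: f) = scale a (Lclass f).
Proof.
apply: Lclass_eq; apply: filterS (LclassK f) => x + _ /=.
by move=> /(_ Logic.I) fx; rewrite -[RHS]/(a * Lrepr (Lclass f) x) fx.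
Qed.

Let addA : associative add.
Proof.
move=> u v w; rewrite -(LreprK u) -(LreprK v) -(LreprK w).
by rewrite -!addE addrA.
Qed.

Let addC : commutative add.
Proof. by move=> u v; rewrite /add addrC. Qed.

Let add0 : left_id zero add.
Proof. by move=> u; rewrite -(LreprK u) -addE add0r. Qed.

Let addN : left_inverse zero opp add.
Proof. by move=> u; rewrite /opp -{2}(LreprK u) -addE addNr. Qed.

HB.instance Definition _ :=
  GRing.isZmodule.Build (LspaceType mu p1) addA addC add0 addN.

Lemma LclassD f g : Lclass (f + g) = Lclass f + Lclass g.
Proof. exact: addE. Qed.

Let scaleA a b u : scale a (scale b u) = scale (a * b) u.
Proof. by rewrite -(LreprK u) -!scaleE scalerA. Qed.

Let scale1 : left_id 1 scale.
Proof. by move=> u; rewrite -(LreprK u) -!scaleE scale1r. Qed.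

Let scaleDr : right_distributive scale +%R.
Proof.
move=> a u v; rewrite -(LreprK u) -(LreprK v).
by rewrite -LclassD -!scaleE -LclassD scalerDr.
Qed.

Let scaleDl u : {morph scale^~ u : a b / a + b}.
Proof. by move=> a b; rewrite -(LreprK u) -!scaleE -!LclassD scalerDl. Qed.

HB.instance Definition _ :=
  GRing.Zmodule_isLmodule.Build R (LspaceType mu p1) scaleA scale1 scaleDr scaleDl.

Lemma LclassZ a f : Lclass (a *: f) = a *: Lclass f.
Proof. exact: scaleE. Qed.

End Lspace_lmodule.

Section Lspace_theory.
Context d (T : measurableType d) (R : realType).
Variables (mu : {measure set T -> \bar R}) (p : \bar R) (p1 : (1 <= p)%E).
Implicit Types u v : LspaceType mu p1.

Lemma Lspace_addE u v :
  ((u + v : LspaceType mu p1) : T -> R) = (fun x => u x + v x) %[ae mu].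
Proof. exact: LclassK. Qed.

Lemma Lspace_scaleE a u :
  ((a *: u : LspaceType mu p1) : T -> R) = (fun x => a * u x) %[ae mu].
Proof. exact: LclassK. Qed.

End Lspace_theory.

Record domain (R : realType) (d : nat) := Domain {
  domain_set :> set 'rV[R]_d;
  domain_open : open domain_set;
  domain_connected : connected domain_set
}.

Arguments domain_open {R d} _.

Section test_functions.
Context {R : realType} {d : nat}.
Implicit Types (phi : 'rV[R]_d -> R) (i : 'I_d).

Definition partial i phi : 'rV[R]_d -> R := 'D_(delta_mx 0 i) phi.

(* C^infinity: all iterated partial derivatives exist and are continuous. *)
Definition smooth phi := forall s : seq 'I_d,
  continuous (foldr partial phi s) /\
  forall i x, derivable (foldr partial phi s) x (delta_mx 0 i).

Definition supp phi := closure [set x | phi x != 0].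

Definition test_function (Omega : set 'rV[R]_d) phi :=
  [/\ smooth phi, compact (supp phi) & supp phi `<=` Omega].

Lemma partial_supp i phi x : ~ supp phi x -> partial i phi x = 0.
Proof.
move=> nx; rewrite /partial (@near_eq_derive _ _ _ phi (cst 0)) ?derive_cst//.
have : nbhs x (~` supp phi).
  by apply: open_nbhs_nbhs; split => //; exact/closed_openC/closed_closure.
apply: filterS => y ny; apply/eqP/negPn/negP => phiy; apply: ny.
exact: subset_closure.
Qed.

End test_functions.

Section Sobolev.
Context {R : realType} {d : nat} (Omega : domain R d).

Definition lebesgue_on : set 'rV[R]_d -> \bar R :=
  mrestr (lebesgue_rV R d) (open_measurable_mx (domain_open Omega)).

HB.instance Definition _ := Measure.on lebesgue_on.

(* The elements are classes of Borel functions defined on all of 'rV[R]_d, but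
   since lebesgue_on does not charge the complement of Omega, only the values
   on Omega matter. *)
Definition L2 := LspaceType2 lebesgue_on.
HB.instance Definition _ := GRing.Lmodule.on L2.

Definition L2norm (u : L2) : R := fine 'N[lebesgue_on]_2[EFin \o u]%E.

Definition weak_partial (i : 'I_d) (u g : L2) :=
  forall phi, test_function Omega phi ->
  \int[lebesgue_on]_x (u x * partial i phi x) =
  - \int[lebesgue_on]_x (g x * phi x).

Lemma bounded_supp_Lfun2 (psi : 'rV[R]_d -> R) (K : set 'rV[R]_d) :
  continuous psi -> compact K -> (forall x, ~ K x -> psi x = 0) ->
  psi \in Lfun lebesgue_on 2%:E.
Proof.
move=> cpsi cK psiK.
have [N NK] : exists N : R, forall x, K x -> forall i, `|x ord0 i| <= N.
  have [N [_ NK]] := compact_bounded cK.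
  exists (N + 1) => x Kx i.
  have := NK (N + 1) _ x Kx; rewrite ltrDl ltr01 => /(_ erefl).
  apply: le_trans; rewrite /Num.norm/= mx_normrE.
  by apply: (@le_bigmax _ _ _ 0
    (fun ij : 'I_1 * 'I_d => `|x ij.1 ij.2|) (ord0, i)).
have [M MK] : exists M : R, forall x, `|psi x| <= M.
  have /compact_bounded[M [_ MK]] : compact (psi @` K).
    by apply: continuous_compact => //; exact: continuous_subspaceT.
  exists (`|M| + 1) => x; have [Kx|/psiK ->] := pselect (K x); last first.
    by rewrite normr0 addr_ge0.
  apply: MK; last by exists x.
  by rewrite ltr_pwDr// ler_norm.
have mpsi : measurable_fun setT psi := continuous_measurable_mx cpsi.
rewrite inE; apply/andP; split; rewrite inE //=.
rewrite /finite_norm unlock /Lnorm poweR_lty//.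
pose a : 'rV[R]_d := const_mx (- `|N|); pose b : 'rV[R]_d := const_mx `|N|.
pose Q := [set x : 'rV[R]_d | forall i, a ord0 i <= x ord0 i <= b ord0 i].
have mQ : measurable Q := measurable_box a b.
apply: (@le_lt_trans _ _ (\int[lebesgue_on]_x ((M ^+ 2) * \1_Q x)%:E)%E).
  apply: ge0_le_integral => //=.
  - apply/measurable_EFinP; apply: (measurableT_comp (measurable_powR 2)).
    exact: measurableT_comp.
  - by apply/measurable_EFinP; apply: measurable_funM.
  move=> x _; rewrite lee_fin powR_mulrn//.
  have [Kx|/psiK ->] := pselect (K x); last first.
    by rewrite normr0 expr0n/= mulr_ge0 ?sqr_ge0.
  rewrite indicE mem_set ?mulr1.
    by rewrite lerXn2r ?nnegrE// (le_trans _ (MK x)).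
  move=> i; rewrite /a /b !mxE -ler_norml.
  exact: le_trans (NK x Kx i) (ler_norm _).
under eq_integral do rewrite EFinM.
rewrite ge0_integralZl//; last 2 first.
- exact/measurable_EFinP.
- by rewrite lee_fin sqr_ge0.
rewrite integral_indic// setIT lte_mul_pinfty ?lee_fin ?sqr_ge0//.
rewrite /lebesgue_on /mrestr.
apply: (@le_lt_trans _ _ (lebesgue_rV R d Q)).
  apply: le_measure; rewrite ?inE//.
  by apply: measurableI => //; apply: open_measurable_mx; exact: domain_open.
rewrite lebesgue_rV_box ?ltry// => i; rewrite !mxE.
by rewrite (le_trans _ (normr_ge0 N))// oppr_le0.
Qed.

Lemma test_Lfun2 phi : test_function Omega phi -> phi \in Lfun lebesgue_on 2%:E.
Proof.
move=> [sphi cphi _]; apply: (bounded_supp_Lfun2 _ cphi).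
  by have [] := sphi [::].
move=> x nx; apply/eqP/negPn/negP => phix; apply: nx.
exact: subset_closure.
Qed.

Lemma partial_test_Lfun2 i phi :
  test_function Omega phi -> partial i phi \in Lfun lebesgue_on 2%:E.
Proof.
move=> [sphi cphi _]; apply: (bounded_supp_Lfun2 _ cphi).
  by have [] := sphi [:: i].
by move=> x; exact: partial_supp.
Qed.

Lemma L2_mul_integrable (u : L2) psi : psi \in Lfun lebesgue_on 2%:E ->
  lebesgue_on.-integrable setT (EFin \o (fun x => u x * psi x)).
Proof.
move=> psi2; apply/Lfun1_integrable; apply: Lfun2_mul_Lfun1 => //.
exact: Lspace_Lfun.
Qed.

Lemma integral_L2P a (u v : L2) psi : psi \in Lfun lebesgue_on 2%:E ->
  \int[lebesgue_on]_x ((a *: u + v : L2) x * psi x) =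
  a * \int[lebesgue_on]_x (u x * psi x) + \int[lebesgue_on]_x (v x * psi x).
Proof.
move=> psi2.
have iu := L2_mul_integrable u psi2; have iv := L2_mul_integrable v psi2.
rewrite -RintegralZl// -RintegralD//; last exact: (integrableZl _ a iu).
congr fine; apply: ae_eq_integral => //.
- exact: measurable_int (L2_mul_integrable (a *: u + v) psi2).
- apply: measurable_int (integrableD _ (integrableZl _ a iu) iv) => //.
apply: filterS2 (Lspace_addE (a *: u) v) (Lspace_scaleE a u) => x.
by move=> /(_ Logic.I) + /(_ Logic.I) + _ => -> ->; rewrite mulrDl mulrA.
Qed.

Definition weakly_differentiable : {pred L2} :=
  [pred u | `[< forall i, exists g, weak_partial i u g >]].

Lemma weakly_differentiable_submod : submod_closed weakly_differentiable.
Proof.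
split=> [|a u v /asboolP du /asboolP dv]; apply/asboolP => i.
  have int0 psi : psi \in Lfun lebesgue_on 2%:E ->
      \int[lebesgue_on]_x ((0 : L2) x * psi x) = 0.
    move=> /(integral_L2P (-1) 0 0).
    by rewrite scaler0 addr0 mulN1r addNr.
  exists 0 => phi tphi.
  have t0 := test_Lfun2 tphi; have t1 := partial_test_Lfun2 i tphi.
  by rewrite !int0// oppr0.
have [g ug] := du i; have [h vh] := dv i.
exists (a *: g + h) => phi tphi.
have t0 := test_Lfun2 tphi; have t1 := partial_test_Lfun2 i tphi.
rewrite !integral_L2P//.
by rewrite ug// vh// opprD mulrN.
Qed.

HB.instance Definition _ := GRing.isSubmodClosed.Build R L2
  weakly_differentiable weakly_differentiable_submod.

Record H1 := MkH1 { H1val :> L2; _ : H1val \in weakly_differentiable }.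
HB.instance Definition _ := [isSub for H1val].
HB.instance Definition _ := [Choice of H1 by <:].
HB.instance Definition _ := [SubChoice_isSubLmodule of H1 by <:].

Definition H1_fun (u : H1) : 'rV[R]_d -> R := H1val u.
Coercion H1_fun : H1 >-> Funclass.

(* weak_partial i u has at most one element in L2 (fundamental lemma of the
   calculus of variations), so that the choice made by xget is immaterial. *)
Definition weak_derivative (i : 'I_d) (u : L2) : L2 :=
  xget 0 (weak_partial i u).

Definition H1norm (u : H1) : R :=
  Num.sqrt (L2norm u ^+ 2 + \sum_i L2norm (weak_derivative i u) ^+ 2).

End Sobolev.
Arguments L2 {R d} Omega.
Arguments H1 {R d} Omega.

HB.mixin Record CompleteNormedModule_isHilbert (R : realType) (V : Type)
    & CompleteNormedModule R V := {
  inner : V -> V -> R;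
  innerC : forall x y, inner x y = inner y x;
  inner_linearl : forall a x y z,
    inner (a *: x + y) z = a * inner x z + inner y z;
  innerxx : forall x, inner x x = `|x| ^+ 2
}.

#[short(type="hilbertType")]
HB.structure Definition Hilbert (R : realType) :=
  {V of CompleteNormedModule R V & CompleteNormedModule_isHilbert R V}.

(* The topological dual, with the operator norm. *)
Section dual.
Context {R : realType} {V : normedModType R}.

Definition continuous_functional : {pred V -> R^o} :=
  [pred f : V -> R^o | `[< linear f /\ continuous f >]].

Lemma continuous_functional_submod : submod_closed continuous_functional.
Proof.
split=> [|a f g /asboolP[lf cf] /asboolP[lg cg]]; apply/asboolP; split.
- by move=> k x y /=; rewrite scaler0 addr0.
- exact: cst_continuous.
- move=> k x y; rewrite !fctE lf lg.
  by rewrite !scalerDr !scalerA mulrC addrACA.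
move=> x; apply: continuousD; last exact: cg.
by apply: continuousZr; exact: cf.
Qed.

HB.instance Definition _ := GRing.isSubmodClosed.Build R (V -> R^o)
  continuous_functional continuous_functional_submod.

Record dual := MkDual {
  dual_fun :> V -> R^o;
  _ : dual_fun \in continuous_functional }.
HB.instance Definition _ := [isSub for dual_fun].
HB.instance Definition _ := [Choice of dual by <:].
HB.instance Definition _ := [SubChoice_isSubLmodule of dual by <:].

Definition dual_norm (f : dual) : R :=
  sup [set `|f x| | x in [set x : V | `|x| <= 1]].

Lemma dual_linear (f : dual) : linear f.
Proof. by have /asboolP[] := valP f. Qed.

Lemma dual_continuous (f : dual) : continuous f.
Proof. by have /asboolP[] := valP f. Qed.

Let dual_lin (f : dual) : {linear V -> R^o} :=
  HB.pack (f : V -> R^o) (GRing.isLinear.Build _ _ _ _ _ (dual_linear f)).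

Lemma dual_has_sup (f : dual) :
  has_sup [set `|f x| | x in [set x : V | `|x| <= 1]].
Proof.
have /linear_bounded_continuous/bounded_funP/(_ 1)[M fM] :
  continuous (dual_lin f) by exact: dual_continuous.
split; first by exists `|f 0|, 0 => //=; rewrite normr0.
by exists M => _ [x /= x1 <-]; exact: fM.
Qed.

Lemma dual_norm_ub (f : dual) x : `|x| <= 1 -> `|f x| <= dual_norm f.
Proof.
move=> x1; apply: ub_le_sup; first by have [] := dual_has_sup f.
by exists x.
Qed.

Let nD (f g : dual) : dual_norm (f + g) <= dual_norm f + dual_norm g.
Proof.
apply: sup_le_ub; first by have [] := dual_has_sup (f + g).
move=> _ [x /= x1 <-]; apply: le_trans (ler_normD _ _) _.
by rewrite lerD// dual_norm_ub.
Qed.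

Let nZle a (f : dual) : dual_norm (a *: f) <= `|a| * dual_norm f.
Proof.
apply: sup_le_ub; first by have [] := dual_has_sup (a *: f).
move=> _ [x /= x1 <-]; rewrite normrM ler_wpM2l//.
exact: dual_norm_ub.
Qed.

Let n0 (f : dual) : dual_norm f = 0 -> f = 0.
Proof.
move=> f0; apply/val_inj/funext => x /=.
have [->|x0] := eqVneq x 0.
  exact: (linear0 (dual_lin f)).
have := @dual_norm_ub f (`|x|^-1 *: x).
rewrite normrZ normfV normr_id mulVf ?normr_eq0// lexx f0 => /(_ erefl).
have -> : f (`|x|^-1 *: x) = `|x|^-1 *: f x := linearZ_LR (dual_lin f) _ _.
rewrite normr_le0 scaler_eq0 invr_eq0 normr_eq0.
by rewrite (negbTE x0) => /eqP.
Qed.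

Let nZ a (f : dual) : dual_norm (a *: f) = `|a| * dual_norm f.
Proof.
apply/eqP; rewrite eq_le nZle/=.
have [->|a0] := eqVneq a 0.
  rewrite normr0 mul0r; apply: le_trans (normr_ge0 ((0 *: f : dual) 0)) _.
  by apply: dual_norm_ub; rewrite normr0.
rewrite -ler_pdivlMl ?normr_gt0//.
have := nZle a^-1 (a *: f).
by rewrite scalerA mulVf// scale1r normfV.
Qed.

HB.instance Definition _ := Lmodule_isNormed.Build R dual nD nZ n0.

End dual.
Arguments dual {R} V.

Section problem.
Context {R : realType}.

Definition dotv d (x y : 'rV[R]_d) : R := \sum_i x ord0 i * y ord0 i.

Definition enorm d (x : 'rV[R]_d) : R := Num.sqrt (dotv x x).

Definition angle d (x y : 'rV[R]_d) : R :=
  acos (dotv x y / (enorm x * enorm y)).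

(* Finite cone with vertex 0, axis direction v, height rho and aperture angle
   kappa. In cone_condition, rho and kappa do not depend on x, i.e. the cones
   x + finite_cone v rho kappa are all congruent. *)
Definition finite_cone d (v : 'rV[R]_d) (rho kappa : R) : set 'rV[R]_d :=
  [set y | y = 0 \/ 0 < enorm y <= rho /\ angle y v <= kappa / 2].

Definition cone_condition d (Omega : set 'rV[R]_d) :=
  exists rho kappa, [/\ 0 < rho, 0 < kappa <= pi &
    forall x, Omega x -> exists2 v, v != 0 &
      [set x + y | y in finite_cone v rho kappa] `<=` Omega].

(* The norms are explicit arguments because H1 carries H1norm but no
   normedModType instance. *)
Definition bounded_operator (X Y : Type) (normX : X -> R) (normY : Y -> R)
  (f : X -> Y) := exists M, forall x, normY (f x) <= M * normX x.

Definition bounded_isomorphism (X Y : Type) (normX : X -> R) (normY : Y -> R)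
    (f : X -> Y) :=
  bounded_operator normX normY f /\
  exists g, [/\ cancel f g, cancel g f & bounded_operator normY normX g].

Section J.
Variables (d : nat) (Omega : domain R d).

Definition complementarity_set : set (H1 Omega * H1 Omega) :=
  [set wz : H1 Omega * H1 Omega |
    {ae lebesgue_rV R d, forall x, domain_set Omega x ->
    [/\ 0 <= wz.1 x, 0 <= wz.2 x & wz.1 x * wz.2 x = 0]}].

Definition J (alpha1 alpha2 eps : R) (u v : H1 Omega) : R :=
  alpha1 / 2 * L2norm u ^+ 2 + alpha2 / 2 * L2norm v ^+ 2 +
  eps / 2 * (H1norm u ^+ 2 + H1norm v ^+ 2).

End J.

Section ocp.
Variables (d : nat) (Omega : domain R d) (Y DD : hilbertType R) (yd : DD).
Variables (A : Y -> dual Y) (B C : H1 Omega -> dual Y) (D : Y -> DD).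
Variables (alpha1 alpha2 eps : R).

Definition feasible (y : Y) (u v : H1 Omega) : Prop :=
  A y - B u - C v = 0 /\ complementarity_set (u, v).

Definition objective (y : Y) (u v : H1 Omega) : R :=
  2^-1 * `|D y - yd| ^+ 2 + J alpha1 alpha2 eps u v.

End ocp.
End problem.

(* Main.v *)
(* Eliminating y = A^-1 (B u + C v) leaves a coercive convex quadratic functional
   of (u, v) in H^1 x H^1. A minimising sequence has a weak limit along an
   ultrafilter on nat, by Riesz representation, and the functional dominates its
   tangents, so only the weak closedness of the complementarity set is at stake.
   Instead of Rellich's theorem this uses Poincare's inequality on small boxes:
   it compares the integral of u v over a box with the product of the means of u
   and v, up to the squared size of the box times the gradient energies. Means
   converge along weakly convergent sequences, so u_n v_n = 0 yields
   int uv <= K delta^2 on boxes of size delta, hence, by bisection, on every box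
   in the domain, and int uv <= 0 as delta goes to 0. *)

Require Import Defs.
From mathcomp Require Import all_boot all_order all_algebra.
From mathcomp Require Import all_classical all_reals all_analysis.
From mathcomp Require Import measurable_realfun ring lra.

Set Implicit Arguments.
Unset Strict Implicit.
Unset Printing Implicit Defensive.

Import Order.TTheory GRing.Theory Num.Theory.
Import numFieldNormedType.Exports.

Local Open Scope classical_set_scope.
Local Open Scope ring_scope.

(** * Inner product spaces *)

(** The bisection scheme serves twice, for Poincare's inequality itself and for the final bound on
    the integral of [u v]. It needs error terms that are additive when a box is halved. This is why
    an ultrafilter is fixed beforehand: the energies of [u_n] and [v_n] then converge on all boxes
    at once, without extraction of subsequences, and uniqueness of limits makes the limiting
    energies additive. Nothing links them to the energies of the limit pair; it is enough that their
    sum over many small boxes is a fixed number, against which the factor delta^2 wins. Poincare's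
    inequality for weak derivatives rests on comparing the integrals over two halves of a box, by
    means of one test function. Halving a side of length l costs at most l^2 times the directional
    energy, while the energy weighted by squared sides drops by 3/4 l^2 times it. Hence twice the
    weighted energy pays for all halvings, and this is the origin of the constant 2. On the smallest
    boxes the function is close to a constant, since continuous functions are dense in L^2. *)

Lemma discriminant_le (R : realFieldType) (a b c : R) : 0 <= a ->
  (forall t, 0 <= a * t ^+ 2 - 2 * b * t + c) -> b ^+ 2 <= a * c.
Proof.
move=> a0 h; have [a_0|aN0] := eqVneq a 0.
  suff -> : b = 0 by rewrite a_0 mul0r expr0n.
  apply/eqP; apply: contraT => b0.
  (* At this point the affine function [c - 2 * b * t] equals -1. *)
  have := h ((c + 1) / (2 * b)); rewrite a_0 mul0r sub0r.
  have -> : 2 * b * ((c + 1) / (2 * b)) = c + 1 by field.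
  lra.
have a_gt0 : 0 < a by rewrite lt0r aN0.
(* The minimum of the quadratic polynomial is attained at [b / a]. *)
have := h (b / a).
have -> : a * (b / a) ^+ 2 - 2 * b * (b / a) + c = (a * c - b ^+ 2) / a by field.
by rewrite pmulr_lge0 ?invr_gt0// subr_ge0.
Qed.

Section inner_product_space.
Context {R : realType} {V : lmodType R}.

(** Positivity is only semidefinite, so that the notion survives pulling back along linear maps. *)
Record inner_product (ip : V -> V -> R) : Prop := InnerProduct {
  ipC : forall x y, ip x y = ip y x;
  ip_linearl : forall a x y z, ip (a *: x + y) z = a * ip x z + ip y z;
  ip_ge0 : forall x, 0 <= ip x x }.

(** Cauchy sequences and limits are measured by the quadratic form itself, because [H1] has no
    normed module instance. [bounded_functional] squares its bound for the same reason. *)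
Definition ip_complete (ip : V -> V -> R) := forall x : nat -> V,
  (forall e, 0 < e -> exists N, forall m n, (N <= m)%N -> (N <= n)%N ->
    ip (x m - x n) (x m - x n) <= e) ->
  exists l, forall e, 0 < e -> exists N, forall n, (N <= n)%N ->
    ip (x n - l) (x n - l) <= e.

Definition bounded_functional (ip : V -> V -> R) (l : V -> R) :=
  (forall a x y, l (a *: x + y) = a * l x + l y) /\
  exists M, forall x, l x ^+ 2 <= M * ip x x.

Variable ip : V -> V -> R.
Hypothesis ipP : inner_product ip.

Local Notation q x := (ip x x).

Lemma ip0l z : ip 0 z = 0.
Proof.
by have := ip_linearl ipP 1 0 0 z; rewrite scaler0 addr0 mul1r; lra.
Qed.
Lemma ipDl x y z : ip (x + y) z = ip x z + ip y z.
Proof. by rewrite -{1}(scale1r x) (ip_linearl ipP) mul1r. Qed.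
Lemma ipZl a x z : ip (a *: x) z = a * ip x z.
Proof. by rewrite -[a *: x]addr0 (ip_linearl ipP) ip0l addr0. Qed.
Lemma ipDr x y z : ip z (x + y) = ip z x + ip z y.
Proof. by rewrite !(ipC ipP z) ipDl. Qed.
Lemma ipZr a x z : ip z (a *: x) = a * ip z x.
Proof. by rewrite !(ipC ipP z) ipZl. Qed.
Lemma ipNl x z : ip (- x) z = - ip x z.
Proof. by rewrite -scaleN1r ipZl mulN1r. Qed.
Lemma ipNr x z : ip z (- x) = - ip z x.
Proof. by rewrite -scaleN1r ipZr mulN1r. Qed.

Definition ipE := (ipDl, ipDr, ipZl, ipZr, ipNl, ipNr).

Lemma cauchy_schwarz x y : ip x y ^+ 2 <= q x * q y.
Proof.
apply: discriminant_le => [|t]; first exact: (ip_ge0 ipP).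
have := ip_ge0 ipP (t *: x - y).
rewrite !ipE (ipC ipP y x); congr (_ <= _); ring.
Qed.

Lemma ip_parallelogram x y : q (x + y) + q (x - y) = 2 * q x + 2 * q y.
Proof. rewrite !ipE (ipC ipP y x); ring. Qed.

Lemma bounded_functional0 l : bounded_functional ip l -> l 0 = 0.
Proof. by move=> [ll _]; have := ll 1 0 0; rewrite scaler0 addr0; lra. Qed.

Lemma bounded_functionalD l x y : bounded_functional ip l ->
  l (x + y) = l x + l y.
Proof. by move=> [ll _]; rewrite -{1}(scale1r x) ll mul1r. Qed.

Lemma bounded_functionalZ l a x : bounded_functional ip l ->
  l (a *: x) = a * l x.
Proof.
by move=> bl; have [ll _] := bl; rewrite -[a *: x]addr0 ll bounded_functional0// addr0.
Qed.

Lemma ip_bounded_functional z : bounded_functional ip (ip z).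
Proof.
split=> [a x y|]; first by rewrite !ipE.
by exists (q z) => x; exact: cauchy_schwarz.
Qed.

Hypothesis ip_cplt : ip_complete ip.

(* A minimising sequence in S of z |-> |z|^2 - 2 l z is Cauchy by the
   parallelogram law; l = ip u gives the projection of u on the closure of S. *)
Lemma riesz_closure (S : {pred V}) (l : V -> R) : submod_closed S ->
  bounded_functional ip l ->
  exists z, (forall e, 0 < e -> exists2 s, s \in S & q (z - s) <= e) /\
    forall s, s \in S -> l s = ip z s.
Proof.
move=> [S0 SL] bl; have [ll [M0 lM0]] := bl.
pose M := `|M0|; have lM x : l x ^+ 2 <= M * q x.
  by rewrite (le_trans (lM0 x))// ler_wpM2r ?(ip_ge0 ipP)// ler_norm.
have M_ge0 : 0 <= M by rewrite normr_ge0.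
pose G z := q z - 2 * l z.
(* From [l z ^+ 2 <= M * q z] and the arithmetic-geometric mean inequality, [2 * l z <= M + q z]. *)
have G_lb z : - M <= G z.
  have := lM z; have := ip_ge0 ipP z; rewrite /G => q0 h.
  suff : 2 * l z <= M + q z by lra.
  rewrite leNgt; apply/negP => h1.
  have : 0 < (2 * l z - (M + q z)) * (2 * l z + (M + q z)) by apply: mulr_gt0; lra.
  have := sqr_ge0 (M - q z); nra.
pose E := [set G s | s in [set s | s \in S]].
have infE : has_inf E by split; [exists (G 0), 0 | exists (- M) => _ [s _ <-]].
pose I := inf E.
have GI s : s \in S -> I <= G s by move=> Ss; apply: ge_inf; [exact: infE.2|exists s].
have [s_ s_P] : {s_ : nat -> V &
    forall n, s_ n \in S /\ G (s_ n) <= I + n.+1%:R^-1}.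
  apply: (@choice _ _ (fun n s => s \in S /\ G s <= I + n.+1%:R^-1)) => n.
  have n0 : 0 < n.+1%:R^-1 :> R by rewrite invr_gt0.
  have [_ [s Ss <-] Gs] := inf_adherent n0 infE.
  by exists s; split => //; exact: ltW.
have s_S n : s_ n \in S by have [] := s_P n.
have s_G n : G (s_ n) <= I + n.+1%:R^-1 by have [] := s_P n.
have small e : 0 < e -> exists N, forall n, (N <= n)%N -> n.+1%:R^-1 <= e :> R.
  move=> e0; exists (Num.truncn e^-1) => n Nn.
  rewrite -[leRHS]invrK lef_pV2 ?posrE ?invr_gt0//.
  by rewrite (le_trans (ltW (truncnS_gt _)))// ler_nat.
have [e e0|z zlim] := ip_cplt (x := s_).
  have e4 : 0 < e / 4 by lra.
  have [N NP] := small _ e4; exists N => m n Nm Nn.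
  (* By the parallelogram law [G] at the midpoint is the mean of [G (s_ m)] and [G (s_ n)] minus a
     quarter of the squared distance. As it is at least [I], the squared distance is at most twice
     the sum of the two errors, hence the choice [e / 4]. *)
  have mid : 2^-1 *: (s_ m + s_ n) \in S.
    rewrite -[_ *: _]addr0; apply: (SL) => //.
    by rewrite -(scale1r (s_ m)); exact: (SL).
  have := GI _ mid; have := s_G m; have := s_G n; have := NP _ Nm; have := NP _ Nn.
  have := ip_parallelogram (s_ m) (s_ n).
  rewrite /G !ipZl !ipZr (bounded_functionalZ _ _ bl) (bounded_functionalD _ _ bl).
  move: n.+1%:R^-1 m.+1%:R^-1 => a b; lra.
exists z; split=> [e e0|s Ss].
  have [N NP] := zlim _ e0; exists (s_ N) => //.
  by rewrite -opprB ipNl ipNr opprK NP.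
apply/eqP; rewrite -subr_eq0 -sqrf_eq0 eq_le sqr_ge0 andbT.
apply/ler_addgt0Pr => e e0; rewrite add0r.
have q0 := ip_ge0 ipP s.
(* The difference splits into two terms whose squares are at most [q s * d] each, so its square is
   at most [4 * q s * d]; the [+ 1] keeps the denominator positive. *)
have d0 : 0 < e / (4 * (q s + 1)) by rewrite divr_gt0//; lra.
have [N1 N1P] := zlim _ d0; have [N2 N2P] := small _ d0.
pose n := maxn N1 N2.
have {N1P} := N1P n (leq_maxl _ _); have {N2P} := N2P n (leq_maxr _ _).
set d := _ / _ in d0 * => dn dz.
have dE : e = 4 * (q s + 1) * d by rewrite /d; field; lra.
(* Approximate Euler equation: [I <= G (t *: s + s_ n)] for all [t], with [G (s_ n) <= I + d], is a
   nonnegative quadratic polynomial in [t]. *)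
have c1 : (l s - ip (s_ n) s) ^+ 2 <= q s * d.
  apply: discriminant_le => // t.
  have /GI : t *: s + s_ n \in S by exact: (SL).
  have := s_G n; rewrite /G ll !ipE (ipC ipP s (s_ n)).
  move: dn; move: n.+1%:R^-1 => a; lra.
have c2 := le_trans (cauchy_schwarz (s_ n - z) s) (ler_wpM2r q0 dz).
rewrite ipDl ipNl in c2.
have -> : l s - ip z s = (l s - ip (s_ n) s) + (ip (s_ n) s - ip z s) by ring.
have := sqr_ge0 ((l s - ip (s_ n) s) - (ip (s_ n) s - ip z s)).
nra.
Qed.

Lemma riesz_representation l : bounded_functional ip l ->
  exists z, forall x, l x = ip z x.
Proof.
move=> bl; have SV : submod_closed (predT : {pred V}) by [].
by have [z [_ zP]] := riesz_closure SV bl; exists z => x; exact: zP.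
Qed.

End inner_product_space.

(** * Weak limits along an ultrafilter *)

Section ultralimits.
Context {R : realType}.

(** The image of an ultrafilter is an ultrafilter, and this one lives on the compact segment from
    [- M] to [M]. *)
Lemma ultralimit (U : set_system nat) (a : nat -> R) (M : R) : UltraFilter U ->
  (forall n, `|a n| <= M) -> exists l : R, a @ U --> l.
Proof.
move=> UU aM.
have := @segment_compact R (- M) M; rewrite compact_ultra.
have aU : UltraFilter (a @ U).
  split=> [|G GP aG]; first exact: fmap_proper_filter.
  apply/seteqP; split => // A GA /=.
  have [//|UA] := in_ultra_setVsetC (a @^-1` A) UU.
  have : G (~` A) by exact: aG.
  move=> /(filterI GA); rewrite setICr => G0.
  by have := @filter_not_empty _ G _ G0.
move=> /(_ (a @ U) aU)[|l [_ al]]; last by exists l.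
by apply: (@filterE _ U) => n; rewrite /= in_itv/= -ler_norml.
Qed.

(** For every [z] the bounded sequence [ip z (x n)] converges along [U]. The limit is linear in [z],
    and its square is at most [M * ip z z], so Riesz representation yields [x0]. A second use of
    Riesz writes every bounded functional as some [ip z]. *)
Lemma weak_ultralimit (V : lmodType R) (ip : V -> V -> R) (U : set_system nat)
    (x : nat -> V) (M : R) : UltraFilter U ->
  inner_product ip -> ip_complete ip -> (forall n, ip (x n) (x n) <= M) ->
  exists x0, forall l, bounded_functional ip l -> (l \o x) @ U --> l x0.
Proof.
move=> UU ipP cplt xM.
have bnd l : bounded_functional ip l -> exists M', forall n, `|l (x n)| <= M'.
  move=> [_ [K lK]]; exists (1 + `|K| * M) => n.
  have := le_trans (lK (x n)) (ler_wpM2r (ip_ge0 ipP _) (ler_norm K)).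
  have := ler_wpM2l (normr_ge0 K) (xM n).
  rewrite -real_normK ?num_real//; have := normr_ge0 (l (x n)).
  move: `|l _| => t *; nra.
have [L LP] : {L : V -> R & forall z, (ip z \o x) @ U --> L z}.
  apply: (@choice _ _ (fun z l => (ip z \o x) @ U --> (l : R))) => z.
  have [M' M'P] := bnd _ (ip_bounded_functional ipP z).
  by apply: ultralimit M'P.
have UP : ProperFilter U by exact: ultra_proper.
have uniq z l : (ip z \o x) @ U --> l -> l = L z.
  by move=> zl; apply: (cvg_unique _ zl (LP z)).
have bL : bounded_functional ip L.
  split=> [a y z|]; first apply/esym/uniq.
    have -> : ip (a *: y + z) \o x = (fun n => a * (ip y \o x) n + (ip z \o x) n).
      by apply/funext => n /=; rewrite (ip_linearl ipP).
    by apply: cvgD; [exact: cvgMr|exact: LP].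
  exists M => z.
  have Lz2 : (fun n => ip z (x n) * ip z (x n)) @ U --> L z * L z.
    by apply: cvgM; exact: LP.
  rewrite expr2 -(cvg_lim _ Lz2)//; apply: limr_le.
    by apply/cvg_ex; exists (L z * L z).
  apply: nearW => n; rewrite -expr2 (le_trans (cauchy_schwarz ipP _ _))//.
  by rewrite mulrC ler_wpM2r// (ip_ge0 ipP).
have [x0 x0P] := riesz_representation ipP cplt bL; exists x0 => l bl.
have [z zP] := riesz_representation ipP cplt bl.
have -> : l \o x = ip z \o x by apply/funext => n; exact: zP.
by rewrite zP (ipC ipP) -x0P; exact: LP.
Qed.

End ultralimits.

(** * The Hilbert space L^2 *)

Section Lfun2.
Context d (T : measurableType d) (R : realType).
Variable mu : {measure set T -> \bar R}.
Implicit Types f g : T -> R.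

Lemma Lfun_measurable (p : \bar R) f : f \in Lfun mu p -> measurable_fun setT f.
Proof. by move=> /sub_Lfun_mfun; rewrite inE. Qed.

Lemma Lfun2_linear a f g : f \in Lfun mu 2%:E -> g \in Lfun mu 2%:E ->
  (fun x => a * f x + g x) \in Lfun mu 2%:E.
Proof.
by have [_] := Lfun_submod_closed mu (lee1n 2 : (1 <= 2%:E :> \bar R)%E); exact.
Qed.

Lemma Lfun2P f : measurable_fun setT f ->
  (\int[mu]_x (f x ^+ 2)%:E < +oo)%E -> f \in Lfun mu 2%:E.
Proof.
move=> mf foo; rewrite inE; apply/andP; split; rewrite inE//=.
rewrite /finite_norm unlock /Lnorm poweR_lty//.
apply: le_lt_trans foo; rewrite le_eqVlt; apply/orP; left; apply/eqP.
by apply: eq_integral => x _; rewrite /= powR_mulrn// real_normK ?num_real.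
Qed.

Lemma Lfun2_mul_integrable f g : f \in Lfun mu 2%:E -> g \in Lfun mu 2%:E ->
  mu.-integrable setT (EFin \o (fun x => f x * g x)).
Proof. by move=> f2 g2; apply/Lfun1_integrable; exact: Lfun2_mul_Lfun1. Qed.

Lemma ae_eq_Rintegral (D : set T) f g : measurable D ->
  measurable_fun D f -> measurable_fun D g ->
  {ae mu, forall x, D x -> f x = g x} ->
  \int[mu]_(x in D) f x = \int[mu]_(x in D) g x.
Proof.
move=> mD mf mg fg; congr fine; apply: ae_eq_integral => //.
- exact/measurable_EFinP.
- exact/measurable_EFinP.
- by apply: filterS fg => x h Dx; rewrite h.
Qed.

End Lfun2.

Section L2_inner_product.
Context d (T : measurableType d) (R : realType).
Variable mu : {measure set T -> \bar R}.
Local Notation L := (LspaceType mu (lee1n 2)).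
Implicit Types u v w : L.

Definition dot u v : R := \int[mu]_x (u x * v x).

Definition mkL2 (f : T -> R) (f2 : f \in Lfun mu 2%:E) : L :=
  Lclass (Lfun_Sub (lee1n 2) f2).

Lemma mkL2E f (f2 : f \in Lfun mu 2%:E) : (mkL2 f2 : T -> R) = f %[ae mu].
Proof. exact: LclassK. Qed.

Lemma L2_Lfun u : (u : T -> R) \in Lfun mu 2%:E.
Proof. exact: Lspace_Lfun. Qed.

Lemma L2_measurable u : measurable_fun setT u.
Proof. exact: Lfun_measurable (L2_Lfun u). Qed.

Lemma L2_integrableM u v : mu.-integrable setT (EFin \o (fun x => u x * v x)).
Proof. by apply: Lfun2_mul_integrable; exact: L2_Lfun. Qed.

Lemma L2_linearE a u v :
  ((a *: u + v : L) : T -> R) = (fun x => a * u x + v x) %[ae mu].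
Proof.
apply: filterS2 (Lspace_addE (a *: u) v) (Lspace_scaleE a u) => x.
by move=> /(_ Logic.I) + /(_ Logic.I) + _ => -> ->.
Qed.

Lemma L2_subE u v : ((u - v : L) : T -> R) = (fun x => u x - v x) %[ae mu].
Proof.
rewrite addrC -scaleN1r; apply: filterS (L2_linearE (-1) v u) => x h Dx.
by rewrite h// mulN1r addrC.
Qed.

Lemma dot_ae u v (f : T -> R) : measurable_fun setT f -> (v : T -> R) = f %[ae mu] ->
  dot u v = \int[mu]_x (u x * f x).
Proof.
move=> mf vf; apply: ae_eq_Rintegral => //.
- by apply: measurable_funM; exact: L2_measurable.
- by apply: measurable_funM => //; exact: L2_measurable.
- by apply: filterS vf => x h Dx; rewrite h.
Qed.

Lemma dot_inner_product : inner_product dot.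
Proof.
split=> [u v|a u v w|u].
- by apply: eq_Rintegral => x _; rewrite mulrC.
- have iu := L2_integrableM u w; have iv := L2_integrableM v w.
  rewrite /dot -RintegralZl// -RintegralD//; last exact: (integrableZl _ a iu).
  apply: ae_eq_Rintegral => //.
  + by apply: measurable_funM; exact: L2_measurable.
  + apply: measurable_funD; last by apply: measurable_funM; exact: L2_measurable.
    apply: measurable_funM => //.
    by apply: measurable_funM; exact: L2_measurable.
  + by apply: filterS (L2_linearE a u v) => x h Dx; rewrite h// mulrDl mulrA.
- by apply: Rintegral_ge0 => x _; rewrite -expr2 sqr_ge0.
Qed.

Lemma dotE_sqr u : (dot u u)%:E = (\int[mu]_x (u x ^+ 2)%:E)%E.
Proof.
rewrite -[RHS]fineK; last first.
  have := integrable_fin_num measurableT (L2_integrableM u u).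
  by under eq_integral do rewrite /= -expr2.
by congr (fine _)%:E; apply: eq_integral => x _; rewrite expr2.
Qed.

Lemma Lnorm2_sqr u : fine ('N[mu]_2[EFin \o u])%E ^+ 2 = dot u u.
Proof.
have -> : ('N[mu]_2[EFin \o u])%E = ((dot u u) `^ 2^-1)%:E.
  rewrite unlock /Lnorm -poweR_EFin dotE_sqr; congr (_ `^ _)%E.
  by apply: eq_integral => x _; rewrite /= powR_mulrn// real_normK ?num_real.
rewrite /= powR12_sqrt ?(ip_ge0 dot_inner_product)// sqr_sqrtr//.
exact: (ip_ge0 dot_inner_product).
Qed.

Lemma L2_0E : ((0 : L) : T -> R) = cst 0 %[ae mu].
Proof.
apply: filterS (Lspace_scaleE 0 (0 : L)) => x + Dx; rewrite scale0r => ->//.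
by rewrite mul0r.
Qed.

Lemma dot_eq0 u : dot u u = 0 -> u = 0.
Proof.
move=> u0; apply/Lspace_eqP.
have : (\int[mu]_x `|(u x ^+ 2)%:E| = 0)%E.
  under eq_integral do rewrite gee0_abs ?lee_fin ?sqr_ge0//.
  by rewrite -dotE_sqr u0.
have mu2 : measurable_fun setT (fun x => (u x ^+ 2)%:E).
  by apply/measurable_EFinP; apply: measurable_funX; exact: L2_measurable.
move/(ae_eq_integral_abs mu measurableT mu2) => u20.
apply: filterS2 u20 L2_0E => x hu hz Dx; rewrite hz//.
by have := hu Dx => -[] /eqP; rewrite sqrf_eq0 => /eqP.
Qed.

(* Riesz-Fischer. A subsequence with |v_(k+1) - v_k|^2 <= 16^-k satisfies
   sum_k 4^k (v_(k+1) - v_k)^2 < oo a.e., hence is pointwise Cauchy a.e.;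
   Fatou's lemma makes its limit a limit in L^2. *)
Lemma dot_complete : ip_complete dot.
Proof.
move=> u uC.
have [N_ N_P] : {N_ : nat -> nat & forall k m n, (N_ k <= m)%N -> (N_ k <= n)%N ->
    dot (u m - u n) (u m - u n) <= 16^-1 ^+ k}.
  apply: (@choice _ _ (fun k N => forall m n, (N <= m)%N -> (N <= n)%N ->
    dot (u m - u n) (u m - u n) <= 16^-1 ^+ k)) => k.
  by apply: uC; rewrite exprn_gt0// invr_gt0.
(* Running maximum of [N_]: both [v k] and [v k.+1] then lie beyond [N_ k]. *)
pose idx := fix idx k := if k is k'.+1 then maxn (idx k') (N_ k) else N_ 0%N.
have N_idx k : (N_ k <= idx k)%N by case: k => //= k; exact: leq_maxr.
have idxS k : (idx k <= idx k.+1)%N by exact: leq_maxl.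
have idx_mono k m : (k <= m)%N -> (idx k <= idx m)%N.
  elim: m => [|m IH]; first by rewrite leqn0 => /eqP ->.
  rewrite leq_eqVlt => /predU1P[->//|/IH h]; exact: leq_trans (idxS _).
pose v k := u (idx k).
have v_fast k : dot (v k.+1 - v k) (v k.+1 - v k) <= 16^-1 ^+ k.
  by apply: N_P; rewrite ?N_idx// (leq_trans (N_idx k)).
pose g k x := (4 ^+ k * (v k.+1 x - v k x) ^+ 2)%:E : \bar R.
have mv k : measurable_fun setT (v k) by exact: L2_measurable.
have mg k : measurable_fun setT (g k).
  apply/measurable_EFinP; apply: measurable_funM => //.
  by apply: measurable_funX; apply: measurable_funB; exact: mv.
have g0 k x : setT x -> (0 <= g k x)%E.
  by move=> _; rewrite lee_fin; apply: mulr_ge0; [rewrite exprn_ge0|exact: sqr_ge0].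
have dotB w1 w2 : (\int[mu]_x ((w1 x - w2 x) ^+ 2)%:E)%E = (dot (w1 - w2) (w1 - w2))%:E.
  rewrite dotE_sqr; apply: ae_eq_integral => //.
  - apply/measurable_EFinP; apply: measurable_funX.
    by apply: measurable_funB; exact: L2_measurable.
  - by apply/measurable_EFinP; apply: measurable_funX; exact: L2_measurable.
  - by apply: filterS (L2_subE w1 w2) => x h Dx; rewrite h.
have intg k : (\int[mu]_x g k x <= (4^-1 ^+ k)%:E)%E.
  rewrite /g; under eq_integral do rewrite EFinM.
  rewrite ge0_integralZl//; last 2 first.
  - apply/measurable_EFinP; apply: measurable_funX.
    by apply: measurable_funB; exact: mv.
  - by move=> x _; rewrite lee_fin sqr_ge0.
  rewrite dotB -EFinM lee_fin.
  apply: (le_trans (ler_wpM2l _ (v_fast k))); first by rewrite exprn_ge0.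
  by rewrite -exprMn (_ : 4 * 16^-1 = 4^-1 :> R)//; lra.
have sumg : (\int[mu]_x (\sum_(k <oo) g k x) < +oo)%E.
  rewrite integral_nneseries//.
  apply: (@le_lt_trans _ _ 2%:E); last exact: ltry.
  apply: lime_le.
    by apply: is_cvg_nneseries => k _ _; apply: integral_ge0 => x; exact: g0.
  (* An explicit majorant of the partial sums that goes through the induction, because 4^-n is at
     most 2 (4^-n - 4^-(n+1)). *)
  apply: nearW => n; apply: (@le_trans _ _ (2 - 2 * 4^-1 ^+ n)%:E); last first.
    by rewrite lee_fin gerBl mulr_ge0 ?exprn_ge0.
  elim: n => [|n IH]; first by rewrite big_nil expr0 lee_fin; lra.
  rewrite big_nat_recr//=; apply: (le_trans (leeD IH (intg n))).
  have : 0 <= 4^-1 ^+ n :> R by rewrite exprn_ge0.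
  by rewrite -EFinD lee_fin exprS; move: (4^-1 ^+ n) => a; lra.
have : {ae mu, forall x, setT x -> (\sum_(k <oo) g k x)%E \is a fin_num}.
  apply: (integrable_ae measurableT); apply/integrableP; split.
    by apply: ge0_emeasurable_sum => *; [exact: g0|exact: mg].
  apply: le_lt_trans sumg; rewrite le_eqVlt; apply/orP; left; apply/eqP.
  by apply: eq_integral => x _; rewrite gee0_abs// nneseries_ge0// => *; exact: g0.
move=> gfin.
have vcvg : {ae mu, forall x, cvgn (fun k => v k x)}.
  apply: filterS gfin => x /(_ Logic.I) xfin.
  pose S := fine (\sum_(k <oo) g k x)%E.
  have gS k : 4 ^+ k * (v k.+1 x - v k x) ^+ 2 <= S.
    rewrite -lee_fin fineK//.
    apply: le_trans (nneseries_lim_ge k.+1 _); last by move=> *; exact: g0.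
    by rewrite big_nat_recr//= leeDr// sume_ge0// => i _; exact: g0.
  have S0 : 0 <= S by apply: le_trans (gS 0%N); rewrite mulr_ge0 ?sqr_ge0.
  (* The bound on the single weighted term becomes a geometric majorant of ratio 1/2 for the
     increments. *)
  have dS k : `|v k.+1 x - v k x| <= Num.sqrt S * 2^-1 ^+ k.
    rewrite -(@ler_pXn2r _ 2) ?nnegrE// ?mulr_ge0 ?sqrtr_ge0 ?exprn_ge0//.
    rewrite real_normK ?num_real// exprMn sqr_sqrtr// -exprM mulnC exprM.
    rewrite -(@ler_pM2l _ (4 ^+ k)) ?exprn_gt0// (le_trans (gS k))//.
    rewrite mulrCA -exprMn (_ : 4 * 2^-1 ^+ 2 = 1 :> R) ?expr1n ?mulr1//.
    by field.
  have : cvgn (series (fun k => v k.+1 x - v k x)).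
    apply: normed_cvg.
    apply: series_le_cvg (@is_cvg_geometric_series R (Num.sqrt S) 2^-1 _) => //.
    - by move=> k; exact: normr_ge0.
    - by move=> k; rewrite /geometric/= mulr_ge0 ?sqrtr_ge0// exprn_ge0.
    - by rewrite ger0_norm// invf_lt1// ltr1n.
  rewrite -[fun k => _]/(telescope (fun k => v k x)) telescopeK => cv.
  have -> : (fun k => v k x) = (fun k => (v k x - v 0%N x) + v 0%N x).
    by apply/funext => k; rewrite subrK.
  by apply: is_cvgD => //; exact: is_cvg_cst.
(* The upper limit is measurable whether or not the sequence converges at [x], and equals the limit
   where it does. *)
pose f x := fine (limn_esup (fun k => (v k x)%:E)).
have mf : measurable_fun setT f.
  apply: (@measurableT_comp _ _ _ _ _ _ (@fine R) _
    (fun x => limn_esup (fun k => (v k x)%:E))) => //.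
  by apply: measurable_fun_limn_esup => k; apply/measurable_EFinP; exact: mv.
have fE : {ae mu, forall x, (fun k => v k x) @ \oo --> f x}.
  apply: filterS vcvg => x /cvg_ex[l vl]; rewrite /f.
  have vlE : (fun k => (v k x)%:E) @ \oo --> l%:E.
    by apply: cvg_EFin => //; exact: nearW.
  by have [_ ->] := cvg_limn_einf_sup vlE.
have fatou_le k n : (N_ k <= n)%N ->
    (\int[mu]_x ((u n x - f x) ^+ 2)%:E <= (16^-1 ^+ k)%:E)%E.
  move=> kn; pose h m x := ((u n x - v m x) ^+ 2)%:E : \bar R.
  have mu_ : measurable_fun setT (u n) by exact: L2_measurable.
  have mh m : measurable_fun setT (h m).
    apply/measurable_EFinP; apply: measurable_funX.
    by apply: measurable_funB; [exact: mu_|exact: mv].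
  have h0 m x : setT x -> (0 <= h m x)%E by move=> _; rewrite lee_fin sqr_ge0.
  have -> : (\int[mu]_x ((u n x - f x) ^+ 2)%:E = \int[mu]_x limn_einf (h^~ x))%E.
    apply: ae_eq_integral => //.
    - by apply/measurable_EFinP; apply: measurable_funX; apply: measurable_funB.
    - apply: (@measurableT_comp _ _ _ _ _ _ (@oppe R) _
        (fun x => limn_esup (fun m => - h m x)%E)) => //.
      apply: (measurable_fun_limn_esup (f := fun m x => - h m x)%E) => m.
      by apply: measurableT_comp => //; exact: mh.
    apply: filterS fE => x vf _.
    have : h^~ x @ \oo --> ((u n x - f x) ^+ 2)%:E.
      apply: cvg_EFin; first exact: nearW.
      have c : (fun m => u n x - v m x) @ \oo --> u n x - f x.
        by apply: cvgB => //; exact: cvg_cst.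
      exact: (cvgM c c).
    by move=> /cvg_limn_einf_sup[-> _].
  apply: (le_trans (fatou mu measurableT mh h0)).
  rewrite limn_einf_lim; apply: lime_le; first exact: is_cvg_einfs.
  near=> m; apply: ereal_inf_le; exists (\int[mu]_x h m x)%E; first by exists m => /=.
  rewrite /h dotB lee_fin; apply: N_P => //.
  apply: (leq_trans (N_idx k)).
  by apply: idx_mono; near: m; exists k.
have f2 : f \in Lfun mu 2%:E.
  (* Fatou's bound controls only [u (N_ 0) - f]; square integrability of [f] follows by subtracting
     from [u (N_ 0)]. *)
  have ufL : (fun x => u (N_ 0%N) x - f x) \in Lfun mu 2%:E.
    apply: Lfun2P; first by apply: measurable_funB => //; exact: L2_measurable.
    by apply: (le_lt_trans (fatou_le 0%N _ (leqnn _))); exact: ltry.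
  have := Lfun2_linear (-1) ufL (L2_Lfun (u (N_ 0%N))).
  by under eq_fun do rewrite mulN1r opprB subrK.
exists (mkL2 f2) => e e0.
have [k ke] : exists k, 16^-1 ^+ k <= e.
  near \oo => k; exists k; apply: ltW; rewrite -[ltLHS]ger0_norm ?exprn_ge0//.
  near: k; have /cvgr0Pnorm_lt : (fun k => 16^-1 ^+ k : R) @ \oo --> 0.
    by apply: cvg_expr; rewrite ger0_norm// invf_lt1// ltr1n.
  exact.
exists (N_ k) => n kn; apply: (le_trans _ ke); rewrite -lee_fin -dotB.
apply: le_trans (fatou_le k n kn).
rewrite le_eqVlt; apply/orP; left; apply/eqP; apply: ae_eq_integral => //.
- apply/measurable_EFinP; apply: measurable_funX.
  by apply: measurable_funB; exact: L2_measurable.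
- apply/measurable_EFinP; apply: measurable_funX; apply: measurable_funB => //.
  exact: L2_measurable.
- by apply: filterS (mkL2E f2) => x h Dx; rewrite h.
Unshelve. all: by end_near. Qed.

End L2_inner_product.

(** * Smooth bump functions on the line *)

Section smooth_real_functions.
Context {R : realType}.
Implicit Types (f g : R -> R) (x : R) (n k : nat).

(** The class C^n. The derivative is exhibited rather than taken to be [derive1], so that closure
    under sums, products and affine substitutions follows by induction from the rules for
    [is_derive]. *)
Fixpoint times_differentiable n f : Prop :=
  if n is n'.+1 then
    exists2 f', (forall x, is_derive x 1 f (f' x)) & times_differentiable n' f'
  else continuous f.

Definition smooth1 f := forall n, times_differentiable n f.

Lemma is_derive_continuous f (f' : R -> R) :
  (forall x, is_derive x 1 f (f' x)) -> continuous f.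
Proof.
by move=> df x; apply/differentiable_continuous/derivable1_diffP; have [] := df x.
Qed.

Lemma times_differentiableW n f :
  times_differentiable n.+1 f -> times_differentiable n f.
Proof.
elim: n f => [|n IH] f [f' df Cf']; first exact: is_derive_continuous df.
by exists f' => //; exact: IH.
Qed.

Lemma times_differentiable_linear n a f g : times_differentiable n f ->
  times_differentiable n g -> times_differentiable n (fun x => a * f x + g x).
Proof.
elim: n f g => [|n IH] f g /=.
  by move=> cf cg x; apply: cvgD; [apply: cvgMr; exact: cf|exact: cg].
move=> [f' df Cf'] [g' dg Cg']; exists (fun x => a * f' x + g' x); last exact: IH.
by move=> x; exact: is_deriveD (is_deriveZ a (df x)) (dg x).
Qed.

Lemma times_differentiableM n f g : times_differentiable n f ->
  times_differentiable n g -> times_differentiable n (fun x => f x * g x).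
Proof.
elim: n f g => [|n IH] f g /=.
  by move=> cf cg x; apply: cvgM; [exact: cf|exact: cg].
move=> [f' df Cf'] [g' dg Cg'].
exists (fun x => 1 * (f x * g' x) + g x * f' x) => [x|].
  by rewrite mul1r; exact: is_deriveM.
by apply: times_differentiable_linear; apply: IH => //;
  apply: times_differentiableW; [exists f'|exists g'].
Qed.

Lemma is_derive_affine (f : R -> R) (a b x y : R) : is_derive (a * x + b) 1 f y ->
  is_derive x 1 (fun x => f (a * x + b)) (a * y).
Proof.
move=> df; rewrite mulrC;
  apply: (is_derive1_comp (f := f) (g := fun x => a * x + b)) => //.
have h : is_derive x 1 (fun x => a * x + b) (a *: (1 : R) + 0) :=
  is_deriveD (is_deriveZ a (is_derive_id x (1 : R))) (is_derive_cst b x 1).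
by apply: is_derive_eq h _; rewrite addr0; exact: mulr1.
Qed.

Lemma times_differentiable_affine n f a b :
  times_differentiable n f -> times_differentiable n (fun x => f (a * x + b)).
Proof.
elim: n f => [|n IH] f /=.
  move=> cf x; apply: (@continuous_comp _ _ _ (fun x => a * x + b) f); last exact: cf.
  by apply: cvgD; [apply: cvgMr; exact: cvg_id|exact: cvg_cst].
(* The summand 0 gives the derivative the shape [a * f x + g x] of [times_differentiable_linear]. *)
move=> [f' df Cf']; exists (fun x => a * f' (a * x + b) + 0).
  by move=> x; rewrite addr0; exact: is_derive_affine.
apply: times_differentiable_linear; first exact: IH.
elim: {f df f' Cf' IH} n => [|n IH] /=; first by move=> x; exact: cvg_cst.
by exists (cst 0) => // x; exact: is_derive_cst.
Qed.

Lemma smooth1_linear a f g : smooth1 f -> smooth1 g -> smooth1 (fun x => a * f x + g x).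
Proof. by move=> sf sg n; exact: times_differentiable_linear. Qed.

Lemma smooth1M f g : smooth1 f -> smooth1 g -> smooth1 (fun x => f x * g x).
Proof. by move=> sf sg n; exact: times_differentiableM. Qed.

Lemma smooth1_affine f a b : smooth1 f -> smooth1 (fun x => f (a * x + b)).
Proof. by move=> sf n; exact: times_differentiable_affine. Qed.

Lemma smooth1_continuous f : smooth1 f -> continuous f.
Proof. by move=> /(_ 0%N). Qed.

Lemma smooth1_primitive f f' : (forall x, is_derive x 1 f (f' x)) ->
  smooth1 f' -> smooth1 f.
Proof.
move=> df sf' [|n]; first exact: is_derive_continuous df.
by exists f'.
Qed.

Lemma smooth1_derivable f x : smooth1 f -> derivable f x 1.
Proof. by move=> /(_ 1%N)[f' df _]; have [] := df x. Qed.

Lemma smooth1_derive1 f : smooth1 f -> smooth1 (derive1 f).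
Proof.
move=> sf n; have [f' df Cf'] := sf n.+1; suff -> : derive1 f = f' by [].
by apply/funext => x; rewrite derive1E; have [] := df x.
Qed.

Lemma smooth1_derive1n f n : smooth1 f -> smooth1 (derive1n n f).
Proof. by move=> sf; elim: n => //= n IH; exact: smooth1_derive1. Qed.

(* The family is closed under differentiation up to linear combinations, so
   that all its members are smooth. *)
Definition flat k x : R := if 0 < x then x^-1 ^+ k * expR (- x^-1) else 0.

Lemma flat_ge0 k x : 0 <= flat k x.
Proof.
rewrite /flat; case: ifPn => // x0.
by rewrite mulr_ge0 ?expR_ge0// exprn_ge0// invr_ge0 ltW.
Qed.

Lemma flat_le0 k x : x <= 0 -> flat k x = 0.
Proof. by rewrite /flat ltNge => ->. Qed.

Lemma flatSM k x : flat k x = flat k.+1 x * x.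
Proof.
rewrite /flat; case: ifPn => x0; last by rewrite mul0r.
by rewrite exprS; field; rewrite gt_eqF.
Qed.

(** The term of degree [k.+1] in the exponential series at [x^-1] already beats the negative power,
    up to the factor [x]. This yields continuity of [flat k] at 0. *)
Lemma flat_le_linear k x : flat k x <= k.+1`!%:R * `|x|.
Proof.
rewrite /flat; case: ifPn => x0; last by rewrite mulr_ge0.
have xV0 : 0 < x^-1 by rewrite invr_gt0.
have := expR_ge1Dxn k (ltW xV0) => h.
have {}h : x^-1 ^+ k.+1 / k.+1`!%:R <= expR x^-1 by apply: le_trans h; rewrite lerDr.
rewrite expRN ler_pdivrMr ?expR_gt0// gtr0_norm//.
rewrite ler_pdivrMr ?ltr0n ?fact_gt0// in h.
apply: (@le_trans _ _ (x * x^-1 ^+ k.+1)).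
  by rewrite exprS mulrA mulfV ?mul1r// gt_eqF.
by rewrite -mulrA mulrCA ler_wpM2l ?(ltW x0)// mulrC.
Qed.

Lemma flat_continuous0 k : {for 0, continuous (flat k)}.
Proof.
suff : flat k x @[x --> 0] --> (0 : R) by rewrite -{2}(flat_le0 k (lexx 0)).
apply: (squeeze_cvgr (f := cst 0) (h := fun x => k.+1`!%:R * `|x|)).
- by apply: nearW => x; rewrite flat_ge0 flat_le_linear.
- exact: cvg_cst.
- rewrite -[X in _ --> X](mulr0 (k.+1`!%:R)); apply: cvgMr.
  by rewrite -[X in _ --> X](@normr0 _ R); apply: cvg_norm; exact: cvg_id.
Qed.

(** For positive [x] this is the product rule. At 0 the difference quotient of [flat k] is
    [flat k.+1], which is continuous with value 0 there, so Caratheodory's criterion applies. *)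
Lemma is_derive_flat k x :
  is_derive x 1 (flat k) (- k%:R * flat k.+1 x + flat k.+2 x).
Proof.
have [x0|x0|->] := ltgtP x 0.
- rewrite !flat_le0 ?ltW// mulr0 addr0.
  apply: near_eq_is_derive (is_derive_cst 0 x 1).
  near=> y; rewrite /= flat_le0// ltW//; near: y; exact: lt_nbhsl.
- have : is_derive x 1 (fun y : R => (y^-1) ^+ k * expR (- y^-1))
      (- k%:R * flat k.+1 x + flat k.+2 x).
    have dV : is_derive x 1 (fun y : R => y^-1) (- x ^- 2 *: 1).
      by apply: (is_deriveV (f := id)); rewrite ?gt_eqF.
    have dE : is_derive x 1 (fun y : R => expR (- y^-1))
        (expR (- x^-1) * - (- x ^- 2 *: 1)).
      by apply: (is_derive1_comp (f := expR) (g := fun y => - y^-1)).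
    have dX : is_derive x 1 (fun y : R => y^-1 ^+ k)
        ((k%:R * x^-1 ^+ k.-1) *: (- x ^- 2 *: 1)).
      by have := is_deriveX k dV; rewrite exprfctE.
    have h := is_deriveM dX dE.
    apply: is_derive_eq h _; rewrite /flat x0 -![_ *: 1]/(_ * 1) !mulr1.
    rewrite -![_ *: _]/(_ * _) !exprS.
    have xN0 : x != 0 by rewrite gt_eqF.
    case: k {dX} => [|k] /=; rewrite ?mul0r ?oppr0 ?mul0r ?mulr0 ?expr0 ?exprS.
      by field.
    by rewrite exprVn; field; rewrite expf_neq0.
  apply: near_eq_is_derive.
  by near=> y; rewrite /flat ifT//; near: y; exact: lt_nbhsr.
- rewrite !flat_le0// mulr0 addr0; apply/is_derive1_caratheodory.
  exists (flat k.+1); split; last by rewrite flat_le0.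
    by move=> z; rewrite (flat_le0 k (lexx 0)) !subr0 -flatSM.
  exact: flat_continuous0.
Unshelve. all: by end_near. Qed.

Lemma smooth1_flat k : smooth1 (flat k).
Proof.
move=> n; elim: n k => [|n IH] k.
  exact: is_derive_continuous (is_derive_flat k).
by eexists; [exact: is_derive_flat|exact: times_differentiable_linear].
Qed.

Lemma flat0_le1 x : flat 0 x <= 1.
Proof.
rewrite /flat; case: ifPn => // x0.
by rewrite expr0 mul1r -[leRHS]expR0 ler_expR oppr_le0 invr_ge0 ltW.
Qed.

(** The arguments are [m * (x - a)] and [m * (b - x)], written as affine functions of [x] for
    [smooth1_affine]. Since [flat 0] tends to 1 at infinity and vanishes on the left of 0, the bumps
    tend to the indicator of the open interval as [m] grows. *)
Definition bump (a b : R) (m : nat) x :=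
  flat 0 (m%:R * x + - m%:R * a) * flat 0 (- m%:R * x + m%:R * b).

Lemma smooth1_bump a b m : smooth1 (bump a b m).
Proof. by apply: smooth1M; apply: smooth1_affine; exact: smooth1_flat. Qed.

Lemma bump_itv a b m x : 0 <= bump a b m x <= 1.
Proof.
rewrite /bump mulr_ge0 ?flat_ge0//=.
by rewrite -[leRHS]mulr1 ler_pM ?flat_ge0 ?flat0_le1.
Qed.

Lemma bump_eq0 a b m x : ~~ (a < x < b) -> bump a b m x = 0.
Proof.
rewrite negb_and -!leNgt => /orP[xa|bx]; rewrite /bump.
  by rewrite flat_le0 ?mul0r// mulNr -mulrBr mulr_ge0_le0// subr_le0.
by rewrite [X in _ * X]flat_le0 ?mulr0// mulNr addrC -mulrBr mulr_ge0_le0// subr_le0.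
Qed.

Lemma flat0_cvg (c : R) : 0 < c -> (fun m : nat => flat 0 (m%:R * c)) @ \oo --> (1 : R).
Proof.
move=> c0.
have h0 : (fun m : nat => - (m.+1%:R^-1 * c^-1)) @ \oo --> (0 : R).
  by rewrite -oppr0 -(mul0r c^-1); apply: cvgN; apply: cvgMl; exact: cvg_harmonic.
have h : (fun m : nat => expR (- (m.+1%:R^-1 * c^-1))) @ \oo --> (1 : R).
  have : expR x @[x --> (0 : R)] --> (1 : R).
    by rewrite -[X in _ --> X](@expR0 R); exact: continuous_expR.
  by move=> /(cvg_comp _ _ h0).
rewrite -(cvg_shiftn 1) /=; apply: cvg_trans h; apply: near_eq_cvg.
apply: nearW => m; rewrite /flat addn1 mulr_gt0// expr0 mul1r.
by rewrite invfM.
Qed.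

Lemma bump_cvg a b x : bump a b ^~ x @ \oo --> (if a < x < b then 1 else 0 : R).
Proof.
case: ifPn => [/andP[ax xb]|nx]; last first.
  by under eq_fun do rewrite (bump_eq0 _ nx); exact: cvg_cst.
rewrite -[X in _ --> X](mulr1 1); apply: cvgM.
  by under eq_fun do rewrite mulNr -mulrBr; apply: flat0_cvg; rewrite subr_gt0.
by under eq_fun do rewrite mulNr addrC -mulrBr; apply: flat0_cvg; rewrite subr_gt0.
Qed.

Lemma bump_primitive a b m : exists S : R -> R,
  forall x, is_derive x 1 S (bump a b m x).
Proof.
pose f := bump a b m.
have cf : continuous f by exact/smooth1_continuous/smooth1_bump.
have intf y : lebesgue_measure.-integrable `]-oo, y] (EFin \o f).
  apply: (@integrableS _ _ _ _ setT) => //.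
  have -> : EFin \o f = (EFin \o f) \_ `[a, b].
    apply/funext => t; rewrite patchE; case: ifPn => // /negP tab.
    rewrite /= /f bump_eq0//; apply/negP => /andP[at_ tb]; apply: tab.
    by rewrite inE /= in_itv/= !ltW.
  apply/(integrable_mkcond _ _).1 => //.
  apply: continuous_compact_integrable; first exact: segment_compact.
  exact: continuous_subspaceT.
exists (fun y => \int[lebesgue_measure]_(t in `]-oo, y]) f t) => x.
have xx1 : x < x + 1 by rewrite ltrDl.
have [d1 d2] := continuous_FTC1 xx1 (intf (x + 1)) (ltNyr x) (cf x).
by apply: DeriveDef; [exact: d1|rewrite -derive1E; exact: d2].
Qed.

(* Smooth approximations of the tent function on [a, a + 2 l]: with S a
   primitive of a bump on [a, a + l], take S x - S (x - l). *)
Lemma tentP a l m : 0 < l -> exists T : R -> R,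
  [/\ smooth1 T, forall x, ~~ (a <= x <= a + 2 * l) -> T x = 0,
      forall x, `|T x| <= l &
      forall x, derive1 T x = bump a (a + l) m x - bump (a + l) (a + 2 * l) m x].
Proof.
move=> l0; have [S dS] := bump_primitive a (a + l) m.
have sS : smooth1 S by apply: smooth1_primitive dS _; exact: smooth1_bump.
have cS x y : {within `[x, y], continuous S}.
  by apply: continuous_subspaceT; exact: smooth1_continuous.
(* The derivative of [S] vanishes outside the interval from [a] to [a + l]. Off the support claimed
   for [T], the points [x] and [x - l] lie on the same side of that interval. *)
have Sconst x y : x <= y -> (y <= a \/ a + l <= x) -> S x = S y.
  move=> xy xya.
  have [z] := MVT_segment xy (fun z _ => dS z) (cS x y).
  rewrite in_itv/= => /andP[xz zy]; rewrite bump_eq0 ?mul0r; first by move/subr0_eq.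
  by rewrite negb_and -!leNgt; case: xya => h; apply/orP; [left|right]; lra.
pose T x := -1 * S (1 * x + - l) + S x.
have TE x : T x = S x - S (x - l) by rewrite /T mul1r mulN1r addrC.
exists T; split=> [|x|x|x].
- by apply: smooth1_linear => //; exact: smooth1_affine.
- rewrite TE negb_and -!ltNge => /orP[xa|bx]; apply/subr0_eq; rewrite subr0.
    by apply/eqP; rewrite subr_eq0; apply/eqP/esym/Sconst; [lra|left; lra].
  by apply/eqP; rewrite subr_eq0; apply/eqP/esym/Sconst; [lra|right; lra].
- have xl : x - l <= x by lra.
  have [z _] := MVT_segment xl (fun z _ => dS z) (cS (x - l) x).
  rewrite TE => ->; have /andP[b0 b1] := bump_itv a (a + l) m z.
  have -> : x - (x - l) = l by ring.
  by rewrite normrM !ger0_norm ?(ltW l0)// ler_piMl// ltW.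
- have dT : is_derive x 1 T
      (-1 * (1 * bump a (a + l) m (1 * x + - l)) + bump a (a + l) m x).
    exact: is_deriveD (is_deriveZ (-1) (is_derive_affine (dS (1 * x + - l)))) (dS x).
  rewrite derive1E; have [_ ->] := dT; rewrite mulN1r addrC !mul1r; congr (_ - _).
  by rewrite /bump; congr (flat 0 _ * flat 0 _); ring.
Qed.

End smooth_real_functions.

(** * Boxes and tensor products of bump functions *)

Section boxes.
Context {R : realType} {d : nat}.
Implicit Types (a b x : 'rV[R]_d) (i : 'I_d) (F : 'I_d -> R -> R).

Definition box a b : set 'rV[R]_d :=
  [set x | forall i, a ord0 i <= x ord0 i <= b ord0 i].

Lemma box_compact a b : compact (box a b).
Proof.
rewrite [X in compact X](_ : _ =
    [set x : 'rV[R]_d | forall i, `[a ord0 i, b ord0 i]%classic (x ord0 i)]).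
  apply: (@rV_compact R d (fun i => `[a ord0 i, b ord0 i]%classic)) => i.
  exact: segment_compact.
by apply/seteqP; split => x /= h i; have := h i; rewrite /= in_itv.
Qed.

Lemma box_closed a b : closed (box a b).
Proof.
rewrite [X in closed X](_ : _ = \bigcap_i
    ((fun x : 'rV[R]_d => x ord0 i) @^-1` `[a ord0 i, b ord0 i])); last first.
  apply/seteqP; split => x /= h i; first by move=> _; rewrite /= in_itv/= h.
  by have := h i Logic.I; rewrite /= in_itv.
apply: closed_bigI => i _; apply: preimage_closed; last exact: interval_closed.
by move=> x _; exact: coord_continuous.
Qed.

Definition set_coord x i (c : R) : 'rV[R]_d :=
  \row_j (if j == i then c else x ord0 j).

Lemma set_coordE x i c j : set_coord x i c ord0 j = if j == i then c else x ord0 j.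
Proof. by rewrite mxE. Qed.

Definition tensor F x : R := \prod_i F i (x ord0 i).

Lemma tensor_continuous F : (forall i, continuous (F i)) -> continuous (tensor F).
Proof.
move=> cF; rewrite /tensor.
elim: (index_enum _) => [|j s IH].
  rewrite [X in continuous X](_ : _ = cst 1); first exact: cst_continuous.
  by apply/funext => x; rewrite big_nil.
rewrite [X in continuous X](_ : _ =
    fun x => F j (x ord0 j) * \prod_(i <- s) F i (x ord0 i)).
  move=> x.
  apply: (@continuousM _ _ (fun y : 'rV[R]_d => F j (y ord0 j))); last exact: IH.
  apply: (@continuous_comp _ _ _ (fun y : 'rV[R]_d => y ord0 j) (F j)); last exact: cF.
  exact: coord_continuous.
by apply/funext => x; rewrite big_cons.
Qed.

Definition update F i (f : R -> R) j := if j == i then f else F j.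

(** Along the [i]-th coordinate line all other factors are frozen into the constant [c], and the
    difference quotient is the one-variable quotient of [F i] times [c]. *)
Lemma is_derive_tensor F i x y : is_derive (x ord0 i) 1 (F i) y ->
  is_derive x (delta_mx 0 i) (tensor F) (tensor (update F i (cst y)) x).
Proof.
move=> [dF Fy].
pose c := \prod_(j | j != i) F j (x ord0 j).
have tE f (z : 'rV[R]_d) : (forall j, j != i -> z ord0 j = x ord0 j) ->
    tensor (update F i f) z = f (z ord0 i) * c.
  move=> zx; rewrite /tensor (bigD1 i)//= /update eqxx; congr (_ * _).
  by apply: eq_bigr => j ji; rewrite (negbTE ji) zx.
have FE : tensor F = tensor (update F i (F i)).
  apply/funext => z; apply: eq_bigr => j _; rewrite /update.
  by case: eqVneq => [->|].
rewrite tE//=.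
have q : (fun h : R =>
    h^-1 *: (tensor F (h *: delta_mx 0 i + x) - tensor F x)) @ 0^' --> y * c.
  have -> : (fun h : R => h^-1 *: (tensor F (h *: delta_mx 0 i + x) - tensor F x)) =
      (fun h : R => (h^-1 *: (F i (h *: 1 + x ord0 i) - F i (x ord0 i))) * c).
    apply/funext => h; rewrite FE !tE// => [|j ji]; last first.
      by rewrite !mxE eqxx (negbTE ji) mulr0 add0r.
    rewrite -mulrBl scalerAl; congr (_ * _); congr (_ *: (F i _ - _)).
    by rewrite !mxE !eqxx.
  by apply: cvgMl; rewrite -Fy; exact: dF.
by apply: DeriveDef; [apply/cvg_ex; exists (y * c)|exact: cvg_lim q].
Qed.

Lemma partial_tensor F i : (forall j, smooth1 (F j)) ->
  partial i (tensor F) = tensor (update F i (derive1 (F i))).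
Proof.
move=> sF; apply/funext => x; rewrite /partial.
have dF : is_derive (x ord0 i) 1 (F i) (derive1 (F i) (x ord0 i)).
  by rewrite derive1E; apply: DeriveDef => //; exact: smooth1_derivable.
have [_ ->] := is_derive_tensor dF.
apply: eq_bigr => j _; rewrite /update.
by case: eqVneq => [->|].
Qed.

(** Iterated partial derivatives stay within the tensor products, which reduces smoothness in [d]
    variables to smoothness on the line. *)
Lemma iter_partial_tensor F (s : seq 'I_d) : (forall j, smooth1 (F j)) ->
  foldr partial (tensor F) s = tensor (fun j => derive1n (count_mem j s) (F j)).
Proof.
move=> sF; elim: s => [//|i s IH] /=.
rewrite IH partial_tensor => [|j]; last exact: smooth1_derive1n.
apply/funext => x; apply: eq_bigr => j _; rewrite /update eq_sym.
by case: eqVneq => [->|].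
Qed.

Lemma smooth_tensor F : (forall j, smooth1 (F j)) -> smooth (tensor F).
Proof.
move=> sF s; rewrite iter_partial_tensor//; split.
  by apply: tensor_continuous => i; apply: smooth1_continuous; exact: smooth1_derive1n.
move=> i x; set G := fun _ => _.
have sG j : smooth1 (G j) by exact: smooth1_derive1n.
have dG : is_derive (x ord0 i) 1 (G i) (derive1 (G i) (x ord0 i)).
  by rewrite derive1E; apply: DeriveDef => //; exact: smooth1_derivable.
by have [] := is_derive_tensor dG.
Qed.

Lemma tensor_eq0 F a b x : (forall i t, ~~ (a ord0 i <= t <= b ord0 i) -> F i t = 0) ->
  ~ box a b x -> tensor F x = 0.
Proof.
move=> F0 /existsNP[i /negP xi].
by rewrite /tensor (bigD1 i)//= F0// mul0r.
Qed.

Lemma test_function_tensor (Omega : set 'rV[R]_d) F a b :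
  (forall i, smooth1 (F i)) ->
  (forall i t, ~~ (a ord0 i <= t <= b ord0 i) -> F i t = 0) ->
  box a b `<=` Omega -> test_function Omega (tensor F).
Proof.
move=> sF F0 abO.
have suppF : supp (tensor F) `<=` box a b.
  rewrite /supp [X in _ `<=` X](closure_id _).1; last exact: box_closed.
  apply: closure_subset => x /= /eqP Fx.
  by apply: contrapT => /(tensor_eq0 F0).
split; first exact: smooth_tensor.
- by apply: subclosed_compact suppF; [exact: closed_closure|exact: box_compact].
- exact: subset_trans suppF abO.
Qed.

Lemma tensor_le1 F x : (forall i t, `|F i t| <= 1) -> `|tensor F x| <= 1.
Proof.
move=> F1; rewrite /tensor normr_prod; apply: prodr_ile1 => i _.
by rewrite normr_ge0 F1.
Qed.

Lemma tensor_update_le F i f x (M : R) : (forall i t, `|F i t| <= 1) ->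
  (forall t, `|f t| <= M) -> `|tensor (update F i f) x| <= M.
Proof.
move=> F1 fM; rewrite /tensor (bigD1 i)//= {1}/update eqxx normrM -[leRHS]mulr1.
apply: ler_pM => //; rewrite normr_prod; apply: prodr_ile1 => j ji.
by rewrite normr_ge0 /update (negbTE ji) F1.
Qed.

Definition bumps a b (m : nat) i := bump (a ord0 i) (b ord0 i) m.

Lemma bumps_le1 a b m i t : `|bumps a b m i t| <= 1.
Proof.
by have /andP[b0 b1] := bump_itv (a ord0 i) (b ord0 i) m t; rewrite ger0_norm.
Qed.

Lemma bumps_eq0 a b m i t : ~~ (a ord0 i <= t <= b ord0 i) -> bumps a b m i t = 0.
Proof.
move=> h; rewrite /bumps bump_eq0//; apply: contra h.
by move=> /andP[at_ tb]; rewrite !ltW.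
Qed.

(** The bumps converge to indicators of open intervals, while [box] is closed. The two differ only
    on the faces, which are excluded here and are negligible by [ae_off_face]. *)
Lemma tensor_bumps_cvg a b x :
  (forall i, x ord0 i != a ord0 i /\ x ord0 i != b ord0 i) ->
  (fun m => tensor (bumps a b m) x) @ \oo --> (\1_(box a b) x : R).
Proof.
move=> xab.
have -> : \1_(box a b) x =
    \prod_i (if a ord0 i < x ord0 i < b ord0 i then 1 else 0) :> R.
  rewrite indicE; have [/set_mem xb|/negP xb] := boolP (x \in box a b).
    rewrite big1// => i _; have [xa xb'] := xab i; rewrite ifT//.
    by rewrite !lt_neqAle xb' eq_sym xa !xb.
  have /existsNP[i /negP xi] : ~ box a b x by move=> h; apply: xb; rewrite inE.
  rewrite (bigD1 i)//= ifF ?mul0r//; apply: contraNF xi.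
  by move=> /andP[? ?]; rewrite !ltW.
rewrite /tensor; elim: (index_enum _) => [|j s IH].
  by under eq_fun do rewrite big_nil; rewrite big_nil; exact: cvg_cst.
under eq_fun do rewrite big_cons.
by rewrite big_cons; apply: cvgM IH; exact: bump_cvg.
Qed.

End boxes.

Lemma negligible_null_on d (T : measurableType d) (R : realType)
    (mu : {measure set T -> \bar R}) (N : set T) : measurable N -> mu N = 0%E ->
  {ae mu, forall x, ~ N x}.
Proof. by move=> mN N0; exists N; split => // x /= /contrapT. Qed.

(** * Boxes and almost everywhere statements in the domain *)

Section boxes_in_domain.
Context {R : realType} {d : nat} (Omega : domain R d).
Implicit Types (a b x : 'rV[R]_d) (i : 'I_d).
Local Notation mu := (lebesgue_on Omega).

Lemma measurable_domain : measurable (Omega : set 'rV[R]_d).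
Proof. by apply: open_measurable_mx; exact: domain_open. Qed.

Lemma lebesgue_on_ae (P : 'rV[R]_d -> Prop) :
  {ae mu, forall x, P x} <-> {ae lebesgue_rV R d, forall x, domain_set Omega x -> P x}.
Proof.
split=> -[N [mN N0 PN]].
  exists (N `&` Omega); split.
  - by apply: measurableI => //; exact: measurable_domain.
  - exact: N0.
  - by move=> x /= /not_implyP[Ox Px]; split => //; apply: PN.
exists (N `|` ~` Omega); split.
- by apply: measurableU => //; exact: measurableC measurable_domain.
- rewrite /= /lebesgue_on /mrestr setIUl setICl setU0.
  apply: (@subset_measure0 _ _ _ (lebesgue_rV R d) _ N) => //.
  by apply: measurableI => //; exact: measurable_domain.
- move=> x /= Px; have [Ox|] := pselect (domain_set Omega x); last by right.
  by left; apply: PN => /= h; apply: Px; exact: h.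
Qed.

Lemma ae_in_domain : {ae mu, forall x, domain_set Omega x}.
Proof. by apply/lebesgue_on_ae; apply: aeW. Qed.

Lemma lebesgue_on_box a b : box a b `<=` Omega -> (forall i, a ord0 i <= b ord0 i) ->
  mu (box a b) = (\prod_i (b ord0 i - a ord0 i))%:E.
Proof.
move=> abO ab; rewrite /= /lebesgue_on /mrestr setIidl//.
exact: lebesgue_rV_box.
Qed.

Lemma lebesgue_on_box_lty a b : (mu (box a b) < +oo)%E.
Proof.
rewrite /= /lebesgue_on /mrestr.
have [ab|/existsNP[i /negP ab]] := pselect (forall i, a ord0 i <= b ord0 i).
  apply: le_lt_trans (ltry (\prod_i (b ord0 i - a ord0 i))).
  rewrite -lebesgue_rV_box//; apply: le_measure; rewrite ?inE//.
    by apply: measurableI; [exact: measurable_box|exact: measurable_domain].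
  exact: measurable_box.
rewrite (_ : box a b = set0) ?set0I ?measure0// -subset0 => x /(_ i)/andP[ax xb].
by move: ab; rewrite (le_trans ax xb).
Qed.

(** The points of the box with [i]-th coordinate [c] lie in a degenerate box, whose volume has a
    zero factor. *)
Lemma ae_off_face a b i c : {ae mu, forall x, box a b x -> x ord0 i != c}.
Proof.
have [aicb|aicb] := boolP (a ord0 i <= c <= b ord0 i); last first.
  by apply: aeW => x /(_ i) xi; apply: contraNneq aicb => <-.
pose a' := set_coord a i c; pose b' := set_coord b i c.
have sub x : box a b x -> x ord0 i = c -> box a' b' x.
  move=> xab xc j; rewrite !set_coordE; case: eqVneq => [->|_]; last exact: xab.
  by rewrite xc lexx.
have [a'b'|/existsNP[j /negP ab]] :=
  pselect (forall j, a' ord0 j <= b' ord0 j); last first.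
  apply: aeW => x xab; apply: contraTneq isT => xc.
  have /andP[ax xb] := sub x xab xc j.
  by move: ab; rewrite (le_trans ax xb).
have mb' := measurable_box a' b'.
have null : mu (box a' b') = 0%E.
  rewrite /= /lebesgue_on /mrestr.
  apply: (@subset_measure0 _ _ _ (lebesgue_rV R d) _ (box a' b')) => //.
    by apply: measurableI => //; exact: measurable_domain.
  apply: etrans (lebesgue_rV_box a'b') _.
  by rewrite (bigD1 i)//= !set_coordE eqxx subrr mul0r.
apply: filterS (negligible_null_on mb' null) => x nx xab.
by apply/eqP => xc; apply: nx; exact: sub.
Qed.

Lemma open_bigcup_rat_box (U : set 'rV[R]_d) x : open U -> U x ->
  exists p : 'rV[rat]_d * 'rV[rat]_d,
    [/\ box (map_mx ratr p.1) (map_mx ratr p.2) `<=` U,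
        forall i, map_mx ratr p.1 ord0 i < x ord0 i &
        forall i, x ord0 i < map_mx ratr p.2 ord0 i :> R].
Proof.
move=> oU Ux.
have /nbhs_ballP[e /= e0 eU] : nbhs x U by exact: open_nbhs_nbhs.
have [p pP] : {p : 'I_d -> rat & forall i, x ord0 i - e < ratr (p i) < x ord0 i}.
  apply: (@choice _ _ (fun i q => x ord0 i - e < ratr q < x ord0 i)) => i.
  have [|q] := @rat_in_itvoo R (x ord0 i - e) (x ord0 i); first by rewrite gtrBl.
  by rewrite in_itv/=; exists q.
have [q qP] : {q : 'I_d -> rat & forall i, x ord0 i < ratr (q i) < x ord0 i + e}.
  apply: (@choice _ _ (fun i q => x ord0 i < ratr q < x ord0 i + e)) => i.
  have [|q] := @rat_in_itvoo R (x ord0 i) (x ord0 i + e); first by rewrite ltrDl.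
  by rewrite in_itv/=; exists q.
exists (\row_i p i, \row_i q i); split=> [y yb|i|i].
- apply: eU; split => // k i; rewrite (ord1 k) -ball_normE /ball_ /= distrC ltr_distl.
  have := yb i; rewrite !mxE; have /andP[p1 p2] := pP i; have /andP[q1 q2] := qP i.
  by move=> /andP[y1 y2]; rewrite (lt_le_trans p1 y1) (le_lt_trans y2 q2).
- by rewrite !mxE; have /andP[] := pP i.
- by rewrite !mxE; have /andP[] := qP i.
Qed.

(** Countably many boxes with rational corners cover the open set [Omega], and countably many null
    sets have a null union. The pairs of corners are enumerated by [unpickle], with a trivial
    condition at the integers that code no pair. *)
Lemma ae_boxes (P : 'rV[R]_d -> Prop) :
  (forall a b, (forall i, a ord0 i < b ord0 i) -> box a b `<=` Omega ->
    {ae mu, forall x, box a b x -> P x}) ->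
  {ae mu, forall x, P x}.
Proof.
move=> aeP.
pose Q (p : 'rV[rat]_d * 'rV[rat]_d) x :=
  box (map_mx ratr p.1) (map_mx ratr p.2) `<=` Omega ->
  (forall i, map_mx ratr p.1 ord0 i < map_mx ratr p.2 ord0 i :> R) ->
  box (map_mx ratr p.1) (map_mx ratr p.2) x -> P x.
have aeQ : {ae mu, forall x n, if unpickle n is Some p then Q p x else True}.
  apply/ae_foralln => n; case: unpickle => [p|]; last exact: aeW.
  have [pO|npO] := pselect
    (box (map_mx ratr p.1) (map_mx ratr p.2) `<=` Omega); last first.
    by apply: aeW => x pO; have := npO pO.
  have [lt|nlt] := pselect
    (forall i, map_mx ratr p.1 ord0 i < map_mx ratr p.2 ord0 i :> R); last first.
    by apply: aeW => x _ lt; have := nlt lt.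
  by apply: filterS (aeP _ _ lt pO) => x h _ _.
apply: filterS2 aeQ ae_in_domain => x Qx Ox.
have [p [pO px xp]] := open_bigcup_rat_box (domain_open Omega) Ox.
have := Qx (pickle p); rewrite pickleK; apply => // i.
  exact: lt_trans (px i) (xp i).
by rewrite !ltW.
Qed.

Definition box_set : set (set 'rV[R]_d) := [set A | exists a b, A = box a b].

Lemma boxI a b a' b' : box a b `&` box a' b' =
  box (\row_i Num.max (a ord0 i) (a' ord0 i)) (\row_i Num.min (b ord0 i) (b' ord0 i)).
Proof.
apply/seteqP; split => [x [xab xab'] i|x xI].
  rewrite !mxE ge_max le_min.
  by have /andP[-> ->] := xab i; have /andP[-> ->] := xab' i.
by split=> i; have := xI i; rewrite !mxE ge_max le_min => /andP[/andP[? ?] /andP[? ?]];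
  apply/andP.
Qed.

Lemma measurable_box_set : @measurable _ 'rV[R]_d = <<s box_set >>.
Proof.
apply/seteqP; split.
  apply: smallest_sub; first exact: smallest_sigma_algebra.
  move=> U oU.
  have -> : U = \bigcup_n
      (if @unpickle ('rV[rat]_d * 'rV[rat]_d)%type n is Some p then
        if `[< box (map_mx ratr p.1) (map_mx ratr p.2) `<=` U >] then
        box (map_mx ratr p.1) (map_mx ratr p.2) else set0 else set0).
    apply/seteqP; split => [x Ux|x [n _]].
      have [p [pU px xp]] := open_bigcup_rat_box oU Ux.
      exists (pickle p) => //; rewrite pickleK; rewrite asboolT// => i.
      by rewrite !ltW.
    by case: unpickle => // p; case: asboolP => // pU /pU.
  apply: sigma_algebra_bigcup => n.
  case: unpickle => [p|]; last exact: sigma_algebra0.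
  case: asboolP => _; last exact: sigma_algebra0.
  by apply: sub_sigma_algebra; do 2 eexists.
apply: smallest_sub; first exact: sigma_algebra_measurable.
by move=> _ [a [b ->]]; exact: measurable_box.
Qed.

(* The sets A with int_A f = 0 form a Dynkin class. *)
Lemma integral_boxes_ae0 (f : 'rV[R]_d -> R) : mu.-integrable setT (EFin \o f) ->
  \int[mu]_x f x = 0 ->
  (forall a b, \int[mu]_(x in box a b) f x = 0) -> {ae mu, forall x, f x = 0}.
Proof.
move=> intf f0T f0.
pose nu := induced_charge intf.
have nuE A : measurable A -> \int[mu]_(x in A) f x = 0 -> nu A = 0%E.
  move=> mA fA; have fin : nu A \is a fin_num by exact: fin_num_measure.
  by rewrite -(fineK fin); congr EFin.
have nuT : nu setT = 0%E by exact: nuE.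
have nu0 A : measurable A -> nu A = 0%E.
  rewrite measurable_box_set.
  apply: (@dynkin_induction _ 'rV[R]_d box_set (fun A => nu A = 0%E)).
  - exact: measurable_box_set.
  - by move=> _ _ [a [b ->]] [a' [b' ->]]; rewrite boxI; do 2 eexists.
  - exact: nuT.
  - by move=> _ [a [b ->]]; apply: nuE; [exact: measurable_box|exact: f0].
  - move=> S mS nuS.
    have e : nu (S `|` ~` S) = (nu S + nu (~` S))%E :=
      chargeU _ mS (measurableC mS) (setICr S).
    by move: e; rewrite nuS add0e => <-; rewrite setUv; exact: nuT.
  - move=> F mF tF nuF.
    have e : (fun n => \sum_(0 <= i < n) nu (F i))%E @ \oo --> nu (\bigcup_k F k) :=
      charge_semi_sigma_additive F mF tF (bigcupT_measurable F mF).
    rewrite -(cvg_lim _ e)//; under eq_fun do rewrite big1//.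
    exact: lim_cst.
have : ae_eq mu setT (EFin \o f) (cst 0%E).
  apply: integral_ae_eq => // E _ mE; rewrite integral_cst// mul0e.
  exact: nu0.
by apply: filterS => x /(_ Logic.I) [].
Qed.

End boxes_in_domain.

(** * Bisection of boxes *)

Section box_bisection.
Context {R : realType} {d : nat}.
Implicit Types (a b : 'rV[R]_d) (i : 'I_d) (D : set 'rV[R]_d).
Implicit Types F : 'rV[R]_d -> 'rV[R]_d -> R.

Definition proper a b := forall i, a ord0 i < b ord0 i.

Definition mid a b i : R := (a ord0 i + b ord0 i) / 2.

Lemma proper_lower a b i : proper a b -> proper a (set_coord b i (mid a b i)).
Proof.
move=> ab j; rewrite set_coordE; case: eqVneq => // ->.
by have := ab i; rewrite /mid; lra.
Qed.

Lemma proper_upper a b i : proper a b -> proper (set_coord a i (mid a b i)) b.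
Proof.
move=> ab j; rewrite set_coordE; case: eqVneq => // ->.
by have := ab i; rewrite /mid; lra.
Qed.

Lemma box_lowerE a b i c x : c <= b ord0 i ->
  box a (set_coord b i c) x <-> box a b x /\ x ord0 i <= c.
Proof.
move=> cb; split=> [xab|[xab xc] j].
  split=> [j|].
    have := xab j; rewrite set_coordE; case: eqVneq => // -> /andP[-> /=].
    by move=> /le_trans; apply.
  by have := xab i; rewrite set_coordE eqxx => /andP[].
rewrite set_coordE; case: eqVneq => // ->.
by rewrite xc andbT; have /andP[] := xab i.
Qed.

Lemma box_upperE a b i c x : a ord0 i <= c ->
  box (set_coord a i c) b x <-> box a b x /\ c <= x ord0 i.
Proof.
move=> ac; split=> [xab|[xab xc] j].
  split=> [j|].
    have := xab j; rewrite set_coordE; case: eqVneq => // -> /andP[cx ->].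
    by rewrite (le_trans ac cx).
  by have := xab i; rewrite set_coordE eqxx => /andP[].
rewrite set_coordE; case: eqVneq => // ->.
by rewrite xc; have /andP[] := xab i.
Qed.

Lemma mid_itv a b i : proper a b -> a ord0 i <= mid a b i <= b ord0 i.
Proof. by move=> /(_ i) ab; apply/andP; rewrite /mid; split; lra. Qed.

Lemma box_lower_sub a b i : proper a b ->
  box a (set_coord b i (mid a b i)) `<=` box a b.
Proof. by move=> /(mid_itv i)/andP[_ mb] x /(box_lowerE _ _ mb)[]. Qed.

Lemma box_upper_sub a b i : proper a b ->
  box (set_coord a i (mid a b i)) b `<=` box a b.
Proof. by move=> /(mid_itv i)/andP[am _] x /(box_upperE _ _ am)[]. Qed.

(** Halving each direction often enough cuts the box into pieces with sides at most [del], and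
    subadditivity adds up the bounds on the pieces. *)
Lemma box_subadditive_le0 D F (del : R) : 0 < del ->
  (forall a b i, proper a b -> box a b `<=` D ->
    F a b <= F a (set_coord b i (mid a b i)) + F (set_coord a i (mid a b i)) b) ->
  (forall a b, proper a b -> box a b `<=` D ->
    (forall i, b ord0 i - a ord0 i <= del) -> F a b <= 0) ->
  forall a b, proper a b -> box a b `<=` D -> F a b <= 0.
Proof.
move=> del0 Fhalf Fsmall.
(* The first [k] directions may be arbitrarily long, the others are already short. *)
suff H k : (k <= d)%N -> forall a b, proper a b -> box a b `<=` D ->
    (forall i : 'I_d, (k <= i)%N -> b ord0 i - a ord0 i <= del) -> F a b <= 0.
  by move=> a b ab abD; apply: (H d) => // i; rewrite leqNgt ltn_ord.
elim: k => [_ a b ab abD h|k IH kd]; first by apply: Fsmall => // i; exact: h.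
pose i := Ordinal kd.
(* Inner induction on the number [n] of halvings that direction [i] still needs; the remaining long
   directions are left to the outer hypothesis. *)
have {}IH (n : nat) a b : proper a b -> box a b `<=` D ->
    (forall j : 'I_d, (k < j)%N -> b ord0 j - a ord0 j <= del) ->
    b ord0 i - a ord0 i <= 2 ^+ n * del -> F a b <= 0.
  elim: n a b => [|n IHn] a b ab abD h hi.
    apply: (IH (ltnW kd)) => //.
    move=> j; rewrite leq_eqVlt => /predU1P[kj|/h//].
    have -> : j = i by apply: val_inj; rewrite /= kj.
    by move: hi; rewrite expr0 mul1r.
  have ji (j : 'I_d) : (k < j)%N -> (j == i) = false.
    by move=> kj; apply/negbTE; apply: contraTneq kj => ->; rewrite ltnn.
  apply: (le_trans (Fhalf a b i ab abD)); rewrite -(addr0 0); apply: lerD.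
    apply: IHn; first exact: proper_lower.
    - exact: subset_trans (box_lower_sub ab) abD.
    - by move=> j kj; rewrite set_coordE ji// h.
    - by rewrite set_coordE eqxx /mid; move: hi; rewrite exprS; lra.
  apply: IHn; first exact: proper_upper.
  - exact: subset_trans (box_upper_sub ab) abD.
  - by move=> j kj; rewrite set_coordE ji// h.
  - by rewrite set_coordE eqxx /mid; move: hi; rewrite exprS; lra.
move=> a b ab abD h.
have [n hn] : exists n, b ord0 i - a ord0 i <= 2 ^+ n * del.
  exists (Num.truncn ((b ord0 i - a ord0 i) / del)).+1.
  rewrite -ler_pdivrMr//; apply: (le_trans (ltW (truncnS_gt _))).
  by rewrite -natrX ler_nat ltnW// ltn_expl.
exact: IH hn.
Qed.

End box_bisection.

(** * Integrals over boxes *)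

Section box_integrals.
Context {R : realType} {d : nat} (Omega : domain R d).
Implicit Types (a b x : 'rV[R]_d) (i : 'I_d) (f g : 'rV[R]_d -> R).
Local Notation mu := (lebesgue_on Omega).
Local Notation "'I_[' a , b ] f" := (\int[mu]_(x in box a b) f x)
  (at level 10, a, b at next level, f at level 9).

Lemma box_integral_indic a b f : I_[a, b] f = \int[mu]_x (f x * \1_(box a b) x).
Proof.
rewrite Rintegral_mkcond; apply: eq_Rintegral => x _; rewrite patchE indicE.
by case: ifP => _; rewrite ?mulr1 ?mulr0.
Qed.

(** The two closed halves overlap in the face where the [i]-th coordinate is [mid a b i], a null
    set. *)
Lemma box_integral_split f a b i : mu.-integrable (box a b) (EFin \o f) -> proper a b ->
  I_[a, b] f = I_[a, set_coord b i (mid a b i)] f + I_[set_coord a i (mid a b i), b] f.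
Proof.
move=> intf ab; have /andP[am mb] := mid_itv i ab.
have ind a' b' : box a' b' `<=` box a b ->
    mu.-integrable setT (EFin \o (f \_ (box a' b'))).
  move=> sub; rewrite -restrict_EFin; apply/(integrable_mkcond _ _).1.
    exact: measurable_box.
  by apply: integrableS intf => //; exact: measurable_box.
have i0 := ind _ _ (@subset_refl _ (box a b)).
have i1 := ind _ _ (box_lower_sub (i := i) ab).
have i2 := ind _ _ (box_upper_sub (i := i) ab).
rewrite (Rintegral_mkcond _ (box a b)) (Rintegral_mkcond _ (box a _)).
rewrite (Rintegral_mkcond _ (box _ b)).
rewrite -RintegralD//; apply: ae_eq_Rintegral => //.
- by apply/measurable_EFinP; exact: measurable_int i0.
- by apply: measurable_funD; apply/measurable_EFinP;
    [exact: measurable_int i1|exact: measurable_int i2].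
apply: filterS (ae_off_face Omega a b i (mid a b i)) => x xm _.
rewrite !patchE; have [xab|xab] := boolP (x \in box a b); last first.
  rewrite !ifF ?addr0//; apply: contraNF xab; rewrite !inE.
    exact: box_upper_sub.
  exact: box_lower_sub.
have {}xm := xm (set_mem xab).
have [xlt|xgt|xe] := ltgtP (x ord0 i) (mid a b i); last by rewrite xe eqxx in xm.
  rewrite (mem_set (A := box a (set_coord b i _))) ?memNset ?addr0//.
    by move=> /(box_upperE _ _ am)[_]; rewrite leNgt xlt.
  by apply/(box_lowerE _ _ mb); split; [exact: set_mem|exact: ltW].
rewrite memNset ?mem_set ?add0r//.
  by apply/(box_upperE _ _ am); split; [exact: set_mem|exact: ltW].
by move=> /(box_lowerE _ _ mb)[_]; rewrite leNgt xgt.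
Qed.

(** Dominated convergence with majorant [|f|], the tensor products being bounded by 1. Outside the
    box they vanish identically, so the faces matter only inside it. *)
Lemma box_integral_cvg f a b : mu.-integrable setT (EFin \o f) ->
  (fun m => \int[mu]_x (f x * tensor (bumps a b m) x)) @ \oo --> I_[a, b] f.
Proof.
move=> intf; rewrite box_integral_indic.
have mf : measurable_fun setT f by apply/measurable_EFinP; exact: measurable_int intf.
have sb m i : smooth1 (bumps a b m i) by exact: smooth1_bump.
have mt m : measurable_fun setT (tensor (bumps a b m)).
  apply: continuous_measurable_mx; apply: tensor_continuous => i.
  exact: smooth1_continuous.
have [|||||intlim _ cv] := @dominated_convergence _ _ _ mu setT measurableT
    (fun m x => (f x * tensor (bumps a b m) x)%:E)
    (fun x => (f x * \1_(box a b) x)%:E) (fun x => `|(f x)%:E|%E).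
- by move=> m; apply/measurable_EFinP; exact: measurable_funM.
- apply/measurable_EFinP; apply: measurable_funM => //.
  exact: measurable_indic (measurable_box a b).
- have aea : {ae mu, forall x i, box a b x -> x ord0 i != a ord0 i}.
    by apply: filter_forall => i; exact: ae_off_face.
  have aeb : {ae mu, forall x i, box a b x -> x ord0 i != b ord0 i}.
    by apply: filter_forall => i; exact: ae_off_face.
  apply: filterS2 aea aeb => x xa xb _; apply: cvg_EFin; first exact: nearW.
  apply: cvgM; first exact: cvg_cst.
  have [xab|nxab] := pselect (box a b x).
    by apply: tensor_bumps_cvg => i; split; [exact: xa|exact: xb].
  rewrite indicE memNset//.
  have t0 m : tensor (bumps a b m) x = 0.
    by apply: tensor_eq0 nxab => i t; exact: bumps_eq0.
  by under eq_fun do rewrite t0; exact: cvg_cst.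
- exact: integrable_abse.
- apply: aeW => x m _; rewrite lee_fin normrM ler_piMr// tensor_le1//.
  by move=> i t; exact: bumps_le1.
have : fine (\int[mu]_x (f x * tensor (bumps a b m) x)%:E)%E @[m --> \oo] -->
    fine (\int[mu]_x (f x * \1_(box a b) x)%:E)%E.
  apply: fine_cvg; rewrite fineK//.
  exact: integrable_fin_num.
exact.
Qed.

End box_integrals.

(** * Weak derivatives and the Hilbert space H^1 *)

Section fundamental_lemma.
Context {R : realType} {d : nat} (Omega : domain R d).
Implicit Types (a b x : 'rV[R]_d) (i : 'I_d) (u v w g h : L2 Omega).
Implicit Types phi : 'rV[R]_d -> R.
Local Notation mu := (lebesgue_on Omega).
Local Notation "'I_[' a , b ] f" := (\int[mu]_(x in box a b) f x)
  (at level 10, a, b at next level, f at level 9).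

Lemma box_Lfun2 a b : (\1_(box a b) : _ -> R) \in Lfun mu 2%:E.
Proof.
apply: Lfun2P; first exact: measurable_indic (measurable_box a b).
have -> : (\int[mu]_x (\1_(box a b) x ^+ 2)%:E = \int[mu]_x (\1_(box a b) x)%:E)%E.
  apply: eq_integral => x _; rewrite indicE.
  by case: (_ \in _); rewrite /= ?expr1n ?expr0n.
by rewrite integral_indic ?setIT//; [exact: lebesgue_on_box_lty|exact: measurable_box].
Qed.

Definition box_class a b : L2 Omega := mkL2 (box_Lfun2 a b).

Lemma box_integral_dot a b u : I_[a, b] u = dot u (box_class a b).
Proof.
rewrite box_integral_indic; apply/esym; apply: dot_ae; last exact: mkL2E.
exact: measurable_indic (measurable_box a b).
Qed.

Lemma Lfun2_box_integrable a b (f : 'rV[R]_d -> R) : f \in Lfun mu 2%:E ->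
  mu.-integrable (box a b) (EFin \o f).
Proof.
move=> f2; apply/(integrable_mkcond _ (measurable_box a b)).2.
have := Lfun2_mul_integrable f2 (box_Lfun2 a b).
congr (_.-integrable _ _); apply/funext => x; rewrite patchE /= indicE.
by case: ifP => _; rewrite ?mulr1 ?mulr0.
Qed.

Lemma L2_box_integrable a b u : mu.-integrable (box a b) (EFin \o u).
Proof. exact: Lfun2_box_integrable (L2_Lfun u). Qed.

(** [box_integral_cvg] asks for integrability on the whole space. Cutting [u] off outside the box
    secures this and changes no integral, as the tensor products vanish there. *)
Lemma L2_box_cvg a b u :
  (fun m => \int[mu]_x (u x * tensor (bumps a b m) x)) @ \oo --> I_[a, b] u.
Proof.
have intf : mu.-integrable setT (EFin \o (u \_ (box a b))).
  rewrite -restrict_EFin; apply/(integrable_mkcond _ (measurable_box a b)).1.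
  exact: L2_box_integrable.
have -> : I_[a, b] u = I_[a, b] (u \_ (box a b)).
  by apply: eq_Rintegral => x xab; rewrite patchE xab.
have -> : (fun m => \int[mu]_x (u x * tensor (bumps a b m) x)) =
    (fun m => \int[mu]_x ((u \_ (box a b)) x * tensor (bumps a b m) x)).
  apply/funext => m; apply: eq_Rintegral => x _; rewrite patchE.
  case: ifPn => // /negP nx; rewrite (@tensor_eq0 _ _ _ a b) ?mulr0//.
    by move=> i t; exact: bumps_eq0.
  by move=> xab; apply: nx; rewrite inE.
exact: box_integral_cvg.
Qed.

(** Tensor products of bumps are test functions, so all integrals of [g] over boxes in [Omega]
    vanish in the limit. Within such a box [integral_boxes_ae0] makes [g] vanish a.e., since
    intersections of boxes are boxes. *)
Lemma fundamental_lemma g :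
  (forall phi, test_function Omega phi -> \int[mu]_x (g x * phi x) = 0) -> g = 0.
Proof.
move=> g0.
have box0 a b : box a b `<=` Omega -> I_[a, b] g = 0.
  move=> abO; rewrite -(cvg_lim _ (@L2_box_cvg a b g))//.
  rewrite [X in lim (X @ _)](_ : _ = fun=> 0); first exact: lim_cst.
  apply/funext => m; apply: g0; apply: (@test_function_tensor _ _ _ _ a b) => //.
    by move=> i; exact: smooth1_bump.
  by move=> i t; exact: bumps_eq0.
have g_ae0 : {ae mu, forall x, g x = 0}.
  apply: ae_boxes => a b ab abO.
  have intf : mu.-integrable setT (EFin \o (g \_ (box a b))).
    rewrite -restrict_EFin; apply/(integrable_mkcond _ (measurable_box a b)).1.
    exact: L2_box_integrable.
  have : {ae mu, forall x, (g \_ (box a b)) x = 0}.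
    apply: integral_boxes_ae0 => //; first by rewrite -Rintegral_mkcond box0.
    move=> a' b'; rewrite -Rintegral_mkcondr boxI box0// -boxI.
    by apply: subset_trans abO => x [].
  by apply: filterS => x; rewrite patchE => + xab; rewrite mem_set.
apply: dot_eq0; transitivity (\int[mu]_x (cst 0 x : R)); last first.
  by rewrite /Rintegral integral0.
apply: ae_eq_Rintegral => //.
- by apply: measurable_funM; exact: L2_measurable.
- by apply: filterS g_ae0 => x -> _; rewrite mul0r.
Qed.

Lemma dot_test u (phi : 'rV[R]_d -> R) (phi2 : phi \in Lfun mu 2%:E) :
  dot u (mkL2 phi2) = \int[mu]_x (u x * phi x).
Proof. by apply: dot_ae; [exact: Lfun_measurable phi2|exact: mkL2E]. Qed.

(** Written with [dot] against fixed classes, the condition is linear in [(u, g)] and passes to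
    limits by Cauchy-Schwarz. *)
Lemma weak_partialE i u g : weak_partial i u g <->
  forall phi (t : test_function Omega phi),
  dot u (mkL2 (partial_test_Lfun2 i t)) = - dot g (mkL2 (test_Lfun2 t)).
Proof.
split=> [ug phi t|ug phi t]; first by rewrite !dot_test ug.
by rewrite -(dot_test u (partial_test_Lfun2 i t)) -(dot_test g (test_Lfun2 t)) ug.
Qed.

Lemma weak_partial_linear i c u v g h : weak_partial i u g -> weak_partial i v h ->
  weak_partial i (c *: u + v) (c *: g + h).
Proof.
move=> /weak_partialE ug /weak_partialE vh; apply/weak_partialE => phi t.
by rewrite !(ip_linearl (dot_inner_product _)) ug vh; ring.
Qed.

Lemma weak_partial_uniq i u g h : weak_partial i u g -> weak_partial i u h -> g = h.
Proof.
move=> ug uh; apply/eqP; rewrite -subr_eq0; apply/eqP; apply: fundamental_lemma => phi t.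
have /weak_partialE/(_ _ t) := weak_partial_linear (-1) uh ug.
rewrite scaleN1r addNr scaleN1r addrC (ip0l (dot_inner_product _)).
rewrite -(dot_test _ (test_Lfun2 t)).
by move/eqP; rewrite eq_sym oppr_eq0 => /eqP.
Qed.

Lemma weak_derivativeP i (u : H1 Omega) :
  weak_partial i (H1val u) (weak_derivative i (H1val u)).
Proof.
have /asboolP/(_ i)[g ug] := valP u.
by rewrite /weak_derivative; case: xgetP => [h _ //|/(_ g)].
Qed.

Lemma weak_derivative_eq i u g : weak_partial i u g -> weak_derivative i u = g.
Proof.
move=> ug; rewrite /weak_derivative; case: xgetP => [h _ uh|/(_ g)//].
exact: weak_partial_uniq uh ug.
Qed.

Lemma weak_derivative_linear i c (u v : H1 Omega) :
  weak_derivative i (H1val (c *: u + v)) =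
  c *: weak_derivative i (H1val u) + weak_derivative i (H1val v).
Proof.
by apply: weak_derivative_eq; apply: weak_partial_linear; exact: weak_derivativeP.
Qed.

(** Let [z] be the projection of [u] on the closure of the classes of continuous functions. Then
    [u - z] is orthogonal to all test functions, and the fundamental lemma gives [u = z]. *)
Lemma continuous_dense u (e : R) : 0 < e -> exists phi,
  [/\ continuous phi, phi \in Lfun mu 2%:E & \int[mu]_x ((u x - phi x) ^+ 2) <= e].
Proof.
move=> e0.
pose S : {pred L2 Omega} := [pred s : L2 Omega | `[< exists2 phi : 'rV[R]_d -> R,
  continuous phi & (s : 'rV[R]_d -> R) = phi %[ae mu] >]].
have SL : submod_closed S.
  split=> [|c s t /asboolP[phi cphi sphi] /asboolP[psi cpsi tpsi]]; apply/asboolP.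
    by exists (cst 0); [exact: cst_continuous|exact: L2_0E].
  exists (fun x => c * phi x + psi x).
    move=> x; apply: continuousD (cpsi x); apply: continuousM (cphi x).
    exact: cst_continuous.
  apply: filterS3 (L2_linearE c s t) sphi tpsi => x h1 h2 h3 xT.
  by rewrite h1// h2// h3.
have [z [zS uz]] := riesz_closure (dot_inner_product _) (@dot_complete _ _ _ mu) SL
  (ip_bounded_functional (dot_inner_product _) u).
suff -> : u = z.
  have [s /asboolP[phi cphi sphi] zs] := zS _ e0; exists phi.
  have mphi : measurable_fun setT phi := continuous_measurable_mx cphi.
  have ms := L2_measurable s; have mz := L2_measurable z.
  split => //.
    apply: Lfun2P => //; rewrite (_ : (\int[mu]_x _)%E = (dot s s)%:E) ?ltry// dotE_sqr.
    apply: ae_eq_integral => //.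
    - by apply/measurable_EFinP; exact: measurable_funX.
    - by apply/measurable_EFinP; exact: measurable_funX.
    - by apply: filterS sphi => x h xT; rewrite h.
  apply: le_trans zs; rewrite le_eqVlt; apply/orP; left; apply/eqP.
  apply: ae_eq_Rintegral => //.
  - by apply: measurable_funX; exact: measurable_funB.
  - by apply: measurable_funM; exact: L2_measurable.
  - by apply: filterS2 sphi (L2_subE z s) => x h1 h2 xT; rewrite h2// h1// expr2.
apply/eqP; rewrite -subr_eq0; apply/eqP; apply: fundamental_lemma => phi t.
rewrite -(dot_test _ (test_Lfun2 t)).
rewrite (ipDl (dot_inner_product _)) (ipNl (dot_inner_product _)).
rewrite uz ?subrr//; apply/asboolP; exists phi; last exact: mkL2E.
by have [sphi _ _] := t; have [] := sphi [::].
Qed.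

End fundamental_lemma.

(** * Product and pullback inner products *)

Section inner_product_prod.
Context {R : realType} {V W : lmodType R}.
Variables (p : V -> V -> R) (q : W -> W -> R).

Definition prod_ip (x y : V * W) : R := p x.1 y.1 + q x.2 y.2.

Lemma inner_product_prod : inner_product p -> inner_product q -> inner_product prod_ip.
Proof.
move=> pP qP; split=> [x y|c x y z|x].
- by rewrite /prod_ip (ipC pP) (ipC qP).
- by rewrite /prod_ip (ip_linearl pP) (ip_linearl qP); ring.
- by rewrite addr_ge0 ?(ip_ge0 pP) ?(ip_ge0 qP).
Qed.

Lemma prod_ip_complete : inner_product p -> inner_product q ->
  ip_complete p -> ip_complete q -> ip_complete prod_ip.
Proof.
move=> pP qP pc qc x xC.
have [|y yP] := pc (fun n => (x n).1).
  move=> e /xC[N NP]; exists N => m n Nm Nn; apply: le_trans (NP m n Nm Nn).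
  by rewrite /prod_ip lerDl (ip_ge0 qP).
have [|z zP] := qc (fun n => (x n).2).
  move=> e /xC[N NP]; exists N => m n Nm Nn; apply: le_trans (NP m n Nm Nn).
  by rewrite /prod_ip lerDr (ip_ge0 pP).
exists (y, z) => e e0; have e2 : 0 < e / 2 by lra.
have [N1 N1P] := yP _ e2; have [N2 N2P] := zP _ e2.
exists (maxn N1 N2) => n; rewrite geq_max => /andP[/N1P h1 /N2P h2].
rewrite /prod_ip /=; lra.
Qed.

End inner_product_prod.

Section pullback_inner_product.
Context {R : realType} {U V : lmodType R} {I : finType}.
Variables (p : V -> V -> R) (T : I -> U -> V).
Hypothesis pP : inner_product p.
Hypothesis T_linear : forall i c x y, T i (c *: x + y) = c *: T i x + T i y.

Definition pullback_ip (x y : U) : R := \sum_i p (T i x) (T i y).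

Lemma pullback_inner_product : inner_product pullback_ip.
Proof.
split=> [x y|c x y z|x].
- by apply: eq_bigr => i _; exact: (ipC pP).
- rewrite /pullback_ip; under eq_bigr do rewrite T_linear (ip_linearl pP).
  by rewrite big_split/= -mulr_sumr.
- by apply: sumr_ge0 => i _; exact: (ip_ge0 pP).
Qed.

Lemma ip_le_pullback i x : p (T i x) (T i x) <= pullback_ip x x.
Proof.
by rewrite /pullback_ip (bigD1 i)//= lerDl sumr_ge0// => j _; exact: (ip_ge0 pP).
Qed.

Lemma pullbackB i x y : T i (x - y) = T i x - T i y.
Proof. by rewrite addrC -scaleN1r T_linear scaleN1r addrC. Qed.

(** Each component [T i (x n)] is Cauchy for [p]. The second hypothesis says that the joint range of
    the [T i] is closed, so the componentwise limits come from one [x0]. *)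
Lemma pullback_complete : ip_complete p ->
  (forall (x : nat -> U) (v : I -> V),
    (forall i e, 0 < e -> exists N, forall n, (N <= n)%N ->
      p (T i (x n) - v i) (T i (x n) - v i) <= e) ->
    exists x0, forall i, T i x0 = v i) ->
  ip_complete pullback_ip.
Proof.
move=> pc closedT x xC.
have [v vP] : {v : I -> V & forall i e, 0 < e -> exists N, forall n, (N <= n)%N ->
    p (T i (x n) - v i) (T i (x n) - v i) <= e}.
  apply: (@choice _ _ (fun i v => forall e, 0 < e -> exists N, forall n, (N <= n)%N ->
    p (T i (x n) - v) (T i (x n) - v) <= e)) => i.
  apply: pc => e /xC[N NP]; exists N => m n Nm Nn.
  by rewrite -pullbackB; apply: le_trans (NP m n Nm Nn); exact: ip_le_pullback.
have [x0 x0P] := closedT _ _ vP.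
(* The successor in [#|I|.+1] keeps the denominator nonzero for an empty index type. *)
exists x0 => e e0; have e1 : 0 < e / #|I|.+1%:R by rewrite divr_gt0.
have [N_ N_P] : {N_ : I -> nat & forall i n, (N_ i <= n)%N ->
    p (T i (x n) - v i) (T i (x n) - v i) <= e / #|I|.+1%:R}.
  apply: (@choice _ _ (fun i N => forall n, (N <= n)%N ->
    p (T i (x n) - v i) (T i (x n) - v i) <= e / #|I|.+1%:R)) => i.
  exact: vP.
exists (\max_i N_ i) => n hN.
apply: (@le_trans _ _ (\sum_(i : I) (e / #|I|.+1%:R))).
  apply: ler_sum => i _; rewrite pullbackB x0P.
  by apply: N_P; apply: leq_trans hN; exact: leq_bigmax.
rewrite sumr_const -[_ *+ _]mulr_natr mulrAC ler_pdivrMr// ler_wpM2l ?(ltW e0)//.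
by rewrite ler_nat leqnSn.
Qed.

End pullback_inner_product.

Lemma sum_option (R : nmodType) (I : finType) (F : option I -> R) :
  \sum_o F o = F None + \sum_i F (Some i).
Proof.
rewrite (bigD1 None)//= (reindex_omap Some id)/=; last by case.
by congr (_ + _); apply: eq_bigl => i; rewrite eqxx.
Qed.

Section H1_inner_product.
Context {R : realType} {d : nat} (Omega : domain R d).
Implicit Types (u v w : H1 Omega) (i : 'I_d).
Local Notation mu := (lebesgue_on Omega).
Local Notation dotP := (dot_inner_product _).

Definition grad i u : L2 Omega := weak_derivative i (H1val u).

(** [None] indexes the function and [Some i] its weak derivatives, so that the inner product of H^1
    becomes a single pullback sum. *)
Definition jet (o : option 'I_d) u : L2 Omega :=
  if o is Some i then grad i u else H1val u.

Definition H1dot : H1 Omega -> H1 Omega -> R := pullback_ip (@dot _ _ _ _) jet.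

Lemma jet_linear o c u v : jet o (c *: u + v) = c *: jet o u + jet o v.
Proof. by case: o => [i|//]; exact: weak_derivative_linear. Qed.

Lemma H1dot_inner_product : inner_product H1dot.
Proof. apply: pullback_inner_product; [exact: dotP|exact: jet_linear]. Qed.

Lemma H1norm_sqr u : H1norm u ^+ 2 = H1dot u u.
Proof.
rewrite /H1norm sqr_sqrtr; last first.
  by rewrite addr_ge0 ?sqr_ge0// sumr_ge0// => i _; exact: sqr_ge0.
rewrite /H1dot /pullback_ip sum_option /= /L2norm Lnorm2_sqr.
by under eq_bigr do rewrite Lnorm2_sqr.
Qed.

Lemma weak_partial_closed i (u g : nat -> L2 Omega) (u0 g0 : L2 Omega) :
  (forall n, weak_partial i (u n) (g n)) ->
  (forall e, 0 < e -> exists N, forall n, (N <= n)%N ->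
    dot (u n - u0) (u n - u0) <= e) ->
  (forall e, 0 < e -> exists N, forall n, (N <= n)%N ->
    dot (g n - g0) (g n - g0) <= e) ->
  weak_partial i u0 g0.
Proof.
move=> ug uu0 gg0; apply/weak_partialE => phi t.
set P := mkL2 _; set Q := mkL2 _.
apply/eqP; rewrite -subr_eq0 opprK -sqrf_eq0 eq_le sqr_ge0 andbT.
apply/ler_addgt0Pr => e e0; rewrite add0r.
(* The defect is the sum of two errors, with squares at most [e / c * dot P P] and
   [e / c * dot Q Q]; the square of the sum is at most twice their total. The [+ 1] makes [c]
   positive. *)
pose c := 2 * dot P P + 2 * dot Q Q + 1.
have P0 := ip_ge0 dotP P; have Q0 := ip_ge0 dotP Q.
have c0 : 0 < c by rewrite /c; lra.
have ec0 : 0 < e / c by rewrite divr_gt0.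
have [N1 N1P] := uu0 _ ec0; have [N2 N2P] := gg0 _ ec0.
pose n := maxn N1 N2.
have h1 := cauchy_schwarz dotP (u n - u0) P.
have h2 := cauchy_schwarz dotP (g n - g0) Q.
have {N1P}k1 := ler_wpM2r P0 (N1P n (leq_maxl _ _)).
have {N2P}k2 := ler_wpM2r Q0 (N2P n (leq_maxr _ _)).
have /weak_partialE/(_ _ t) := ug n; rewrite -/P -/Q => un.
have -> : dot u0 P + dot g0 Q = - (dot (u n - u0) P + dot (g n - g0) Q).
  by rewrite !(ipDl dotP) !(ipNl dotP) un; ring.
rewrite sqrrN.
have -> : e = c * (e / c) by field; rewrite gt_eqF.
set x := dot (u n - u0) P in h1 *; set y := dot (g n - g0) Q in h2 *.
have := le_trans h1 k1; have := le_trans h2 k2.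
move: (e / c) ec0 => r r0; have := sqr_ge0 (x - y); rewrite /c; nra.
Qed.

Lemma H1dot_complete : ip_complete H1dot.
Proof.
apply: (pullback_complete dotP jet_linear (@dot_complete _ _ _ _)) => u g ug.
have wg i : weak_partial i (g None) (g (Some i)).
  by apply: weak_partial_closed (ug None) (ug (Some i)) => n; exact: weak_derivativeP.
have dg : g None \in @weakly_differentiable R d Omega.
  by apply/asboolP => i; exists (g (Some i)); exact: wg.
exists (MkH1 dg) => -[i|//]; exact: weak_derivative_eq.
Qed.

End H1_inner_product.

(** * Poincare's inequality on boxes *)

(** Heine's theorem from the near-covering form of compactness: around each point half the radius of
    continuity is spent on moving the base point and half on the displacement to [y], which may
    leave the box. *)
Lemma uniform_continuity_box (R : realType) (d : nat) (phi : 'rV[R]_d -> R)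
    (a b : 'rV[R]_d) (eta : R) :
  continuous phi -> 0 < eta -> exists2 del : R, 0 < del &
    forall x y : 'rV[R]_d, box a b x -> (forall i, `|x ord0 i - y ord0 i| <= del) ->
      `|phi x - phi y| <= eta.
Proof.
move=> cphi eta0.
have /compact_near_coveringP nc := @box_compact R d a b.
pose P (del : R) (x : 'rV[R]_d) := forall y : 'rV[R]_d,
  (forall i, `|x ord0 i - y ord0 i| <= del) -> `|phi x - phi y| <= eta.
have near_del : \forall del \near (0 : R)^'+, box a b `<=` P del.
  apply: nc => x xab.
  have eta2 : 0 < eta / 2 by lra.
  have /cvgrPdist_lt/(_ _ eta2)/nbhs_ballP[r /= r0 rP] := cphi x.
  have r2 : 0 < r / 2 by lra.
  exists (ball x (r / 2), [set del | del < r / 2]) => /=.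
    by split; [exact: nbhsx_ballx|exact: nbhs_right_lt].
  move=> [x' del] /= [[_ xx'] dr] y x'y.
  have h1 : `|phi x - phi x'| < eta / 2.
    by apply: rP; split => // i j; apply: le_ball (xx' i j); lra.
  have h2 : `|phi x - phi y| < eta / 2.
    apply: rP; split => // i j; rewrite (ord1 i); have := xx' ord0 j; have := x'y j.
    rewrite -!ball_normE /ball_ /=; have := ler_distD (x' ord0 j) (x ord0 j) (y ord0 j).
    by move: dr; lra.
  rewrite distrC in h1; have := ler_distD (phi x) (phi x') (phi y).
  by lra.
have near0 : \forall del \near (0 : R)^'+, 0 < del by exact: nbhs_right_gt.
have [del [del0 delP]] := filter_ex (filterI near0 near_del).
by exists del => // x y xab xy; exact: delP.
Qed.

Section poincare.
Context {R : realType} {d : nat} (Omega : domain R d).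
Implicit Types (a b x : 'rV[R]_d) (i j : 'I_d) (u v w g : L2 Omega) (f : 'rV[R]_d -> R).
Local Notation mu := (lebesgue_on Omega).
Local Notation "'I_[' a , b ] f" := (\int[mu]_(x in box a b) f x)
  (at level 10, a, b at next level, f at level 9).
Local Notation lower a b i := (set_coord b i (mid a b i)).
Local Notation upper a b i := (set_coord a i (mid a b i)).

Definition vol a b : R := \prod_i (b ord0 i - a ord0 i).

Lemma vol_gt0 a b : proper a b -> 0 < vol a b.
Proof. by move=> ab; apply: prodr_gt0 => i _; rewrite subr_gt0. Qed.

Lemma vol_half a b i :
  (vol a (lower a b i) = vol a b / 2) * (vol (upper a b i) b = vol a b / 2).
Proof.
split; rewrite /vol (bigD1 i)//= [in RHS](bigD1 i)//= !set_coordE eqxx.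
  rewrite (eq_bigr (fun j => b ord0 j - a ord0 j)).
    by rewrite /mid; field.
  by move=> j ji; rewrite set_coordE (negbTE ji).
rewrite (eq_bigr (fun j => b ord0 j - a ord0 j)).
  by rewrite /mid; field.
by move=> j ji; rewrite set_coordE (negbTE ji).
Qed.

Lemma fine_mu_box a b : proper a b -> box a b `<=` Omega ->
  fine (mu (box a b)) = vol a b.
Proof. by move=> ab abO; rewrite lebesgue_on_box// => i; exact: ltW. Qed.

Lemma box_integrable_sqr f a b : f \in Lfun mu 2%:E ->
  mu.-integrable (box a b) (EFin \o (fun x => f x ^+ 2)).
Proof.
move=> f2; apply: (integrableS measurableT (measurable_box a b) (@subsetT _ _)).
exact: Lfun2_integrable_sqr.
Qed.

Lemma box_integral_sqB f c a b :
  f \in Lfun mu 2%:E -> proper a b -> box a b `<=` Omega ->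
  I_[a, b] (fun x => (f x - c) ^+ 2) =
  I_[a, b] (fun x => f x ^+ 2) - 2 * c * I_[a, b] f + c ^+ 2 * vol a b.
Proof.
move=> f2 ab abO; have mab := measurable_box a b.
have if1 : mu.-integrable (box a b) (EFin \o f) by exact: Lfun2_box_integrable.
have if2 := box_integrable_sqr a b f2.
have ic : mu.-integrable (box a b) (EFin \o (fun=> c ^+ 2)).
  apply/integrableP; split; first exact: measurable_cst.
  by rewrite integral_cst//= lte_mul_pinfty ?lebesgue_on_box_lty.
have ifc : mu.-integrable (box a b) (EFin \o (fun x => - (2 * c) * f x)).
  exact: (integrableZl mab (- (2 * c)) if1).
rewrite -(fine_mu_box ab abO) -Rintegral_cst// -mulNr -RintegralZl//.
rewrite -RintegralD// -RintegralD//; last exact: (integrableD mab if2 ifc).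
by apply: eq_Rintegral => x _; ring.
Qed.

Lemma box_integrable_sqB f c a b : f \in Lfun mu 2%:E ->
  mu.-integrable (box a b) (EFin \o (fun x => (f x - c) ^+ 2)).
Proof.
move=> f2; have := Lfun2_integrable_sqr (Lfun2_linear (- c) (box_Lfun2 Omega a b) f2).
move=> /(integrableS measurableT (measurable_box a b) (@subsetT _ _)).
apply: eq_integrable; first exact: measurable_box.
by move=> x xab; rewrite /= indicE xab mulr1 addrC.
Qed.

Lemma box_cauchy_schwarz f a b :
  f \in Lfun mu 2%:E -> proper a b -> box a b `<=` Omega ->
  (I_[a, b] f) ^+ 2 <= vol a b * I_[a, b] (fun x => f x ^+ 2).
Proof.
move=> f2 ab abO; apply: discriminant_le => [|t]; first exact/ltW/vol_gt0.
have : 0 <= I_[a, b] (fun x => (f x - t) ^+ 2).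
  by apply: Rintegral_ge0 => x _; exact: sqr_ge0.
by rewrite box_integral_sqB//; congr (_ <= _); ring.
Qed.

Lemma Lfun2_norm f : f \in Lfun mu 2%:E -> (fun x => `|f x|) \in Lfun mu 2%:E.
Proof.
move=> f2; have mf := Lfun_measurable f2.
apply: Lfun2P; first exact: measurableT_comp.
have /integrableP[_] := Lfun2_integrable_sqr f2; apply: le_lt_trans.
rewrite le_eqVlt; apply/orP; left; apply/eqP; apply: eq_integral => x _.
by rewrite /= normrX.
Qed.

Lemma Lfun2_subL2 u f : f \in Lfun mu 2%:E -> (fun x => u x - f x) \in Lfun mu 2%:E.
Proof.
move=> f2; rewrite [X in X \in _](_ : _ = fun x => -1 * f x + u x).
  exact: Lfun2_linear f2 (L2_Lfun u).
by apply/funext => x; rewrite mulN1r addrC.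
Qed.

(** The integral of the squared deviation of [f] from its mean, multiplied out and not divided by
    the volume. *)
Definition variance a b f : R :=
  I_[a, b] (fun x => f x ^+ 2) - (I_[a, b] f) ^+ 2 / vol a b.

Lemma variance_ge0 a b f : f \in Lfun mu 2%:E -> proper a b -> box a b `<=` Omega ->
  0 <= variance a b f.
Proof.
move=> f2 ab abO; rewrite subr_ge0 ler_pdivrMr ?vol_gt0// mulrC.
exact: box_cauchy_schwarz.
Qed.

Lemma variance_le a b f c : f \in Lfun mu 2%:E -> proper a b -> box a b `<=` Omega ->
  variance a b f <= I_[a, b] (fun x => (f x - c) ^+ 2).
Proof.
move=> f2 ab abO; rewrite box_integral_sqB// /variance.
set s := I_[a, b] (fun x => f x ^+ 2); set m := I_[a, b] f.
have v0 := vol_gt0 ab; set V := vol a b in v0 *.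
rewrite -subr_ge0.
have -> : s - 2 * c * m + c ^+ 2 * V - (s - m ^+ 2 / V) = (m - c * V) ^+ 2 / V.
  by field; rewrite gt_eqF.
by rewrite divr_ge0 ?sqr_ge0// ltW.
Qed.

(* The test function is a tent in the i-th coordinate, with slope 1 on the
   lower half and -1 on the upper half, tensored with bumps. *)
Lemma box_integral_half_difference i u g a b : weak_partial i u g ->
  proper a b -> box a b `<=` Omega ->
  `|I_[a, lower a b i] u - I_[upper a b i, b] u| <=
  (b ord0 i - a ord0 i) / 2 * I_[a, b] (fun x => `|g x|).
Proof.
move=> ug ab abO; set l := (b ord0 i - a ord0 i) / 2.
have l0 : 0 < l by rewrite /l; have := ab i; lra.
have al : a ord0 i + l = mid a b i by rewrite /l /mid; lra.
have al2 : a ord0 i + 2 * l = b ord0 i by rewrite /l; lra.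
have intg : mu.-integrable (box a b) (EFin \o (fun x => `|g x|)).
  by apply: Lfun2_box_integrable; apply: Lfun2_norm; exact: L2_Lfun.
(* At level [n] this is the definition of the weak derivative for the tent tensor, which is bounded
   by [l] and vanishes off the box. Letting [n] grow replaces the bumps by indicators. *)
have bound n : `|\int[mu]_x (u x * tensor (bumps a (lower a b i) n) x) -
    \int[mu]_x (u x * tensor (bumps (upper a b i) b n) x)| <=
    l * I_[a, b] (fun x => `|g x|).
  have [T [sT T0 Tl dT]] := tentP (a ord0 i) n l0.
  pose F := update (bumps a b n) i T.
  have sF j : smooth1 (F j).
    by rewrite /F /update; case: eqP => // _; exact: smooth1_bump.
  have F0 j t : ~~ (a ord0 j <= t <= b ord0 j) -> F j t = 0.
    rewrite /F /update; case: eqP => [->|_]; last exact: bumps_eq0.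
    by rewrite -al2; exact: T0.
  have tF : test_function Omega (tensor F) by exact: test_function_tensor sF F0 abO.
  have dF : partial i (tensor F) =
      (fun x => tensor (bumps a (lower a b i) n) x -
        tensor (bumps (upper a b i) b n) x).
    rewrite partial_tensor//; apply/funext => x.
    rewrite /tensor (bigD1 i)//= [in RHS](bigD1 i)//= [X in _ = _ - X](bigD1 i)//=.
    rewrite (eq_bigr (fun j => bumps a b n j (x ord0 j))); last first.
      by move=> j ji; rewrite /F /update (negbTE ji).
    rewrite [in RHS](eq_bigr (fun j => bumps a b n j (x ord0 j))); last first.
      by move=> j ji; rewrite /bumps set_coordE (negbTE ji).
    rewrite [X in _ = _ - _ * X](eq_bigr (fun j => bumps a b n j (x ord0 j)));
      last first.
      by move=> j ji; rewrite /bumps set_coordE (negbTE ji).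
    by rewrite -mulrBl {1}/update /F /update eqxx dT /bumps !set_coordE eqxx al al2.
  have bump2 a' b' : box a' b' `<=` Omega -> tensor (bumps a' b' n) \in Lfun mu 2%:E.
    move=> sub; apply: test_Lfun2; apply: (@test_function_tensor _ _ _ _ a' b') => //.
      by move=> j; exact: smooth1_bump.
    by move=> j t; exact: bumps_eq0.
  rewrite -RintegralB//; last 2 first.
  - apply: Lfun2_mul_integrable (L2_Lfun u) (bump2 _ _ _).
    exact: subset_trans (box_lower_sub ab) abO.
  - apply: Lfun2_mul_integrable (L2_Lfun u) (bump2 _ _ _).
    exact: subset_trans (box_upper_sub ab) abO.
  under eq_Rintegral do rewrite -mulrBr.
  have := ug _ tF; rewrite dF => ->; rewrite normrN.
  have intgF : mu.-integrable setT (EFin \o (fun x => g x * tensor F x)).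
    by apply: Lfun2_mul_integrable (L2_Lfun g) _; exact: test_Lfun2 tF.
  apply: (le_trans (le_normr_Rintegral measurableT intgF)).
  rewrite -RintegralZl//; last exact: measurable_box.
  rewrite [leRHS]Rintegral_mkcond; apply: le_Rintegral => //.
  - exact: (integrable_abse intgF).
  - rewrite -restrict_EFin; apply/(integrable_mkcond _ (measurable_box a b)).1.
    exact: (integrableZl (measurable_box a b) l intg).
  move=> x _; rewrite patchE; case: ifPn => [_|/negP nx]; last first.
    rewrite (tensor_eq0 F0) ?mulr0 ?normr0// => xab; apply: nx.
    by rewrite inE.
  rewrite normrM mulrC ler_wpM2r//; apply: tensor_update_le => //.
  by move=> j t; exact: bumps_le1.
have cv : (fun n => `|\int[mu]_x (u x * tensor (bumps a (lower a b i) n) x) -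
    \int[mu]_x (u x * tensor (bumps (upper a b i) b n) x)|) @ \oo -->
    `|I_[a, lower a b i] u - I_[upper a b i, b] u|.
  by apply: cvg_norm; apply: cvgB; exact: L2_box_cvg.
rewrite -(cvg_lim _ cv)//; apply: limr_le; first by apply/cvg_ex; eexists; exact: cv.
by apply: nearW => n; exact: bound.
Qed.

Lemma Lfun2_sqr_split f a b i : f \in Lfun mu 2%:E -> proper a b ->
  I_[a, b] (fun x => f x ^+ 2) = I_[a, lower a b i] (fun x => f x ^+ 2) +
    I_[upper a b i, b] (fun x => f x ^+ 2).
Proof.
by move=> f2 ab; apply: box_integral_split => //; exact: box_integrable_sqr.
Qed.

(** The variance exceeds that of the halves by the squared difference of the two integrals over
    [vol a b]. The previous bound and Cauchy-Schwarz control this excess; the factor 1/4 they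
    provide is given away. *)
Lemma variance_half i u g a b :
  weak_partial i u g -> proper a b -> box a b `<=` Omega ->
  variance a b u <= variance a (lower a b i) u + variance (upper a b i) b u +
    (b ord0 i - a ord0 i) ^+ 2 * I_[a, b] (fun x => g x ^+ 2).
Proof.
move=> ug ab abO; have v0 := vol_gt0 ab.
have half := box_integral_half_difference ug ab abO.
have cs := box_cauchy_schwarz (Lfun2_norm (L2_Lfun g)) ab abO.
have gn : I_[a, b] (fun x => `|g x| ^+ 2) = I_[a, b] (fun x => g x ^+ 2).
  by apply: eq_Rintegral => x _; rewrite real_normK ?num_real.
rewrite gn in cs.
rewrite /variance (Lfun2_sqr_split i (L2_Lfun u) ab) !(vol_half a b i).
rewrite (box_integral_split i (L2_box_integrable a b u) ab).
have l0 : 0 < b ord0 i - a ord0 i by rewrite subr_gt0.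
have g0 : 0 <= I_[a, b] (fun x => `|g x|) by apply: Rintegral_ge0.
move: half cs v0 l0 g0; set m1 := I_[_, _] u; set m2 := I_[_, b] u.
set G := I_[a, b] (fun x => `|g x|); set G2 := I_[a, b] (fun x => g x ^+ 2).
set s1 := I_[a, _] (fun x => u x ^+ 2); set s2 := I_[_, b] (fun x => u x ^+ 2).
move: (b ord0 i - a ord0 i) (vol a b) => l V half cs V0 l0 G0.
have h2 : (m1 - m2) ^+ 2 <= (l / 2 * G) ^+ 2.
  rewrite -(real_normK (num_real (m1 - m2))) lerXn2r// nnegrE.
  by rewrite mulr_ge0// divr_ge0// ltW.
have h3 : (m1 - m2) ^+ 2 / V <= l ^+ 2 * G2.
  rewrite ler_pdivrMr// (le_trans h2)// exprMn.
  have -> : l ^+ 2 * G2 * V = l ^+ 2 * (V * G2) by ring.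
  have : 0 <= (l / 2) ^+ 2 by exact: sqr_ge0.
  move=> /ler_wpM2l/(_ _ _ cs); have := sqr_ge0 l.
  have : 0 <= V * G2 by apply: le_trans cs; exact: sqr_ge0.
  move: (V * G2) => x x0 lx; have := mulr_ge0 lx x0.
  have -> : (l / 2) ^+ 2 * x = l ^+ 2 * x / 4 by field.
  lra.
(* Both halves have volume [V / 2], which makes the excess a perfect square. *)
have e : (m1 - m2) ^+ 2 / V =
    m1 ^+ 2 / (V / 2) + m2 ^+ 2 / (V / 2) - (m1 + m2) ^+ 2 / V.
  by field; rewrite gt_eqF.
rewrite e in h3; lra.
Qed.

Definition gradient_energy a b (g : 'I_d -> L2 Omega) : R :=
  \sum_i (b ord0 i - a ord0 i) ^+ 2 * I_[a, b] (fun x => g i x ^+ 2).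

Lemma box_integral_sqr_ge0 a b f : 0 <= I_[a, b] (fun x => f x ^+ 2).
Proof. by apply: Rintegral_ge0 => x _; exact: sqr_ge0. Qed.

(** In direction [i] the squared side drops to a quarter, which frees 3/4 of that term, more than
    the half claimed. The other terms split additively. *)
Lemma gradient_energy_half i a b (g : 'I_d -> L2 Omega) : proper a b ->
  gradient_energy a (lower a b i) g + gradient_energy (upper a b i) b g +
    (b ord0 i - a ord0 i) ^+ 2 / 2 * I_[a, b] (fun x => g i x ^+ 2) <=
  gradient_energy a b g.
Proof.
move=> ab; rewrite /gradient_energy -big_split/= (bigD1 i)//= [leRHS](bigD1 i)//=.
rewrite [leLHS]addrAC lerD//.
  have := Lfun2_sqr_split i (L2_Lfun (g i)) ab.
  have := box_integral_sqr_ge0 a b (g i).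
  rewrite !set_coordE eqxx /mid.
  set J := I_[a, b] (fun x => g i x ^+ 2).
  set I1 := I_[a, _] (fun x => g i x ^+ 2).
  set I2 := I_[_, b] (fun x => g i x ^+ 2) => J0 JE.
  have : 0 <= (b ord0 i - a ord0 i) ^+ 2 * J by rewrite mulr_ge0 ?sqr_ge0.
  by rewrite JE; lra.
apply: ler_sum => j ji; rewrite !set_coordE (negbTE ji) -mulrDr.
by rewrite -Lfun2_sqr_split//; exact: L2_Lfun.
Qed.

Lemma poincare u (g : 'I_d -> L2 Omega) a b : (forall i, weak_partial i u (g i)) ->
  proper a b -> box a b `<=` Omega -> variance a b u <= 2 * gradient_energy a b g.
Proof.
move=> ug ab0 abO0.
suff H (e : R) : 0 < e ->
    variance a b u - 2 * gradient_energy a b g <= (2 + vol a b) * e.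
  have v0 := vol_gt0 ab0; rewrite -subr_le0; apply/ler_addgt0Pr => e e0.
  have v2 : 0 < 2 + vol a b by lra.
  have := H (e / (2 + vol a b)); rewrite divr_gt0// => /(_ erefl).
  by rewrite mulrCA mulfV ?(gt_eqF v2)// mulr1 add0r.
move=> e0.
have aux1 (v g0 z V : R) : z <= e ->
    v - 2 * g0 - 2 * z - e * V <= 0 -> v - 2 * g0 <= (2 + V) * e.
  by lra.
have aux2 (v v1 v2 g0 g1 g2 z z1 z2 V L I : R) : v <= v1 + v2 + L * I ->
    g1 + g2 + L / 2 * I <= g0 -> z = z1 + z2 ->
    v - 2 * g0 - 2 * z - e * V <=
    v1 - 2 * g1 - 2 * z1 - e * (V / 2) + (v2 - 2 * g2 - 2 * z2 - e * (V / 2)).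
  by move=> ? ? ->; lra.
have aux3 (v w g0 z V : R) : 0 <= g0 -> v <= w -> w <= 2 * z + V ->
    v - 2 * g0 - 2 * z - V <= 0.
  by lra.
(* The bound [2 * eta ^+ 2 <= e] matches (p - r)^2 <= 2 (p - q)^2 + 2 (q - r)^2, with [q] a value of
   the continuous approximation of [u]. *)
have [eta eta0 eta2] : exists2 eta : R, 0 < eta & 2 * eta ^+ 2 <= e.
  exists (Num.sqrt (e / 2)); first by rewrite sqrtr_gt0; lra.
  by rewrite sqr_sqrtr; lra.
have aux4 (p q r : R) : (q - r) ^+ 2 <= eta ^+ 2 ->
    (p - r) ^+ 2 <= 2 * (p - q) ^+ 2 + e.
  by have := sqr_ge0 ((p - q) - (q - r)); move: eta2; nra.
have [phi [cphi phi2 uphi]] := continuous_dense u e0.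
have up2 : (fun x => u x - phi x) \in Lfun mu 2%:E by exact: Lfun2_subL2.
have /= ie : mu.-integrable setT (EFin \o (fun x => (u x - phi x) ^+ 2)).
  exact: Lfun2_integrable_sqr up2.
(* The last two terms are additive under bisection. On a small box they pay for replacing [u] by the
   constant [phi a']; on the whole box they amount to at most [(2 + vol a b) * e]. *)
pose F a b := variance a b u - 2 * gradient_energy a b g -
  2 * I_[a, b] (fun x => (u x - phi x) ^+ 2) - e * vol a b.
have le_total : I_[a, b] (fun x => (u x - phi x) ^+ 2) <= e.
  apply: le_trans uphi; rewrite Rintegral_mkcond; apply: le_Rintegral => //.
    rewrite -restrict_EFin; apply/(integrable_mkcond _ (measurable_box a b)).1.
    exact: (integrableS measurableT (measurable_box a b) (@subsetT _ _) ie).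
  by move=> x _; rewrite patchE; case: ifP => // _; exact: sqr_ge0.
suff : F a b <= 0 by exact: aux1.
have [del del0 delP] := @uniform_continuity_box R d phi a b eta cphi eta0.
apply: (@box_subadditive_le0 _ _ (box a b) F del) => //.
- move=> a' b' i ab' ab'D; have abO := subset_trans ab'D abO0.
  have h1 := variance_half (ug i) ab' abO.
  have h2 := gradient_energy_half i g ab'.
  have h3 := Lfun2_sqr_split i up2 ab'.
  by rewrite /F !(vol_half a' b' i); exact: aux2 h1 h2 h3.
move=> a' b' ab' ab'D side; have abO := subset_trans ab'D abO0.
have v0 := vol_gt0 ab'.
have aab : box a' b' a' by move=> i; rewrite lexx/= ltW.
have phi_a x : box a' b' x -> `|phi x - phi a'| <= eta.
  move=> xab; rewrite distrC; apply: delP; first exact: ab'D.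
  move=> i; apply: le_trans (side i); have /andP[h1 h2] := xab i.
  by rewrite distrC ger0_norm ?subr_ge0// lerB.
have mab := measurable_box a' b'.
have h := variance_le (phi a') (L2_Lfun u) ab' abO.
have h4 : I_[a', b'] (fun x => (u x - phi a') ^+ 2) <=
    2 * I_[a', b'] (fun x => (u x - phi x) ^+ 2) + e * vol a' b'.
  have ieb := integrableS measurableT mab (@subsetT _ _) ie.
  have ie2 : mu.-integrable (box a' b') (EFin \o (fun x => 2 * (u x - phi x) ^+ 2)).
    exact: (integrableZl mab 2 ieb).
  have ic : mu.-integrable (box a' b') (EFin \o (fun=> e)).
    apply/integrableP; split; first exact: measurable_cst.
    by rewrite integral_cst//= lte_mul_pinfty ?lebesgue_on_box_lty.
  rewrite -(fine_mu_box ab' abO) -Rintegral_cst// -RintegralZl// -RintegralD//.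
  apply: le_Rintegral => //.
  - exact: box_integrable_sqB (L2_Lfun u).
  - exact: (integrableD mab ie2 ic).
  move=> x xab; have k1 := phi_a x xab.
  apply: (aux4 _ (phi x)).
  by rewrite -(real_normK (num_real (phi x - _))) lerXn2r// nnegrE ltW.
have g0 : 0 <= gradient_energy a' b' g.
  by apply: sumr_ge0 => i _; rewrite mulr_ge0 ?sqr_ge0 ?box_integral_sqr_ge0.
exact: aux3 g0 h h4.
Qed.

End poincare.

(** * Weak limits of complementary pairs *)

Section complementarity.
Context {R : realType} {d : nat} (Omega : domain R d).
Implicit Types (a b x : 'rV[R]_d) (i j : 'I_d) (u v w g : L2 Omega) (f : 'rV[R]_d -> R).
Local Notation mu := (lebesgue_on Omega).
Local Notation "'I_[' a , b ] f" := (\int[mu]_(x in box a b) f x)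
  (at level 10, a, b at next level, f at level 9).
Local Notation lower a b i := (set_coord b i (mid a b i)).
Local Notation upper a b i := (set_coord a i (mid a b i)).

Lemma box_integrable_mul a b u v :
  mu.-integrable (box a b) (EFin \o (fun x => u x * v x)).
Proof.
apply: (integrableS measurableT (measurable_box a b) (@subsetT _ _)).
exact: L2_integrableM.
Qed.

Lemma box_integral_sqr_le_dot a b u : I_[a, b] (fun x => u x ^+ 2) <= dot u u.
Proof.
have -> : dot u u = \int[mu]_x (u x ^+ 2) by apply: eq_Rintegral => x _; rewrite expr2.
rewrite Rintegral_mkcond; apply: le_Rintegral => //.
- rewrite -restrict_EFin; apply/(integrable_mkcond _ (measurable_box a b)).1.
  exact: box_integrable_sqr (L2_Lfun u).
- exact: Lfun2_integrable_sqr (L2_Lfun u).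
- by move=> x _; rewrite patchE; case: ifP => // _; exact: sqr_ge0.
Qed.

(** The polarisation of [variance]. If [u v] vanishes a.e. on the box, only minus the product of the
    two integrals over the volume remains. *)
Definition covariance a b u v : R :=
  I_[a, b] (fun x => u x * v x) - I_[a, b] u * I_[a, b] v / vol a b.

Lemma variance_linear c a b u v :
  variance Omega a b (fun x => c * u x + v x) =
  c ^+ 2 * variance Omega a b u + 2 * c * covariance a b u v + variance Omega a b v.
Proof.
have mab := measurable_box a b.
have sqr w : mu.-integrable (box a b) (EFin \o (fun x => w x ^+ 2)).
  exact: box_integrable_sqr (L2_Lfun w).
have iu := L2_box_integrable a b u; have iv := L2_box_integrable a b v.
have icu : mu.-integrable (box a b) (EFin \o (fun x => c * u x)).
  exact: (integrableZl mab c iu).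
have icu2 : mu.-integrable (box a b) (EFin \o (fun x => c ^+ 2 * u x ^+ 2)).
  exact: (integrableZl mab (c ^+ 2) (sqr u)).
have icuv : mu.-integrable (box a b) (EFin \o (fun x => 2 * c * (u x * v x))).
  exact: (integrableZl mab (2 * c) (box_integrable_mul a b u v)).
have e1 : I_[a, b] (fun x => c * u x + v x) = c * I_[a, b] u + I_[a, b] v.
  by rewrite RintegralD// RintegralZl.
have e2 : I_[a, b] (fun x => (c * u x + v x) ^+ 2) =
    c ^+ 2 * I_[a, b] (fun x => u x ^+ 2) + 2 * c * I_[a, b] (fun x => u x * v x) +
    I_[a, b] (fun x => v x ^+ 2).
  rewrite -!RintegralZl//; last exact: box_integrable_mul.
  rewrite -RintegralD// -RintegralD//; last exact: (integrableD mab icu2 icuv).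
  by apply: eq_Rintegral => x _; ring.
rewrite /variance e1 e2 /covariance.
move: (vol a b)^-1 => V; ring.
Qed.

(** The variances of [u + v] and [- u + v] are nonnegative. *)
Lemma covariance_le a b u v : proper a b -> box a b `<=` Omega ->
  2 * `|covariance a b u v| <= variance Omega a b u + variance Omega a b v.
Proof.
move=> ab abO.
have h c : 0 <= c ^+ 2 * variance Omega a b u +
    2 * c * covariance a b u v + variance Omega a b v.
  rewrite -variance_linear; apply: variance_ge0 => //.
  by apply: Lfun2_linear; exact: L2_Lfun.
have := h 1; have := h (-1).
rewrite sqrrN expr1n !mul1r mulr1 mulrN1 mulNr.
by case: (ger0P (covariance a b u v)) => _; lra.
Qed.

(** Unlike [gradient_energy] it carries no side lengths, so it is exactly additive under
    bisection. *)
Definition energy a b (u : H1 Omega) : R := \sum_i I_[a, b] (fun x => grad i u x ^+ 2).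

Lemma energy_half a b i (u : H1 Omega) : proper a b ->
  energy a b u = energy a (lower a b i) u + energy (upper a b i) b u.
Proof.
move=> ab; rewrite /energy -big_split/=; apply: eq_bigr => j _.
by apply: Lfun2_sqr_split => //; exact: L2_Lfun.
Qed.

Lemma energy_ge0 a b (u : H1 Omega) : 0 <= energy a b u.
Proof. by apply: sumr_ge0 => i _; exact: box_integral_sqr_ge0. Qed.

Lemma energy_le_H1dot a b (u : H1 Omega) : energy a b u <= H1dot u u.
Proof.
rewrite /H1dot /pullback_ip sum_option /= -[leLHS]add0r lerD//.
  exact: (ip_ge0 (dot_inner_product _)).
by apply: ler_sum => i _; exact: box_integral_sqr_le_dot.
Qed.

Lemma variance_le_energy (del : R) a b (u : H1 Omega) :
  proper a b -> box a b `<=` Omega ->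
  (forall i, b ord0 i - a ord0 i <= del) ->
  variance Omega a b (H1val u) <= 2 * (del ^+ 2 * energy a b u).
Proof.
move=> ab abO side.
apply: (le_trans (poincare (fun i => weak_derivativeP i u) ab abO)).
rewrite ler_wpM2l// mulr_sumr; apply: ler_sum => i _.
rewrite ler_wpM2r ?box_integral_sqr_ge0// lerXn2r// nnegrE.
  by rewrite subr_ge0 ltW.
by apply: le_trans (side i); rewrite subr_ge0 ltW.
Qed.

Lemma covariance_le_energy (del : R) a b (u v : H1 Omega) :
  proper a b -> box a b `<=` Omega ->
  (forall i, b ord0 i - a ord0 i <= del) ->
  `|covariance a b (H1val u) (H1val v)| <= del ^+ 2 * (energy a b u + energy a b v).
Proof.
have aux (c x y p q r : R) : 2 * c <= p + q -> p <= 2 * (r * x) -> q <= 2 * (r * y) ->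
    c <= r * (x + y) by rewrite mulrDr; lra.
move=> ab abO side; apply: aux (covariance_le (H1val u) (H1val v) ab abO) _ _.
- exact: variance_le_energy.
- exact: variance_le_energy.
Qed.

Section weak_limit.
Variables (U : set_system nat) (UU : UltraFilter U).
Variables (u_ v_ : nat -> H1 Omega) (u v : H1 Omega) (M : R).
Hypothesis uM : forall n, H1dot (u_ n) (u_ n) <= M.
Hypothesis vM : forall n, H1dot (v_ n) (v_ n) <= M.
Hypothesis u_u : forall w : L2 Omega,
  (fun n => dot (H1val (u_ n)) w) @ U --> dot (H1val u) w.
Hypothesis v_v : forall w : L2 Omega,
  (fun n => dot (H1val (v_ n)) w) @ U --> dot (H1val v) w.

(* On a box with sides at most del and volume V, Poincare's inequality turns
   u_n v_n = 0 into (int u_n)(int v_n) <= V del^2 (energy of u_n and v_n).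
   Only the integrals of u_n and v_n over the box have to converge to obtain
   int uv <= O(del^2), uniformly in del by bisection. *)
Lemma weak_limit_box_integral_le0 a b :
  (forall n, {ae mu, forall x, u_ n x * v_ n x = 0}) ->
  proper a b -> box a b `<=` Omega -> I_[a, b] (fun x => u x * v x) <= 0.
Proof.
move=> uv0 ab0 abO0; have UP : ProperFilter U by exact: ultra_proper.
(* [e] assigns to each box the limit along [U] of the energies, which are bounded by [M + M]. *)
have [e eP] : {e : 'rV[R]_d * 'rV[R]_d -> R & forall p,
    (fun n => energy p.1 p.2 (u_ n) + energy p.1 p.2 (v_ n)) @ U --> e p}.
  apply: (@choice _ _ (fun p l =>
    (fun n => energy p.1 p.2 (u_ n) + energy p.1 p.2 (v_ n)) @ U --> (l : R))) => p.
  apply: (@ultralimit _ _ _ (M + M)) => n.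
  rewrite ger0_norm ?addr_ge0 ?energy_ge0// lerD//.
    exact: le_trans (energy_le_H1dot _ _ _) (uM n).
  exact: le_trans (energy_le_H1dot _ _ _) (vM n).
have box_u a' b' : (fun n => I_[a', b'] (H1val (u_ n))) @ U --> I_[a', b'] (H1val u).
  by rewrite box_integral_dot; under eq_fun do rewrite box_integral_dot; exact: u_u.
have box_v a' b' : (fun n => I_[a', b'] (H1val (v_ n))) @ U --> I_[a', b'] (H1val v).
  by rewrite box_integral_dot; under eq_fun do rewrite box_integral_dot; exact: v_v.
have aux (m1 m2 r e1 e2 x1 x2 y1 y2 : R) :
    m1 + m2 - r * (e1 + e2 + (x1 + x2 + (y1 + y2))) <=
    m1 - r * (e1 + (x1 + y1)) + (m2 - r * (e2 + (x2 + y2))) by lra.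
have aux2 (x y x1 y1 x2 y2 : R) : x = x1 + x2 -> y = y1 + y2 ->
    x + y = x1 + y1 + (x2 + y2) by move=> -> ->; ring.
pose K a' b' := e (a', b') + (energy a' b' u + energy a' b' v).
have small (del : R) a' b' : proper a' b' -> box a' b' `<=` Omega ->
    (forall i, b' ord0 i - a' ord0 i <= del) ->
    I_[a', b'] (fun x => u x * v x) <= del ^+ 2 * K a' b'.
  move=> ab' abO' side; have V0 := vol_gt0 ab'; have VN0 := gt_eqF V0.
  have I0 n : I_[a', b'] (fun x => u_ n x * v_ n x) = 0.
    rewrite (ae_eq_Rintegral (g := cst 0)) ?Rintegral_cst ?mul0r//.
    - exact: measurable_box.
    - exact: measurable_box.
    - apply: measurable_funS (@subsetT _ _) _ => //.
      by apply: measurable_funM; exact: L2_measurable.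
    - by apply: filterS (uv0 n) => x -> _.
  have prod_le n : I_[a', b'] (H1val (u_ n)) * I_[a', b'] (H1val (v_ n)) <=
      vol a' b' * (del ^+ 2 * (energy a' b' (u_ n) + energy a' b' (v_ n))).
    have := covariance_le_energy (u_ n) (v_ n) ab' abO' side.
    rewrite /covariance I0 sub0r normrN => /(le_trans (ler_norm _)).
    by rewrite ler_pdivrMr// [leRHS]mulrC.
  have lim_le : I_[a', b'] (H1val u) * I_[a', b'] (H1val v) <=
      vol a' b' * (del ^+ 2 * e (a', b')).
    have h1 : (fun n => I_[a', b'] (H1val (u_ n)) * I_[a', b'] (H1val (v_ n))) @ U -->
        I_[a', b'] (H1val u) * I_[a', b'] (H1val v).
      by apply: cvgM; [exact: box_u|exact: box_v].
    have h2 : (fun n => vol a' b' *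
        (del ^+ 2 * (energy a' b' (u_ n) + energy a' b' (v_ n)))) @ U -->
        vol a' b' * (del ^+ 2 * e (a', b')).
      by apply: cvgMr; apply: cvgMr; exact: (eP (a', b')).
    rewrite -(cvg_lim _ h1)// -(cvg_lim _ h2)//; apply: ler_lim.
    - by apply/cvg_ex; eexists; exact: h1.
    - by apply/cvg_ex; eexists; exact: h2.
    - by apply: nearW => n; exact: prod_le.
  (* Poincare's inequality is used once more, now for the limit pair, to pass from the product of
     its integrals back to the integral of the product. *)
  have h3 := le_trans (ler_norm _) (covariance_le_energy u v ab' abO' side).
  have h4 : I_[a', b'] (H1val u) * I_[a', b'] (H1val v) / vol a' b' <=
      del ^+ 2 * e (a', b').
    by rewrite ler_pdivrMr// [leRHS]mulrC.
  rewrite -[leLHS](subrK (I_[a', b'] (H1val u) * I_[a', b'] (H1val v) / vol a' b')).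
  rewrite /K mulrDr addrC; exact: lerD h4 h3.
have half (del : R) : 0 < del -> I_[a, b] (fun x => u x * v x) <= del ^+ 2 * K a b.
  move=> del0; rewrite -subr_le0.
  apply: (@box_subadditive_le0 _ _ (box a b)
    (fun a' b' => I_[a', b'] (fun x => u x * v x) - del ^+ 2 * K a' b') del) => //.
  - move=> a' b' i ab' _.
    rewrite (box_integral_split i (box_integrable_mul a' b' (H1val u) (H1val v)) ab').
    rewrite /K (energy_half i u ab') (energy_half i v ab').
    (* Additivity of the energies passes to the limit by its uniqueness. *)
    have -> : e (a', b') = e (a', lower a' b' i) + e (upper a' b' i, b').
      apply: (cvg_unique _ (eP (a', b')) _) => //.
      rewrite [X in X @ _](_ : _ = fun n =>
        (energy a' (lower a' b' i) (u_ n) + energy a' (lower a' b' i) (v_ n)) +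
        (energy (upper a' b' i) b' (u_ n) + energy (upper a' b' i) b' (v_ n))).
        by apply: cvgD; [exact: (eP (a', _))|exact: (eP (_, b'))].
      apply/funext => n /=.
      exact: aux2 (energy_half i (u_ n) ab') (energy_half i (v_ n) ab').
    by apply: aux.
  - move=> a' b' ab' sub side; rewrite subr_le0; apply: small => //.
    exact: subset_trans sub abO0.
apply/ler_addgt0Pr => r r0; rewrite add0r.
have K0 : 0 < `|K a b| + 1 by rewrite ltr_wpDl.
(* With this [del] the bound [del ^+ 2 * K a b] is at most [r]. *)
have := half (Num.sqrt (r / (`|K a b| + 1))).
rewrite sqrtr_gt0 divr_gt0// => /(_ erefl).
rewrite sqr_sqrtr ?divr_ge0 ?(ltW r0) ?(ltW K0)// => /le_trans; apply.
rewrite mulrAC ler_pdivrMr// ler_wpM2l ?(ltW r0)//.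
by rewrite (le_trans (ler_norm _))// lerDl.
Qed.

End weak_limit.

(** Testing with the negative part [f] of [u] gives [0 <= dot u f], which is minus the squared norm
    of [f]. *)
Lemma weak_limit_ge0 (U : set_system nat) (u_ : nat -> L2 Omega) u : UltraFilter U ->
  (forall w, (fun n => dot (u_ n) w) @ U --> dot u w) ->
  (forall n, {ae mu, forall x, 0 <= u_ n x}) -> {ae mu, forall x, 0 <= u x}.
Proof.
move=> UU u_u u0; have UP : ProperFilter U by exact: ultra_proper.
have mu_ := L2_measurable u.
pose f x := Num.max 0 (- u x).
have mf : measurable_fun setT f.
  by apply: measurable_maxr => //; exact: measurableT_comp.
have f2 : f \in Lfun mu 2%:E.
  apply: Lfun2P => //.
  have /integrableP[_] := Lfun2_integrable_sqr (L2_Lfun u); apply: le_lt_trans.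
  apply: ge0_le_integral => //.
  - by move=> x _; rewrite lee_fin sqr_ge0.
  - by apply/measurable_EFinP; exact: measurable_funX.
  - by apply: measurableT_comp => //; apply/measurable_EFinP; exact: measurable_funX.
  - move=> x _; rewrite /= lee_fin ger0_norm ?sqr_ge0// /f.
    by case: (leP 0 (- u x)) => _; rewrite ?sqrrN// expr0n/= sqr_ge0.
have fE : ((mkL2 f2 : L2 Omega) : 'rV[R]_d -> R) = f %[ae mu] := mkL2E f2.
have f0 x : 0 <= f x by rewrite /f le_max lexx.
have ge0 : 0 <= dot u (mkL2 f2).
  rewrite -(cvg_lim _ (u_u (mkL2 f2)))//; apply: limr_ge.
    by apply/cvg_ex; eexists; exact: u_u.
  apply: nearW => n; rewrite (dot_ae _ mf fE).
  (* Passing to the positive part of [u_ n] makes the integrand nonnegative at every point. *)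
  rewrite (ae_eq_Rintegral (g := fun x => Num.max 0 (u_ n x) * f x))//.
  - by apply: Rintegral_ge0 => x _; rewrite mulr_ge0// le_max lexx.
  - by apply: measurable_funM => //; exact: L2_measurable.
  - apply: measurable_funM => //; apply: measurable_maxr => //; exact: L2_measurable.
  - by apply: filterS (u0 n) => x ux _; rewrite max_r.
have : dot (mkL2 f2) (mkL2 f2) = 0.
  apply/eqP; rewrite eq_le (ip_ge0 (dot_inner_product _)) andbT.
  rewrite -oppr_ge0 (le_trans ge0)// le_eqVlt; apply/orP; left; apply/eqP.
  rewrite (dot_ae _ mf fE) -mulN1r -RintegralZl//; last exact: L2_integrableM.
  apply: ae_eq_Rintegral => //.
  - exact: measurable_funM.
  - by apply: measurable_funM => //; apply: measurable_funM; exact: L2_measurable.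
  - apply: filterS fE => x h xT; rewrite h// /f mulN1r -mulNr.
    by case: (leP 0 (- u x)) => _; rewrite ?mulr0 ?mul0r ?oppr0 ?mul0r ?opprK.
move=> /dot_eq0/Lspace_eqP f_ae0.
apply: filterS3 fE f_ae0 (@L2_0E _ _ _ mu) => x h1 h2 h3.
have : f x = 0 by rewrite -h1// h2// h3.
by rewrite /f; case: (leP 0 (- u x)) => [_ /eqP|ux _];
  [rewrite oppr_eq0 => /eqP ->|rewrite ltW// -oppr_lt0].
Qed.
End complementarity.

(** * Existence of minimisers *)

Section convex_minimizer.
Context {R : realType} {V : lmodType R}.
Variable ip : V -> V -> R.
Hypothesis ipP : inner_product ip.

Lemma bounded_functional_linear c l1 l2 : bounded_functional ip l1 ->
  bounded_functional ip l2 -> bounded_functional ip (fun x => c * l1 x + l2 x).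
Proof.
move=> [lin1 [M1 b1]] [lin2 [M2 b2]]; split=> [a x y|].
  by rewrite lin1 lin2; ring.
exists (2 * c ^+ 2 * M1 + 2 * M2) => x.
have := ler_wpM2l (sqr_ge0 c) (b1 x); have := b2 x; have := sqr_ge0 (c * l1 x - l2 x).
by move: (ip x x) (l1 x) (l2 x) => q p r; nra.
Qed.

(** Coercivity bounds a minimising sequence. Weak lower semicontinuity is replaced by the tangent
    [l] at the weak limit [x]: [f x + (l (x_ n) - l x) <= f (x_ n)], where the bracket tends to
    0. *)
Lemma convex_minimizer (f : V -> R) (K : V -> Prop) (c : R) : ip_complete ip ->
  0 < c -> (forall x, c * ip x x <= f x) ->
  (forall x, exists2 l, bounded_functional ip l & forall z, f x + (l z - l x) <= f z) ->
  (exists x, K x) ->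
  (forall (U : set_system nat) (x_ : nat -> V) x M, UltraFilter U ->
    (forall n, K (x_ n)) -> (forall n, ip (x_ n) (x_ n) <= M) ->
    (forall l, bounded_functional ip l -> (l \o x_) @ U --> l x) -> K x) ->
  exists2 x, K x & forall z, K z -> f x <= f z.
Proof.
move=> cplt c0 coercive subgradient [x1 Kx1] closedK.
pose E := [set f x | x in K].
have f0 x : 0 <= f x.
  by apply: le_trans (coercive x); rewrite mulr_ge0 ?(ltW c0)// (ip_ge0 ipP).
have infE : has_inf E by split; [exists (f x1), x1|exists 0 => _ [x _ <-]].
pose m := inf E.
have mf z : K z -> m <= f z by move=> Kz; apply: ge_inf; [exact: infE.2|exists z].
have [x_ x_P] : {x_ : nat -> V & forall n, K (x_ n) /\ f (x_ n) <= m + n.+1%:R^-1}.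
  apply: (@choice _ _ (fun n x => K x /\ f x <= m + n.+1%:R^-1)) => n.
  have n0 : 0 < n.+1%:R^-1 :> R by rewrite invr_gt0.
  have [_ [x Kx <-] fx] := inf_adherent n0 infE.
  by exists x; split => //; exact: ltW.
have x_K n : K (x_ n) by have [] := x_P n.
(* An ultrafilter finer than [\oo], so that the errors [n.+1%:R^-1] still tend to 0 along it. *)
have [U [UU sU]] := @ultraFilterLemma nat \oo _.
have UP : ProperFilter U by exact: ultra_proper.
have x_M n : ip (x_ n) (x_ n) <= (m + 1) / c.
  rewrite ler_pdivlMr// mulrC (le_trans (coercive _))//.
  have [_ /le_trans] := x_P n; apply; rewrite lerD2l.
  by rewrite invf_le1 ?ler1n.
have [x xP] := weak_ultralimit UU ipP cplt x_M.
have Kx : K x := closedK U x_ x _ UU x_K x_M xP.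
exists x => // z Kz; apply: le_trans (mf z Kz).
have [l bl lP] := subgradient x.
have h1 : (fun n => f x + (l (x_ n) - l x)) @ U --> f x + (l x - l x).
  by apply: cvgD; [exact: cvg_cst|apply: cvgB; [exact: xP|exact: cvg_cst]].
have h2 : (fun n => m + n.+1%:R^-1) @ U --> m + 0.
  apply: cvgD; first exact: cvg_cst.
  by apply: cvg_trans (@cvg_harmonic R) => A /sU.
rewrite subrr addr0 in h1; rewrite addr0 in h2.
rewrite -(cvg_lim _ h1)// -(cvg_lim _ h2)//; apply: ler_lim.
- by apply/cvg_ex; eexists; exact: h1.
- by apply/cvg_ex; eexists; exact: h2.
- by apply: nearW => n; have [_] := x_P n; exact: le_trans (lP _).
Qed.

Lemma ip_tangent x z : ip x x + 2 * (ip x z - ip x x) <= ip z z.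
Proof.
have := ip_ge0 ipP (z - x); rewrite !(ipDl ipP) !(ipDr ipP) !(ipNl ipP) !(ipNr ipP).
by rewrite (ipC ipP z x); lra.
Qed.

End convex_minimizer.

(** * Weak closedness of the complementarity set *)

Section complementarity_closed.
Context {R : realType} {d : nat} (Omega : domain R d).
Local Notation mu := (lebesgue_on Omega).

Lemma complementarity_setP (u v : H1 Omega) : complementarity_set (u, v) <->
  [/\ {ae mu, forall x, 0 <= u x}, {ae mu, forall x, 0 <= v x} &
      {ae mu, forall x, u x * v x = 0}].
Proof.
split=> [uv|[u0 v0 uv]].
  have {}uv : {ae mu, forall x, [/\ 0 <= u x, 0 <= v x & u x * v x = 0]}.
    exact/lebesgue_on_ae.
  by split; apply: filterS uv => x [].
by apply/lebesgue_on_ae; apply: filterS3 u0 v0 uv => x.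
Qed.

Definition pairdot : H1 Omega * H1 Omega -> H1 Omega * H1 Omega -> R :=
  prod_ip (@H1dot R d Omega) (@H1dot R d Omega).

Lemma pairdot_inner_product : inner_product pairdot.
Proof. by apply: inner_product_prod; exact: H1dot_inner_product. Qed.

Lemma pairdot_complete : ip_complete pairdot.
Proof.
by apply: prod_ip_complete; [exact: H1dot_inner_product|exact: H1dot_inner_product|
  exact: H1dot_complete|exact: H1dot_complete].
Qed.

Lemma H1dot1_le (p : H1 Omega * H1 Omega) : H1dot p.1 p.1 <= pairdot p p.
Proof. by rewrite lerDl; exact: (ip_ge0 (H1dot_inner_product _)). Qed.

Lemma H1dot2_le (p : H1 Omega * H1 Omega) : H1dot p.2 p.2 <= pairdot p p.
Proof. by rewrite lerDr; exact: (ip_ge0 (H1dot_inner_product _)). Qed.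

Lemma dot_le_H1dot (u : H1 Omega) : dot (H1val u) (H1val u) <= H1dot u u.
Proof. exact: (ip_le_pullback _ (dot_inner_product _) None). Qed.

(** Together with [bounded_functional2]: weak convergence of pairs in H^1 implies weak convergence
    of both components in L^2. *)
Lemma bounded_functional1 w : bounded_functional pairdot (fun p => dot (H1val p.1) w).
Proof.
split=> [c p q|]; first exact: (ip_linearl (dot_inner_product _)).
exists (dot w w) => p; apply: (le_trans (cauchy_schwarz (dot_inner_product _) _ _)).
rewrite mulrC ler_wpM2l ?(ip_ge0 (dot_inner_product _))//.
exact: le_trans (dot_le_H1dot _) (H1dot1_le _).
Qed.

Lemma bounded_functional2 w : bounded_functional pairdot (fun p => dot (H1val p.2) w).
Proof.
split=> [c p q|]; first exact: (ip_linearl (dot_inner_product _)).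
exists (dot w w) => p; apply: (le_trans (cauchy_schwarz (dot_inner_product _) _ _)).
rewrite mulrC ler_wpM2l ?(ip_ge0 (dot_inner_product _))//.
exact: le_trans (dot_le_H1dot _) (H1dot2_le _).
Qed.

(** The signs pass to the limit, so [u v] is nonnegative a.e. On each box in the domain its integral
    is at most 0, hence it vanishes a.e. there. *)
Lemma complementarity_weakly_closed (U : set_system nat)
    (p_ : nat -> H1 Omega * H1 Omega) p M : UltraFilter U ->
  (forall n, complementarity_set (p_ n)) -> (forall n, pairdot (p_ n) (p_ n) <= M) ->
  (forall l, bounded_functional pairdot l -> (l \o p_) @ U --> l p) ->
  complementarity_set p.
Proof.
move=> UU Cp pM p_p; case: p p_p => u v p_p.
have {}Cp n : [/\ {ae mu, forall x, 0 <= (p_ n).1 x},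
      {ae mu, forall x, 0 <= (p_ n).2 x} &
      {ae mu, forall x, (p_ n).1 x * (p_ n).2 x = 0}].
  by apply/complementarity_setP; have := Cp n; case: (p_ n).
have u_u w := p_p _ (bounded_functional1 w).
have v_v w := p_p _ (bounded_functional2 w).
have u0 : {ae mu, forall x, 0 <= u x}.
  by apply: (weak_limit_ge0 UU u_u) => n; have [] := Cp n.
have v0 : {ae mu, forall x, 0 <= v x}.
  by apply: (weak_limit_ge0 UU v_v) => n; have [] := Cp n.
apply/complementarity_setP; split => //.
apply: ae_boxes => a b ab abO.
have le0 : \int[mu]_(x in box a b) (H1val u x * H1val v x) <= 0.
  apply: (weak_limit_box_integral_le0 (M := M) UU _ _ u_u v_v) => // n.
  - exact: le_trans (H1dot1_le _) (pM n).
  - exact: le_trans (H1dot2_le _) (pM n).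
  - by have [] := Cp n.
have mab := measurable_box a b.
have iuv := box_integrable_mul a b (H1val u) (H1val v).
have muv : measurable_fun (box a b) (EFin \o (fun x => H1val u x * H1val v x)).
  exact: measurable_int iuv.
have absE : (\int[mu]_(x in box a b) `|(H1val u x * H1val v x)%:E| =
    \int[mu]_(x in box a b) (H1val u x * H1val v x)%:E)%E.
  apply: ae_eq_integral => //; first exact: measurableT_comp.
  apply: filterS2 u0 v0 => x ux vx _.
  by rewrite gee0_abs// lee_fin mulr_ge0.
have int0 : (\int[mu]_(x in box a b) `|(H1val u x * H1val v x)%:E| = 0)%E.
  have fin : (\int[mu]_(x in box a b) (H1val u x * H1val v x)%:E)%E \is a fin_num.
    exact: integrable_fin_num.
  apply/eqP; rewrite eq_le integral_ge0// andbT absE -(fineK fin) lee_fin.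
  exact: le0.
move/(ae_eq_integral_abs mu mab muv): int0.
by apply: filterS => x h xab; have [] := h xab.
Qed.

End complementarity_closed.

Lemma hilbert_inner_product (R : realType) (H : hilbertType R) : inner_product (@inner R H).
Proof.
by split=> [x y|c x y z|x];
  [exact: innerC|exact: inner_linearl|rewrite innerxx sqr_ge0].
Qed.

Theorem corollary2p4 (R : realType) (d : nat) (Omega : domain R d)
    (Y DD : hilbertType R) (yd : DD)
    (A : {linear Y -> dual Y}) (B C : {linear H1 Omega -> dual Y})
    (D : {linear Y -> DD}) (alpha1 alpha2 eps : R)
    (Omega_nonempty : domain_set Omega !=set0)
    (Omega_bounded : bounded_set (domain_set Omega))
    (Omega_cone : cone_condition (domain_set Omega))
    (A_iso : bounded_isomorphism (fun y : Y => `|y|) (fun f : dual Y => `|f|) A)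
    (B_bounded : bounded_operator
      (@H1norm R d Omega) (fun f : dual Y => `|f|) B)
    (C_bounded : bounded_operator
      (@H1norm R d Omega) (fun f : dual Y => `|f|) C)
    (D_bounded : bounded_operator (fun y : Y => `|y|) (fun z : DD => `|z|) D)
    (alpha1_ge0 : 0 <= alpha1) (alpha2_ge0 : 0 <= alpha2) (eps_gt0 : 0 < eps) :
  exists (ybar : Y) (ubar vbar : H1 Omega),
    feasible A B C ybar ubar vbar /\
    (forall (y : Y) (u v : H1 Omega), feasible A B C y u v ->
       objective yd D alpha1 alpha2 eps ybar ubar vbar
       <= objective yd D alpha1 alpha2 eps y u v).
Proof.
have [_ [g [Ag gA [Mg gM]]]] := A_iso.
have [MB BM] := B_bounded; have [MC CM] := C_bounded; have [MD DM] := D_bounded.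
(* The solution operator of the state equation. [g] is given only as an inverse map; linearity of
   [S] follows by applying the injective linear [A] to both sides. *)
pose S (p : H1 Omega * H1 Omega) : Y := g (B p.1 + C p.2).
have S_linear c p q : S (c *: p + q) = c *: S p + S q.
  apply: (can_inj Ag); rewrite linearP !gA /= !linearP.
  by rewrite scalerDr addrACA.
pose T p := D (S p).
have T_linear c p q : T (c *: p + q) = c *: T p + T q by rewrite /T S_linear linearP.
(* The weighted sum of four tangent inequalities, for the tracking term ([r]), the two L^2 terms
   ([q1], [q2]) and the H^1 term ([P]). *)
have aux (e a1 a2 r r' q1 q1' q2 q2' P P' b1 b2 b b' i i' : R) :
    0 <= a1 -> 0 <= a2 -> 0 <= e -> r + 2 * (i' - i) <= r' ->
    q1 + 2 * (b1 - q1) <= q1' -> q2 + 2 * (b2 - q2) <= q2' -> P + 2 * (b - P) <= P' ->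
    2^-1 * r + (a1 / 2 * q1 + a2 / 2 * q2 + e / 2 * P) +
      (a1 * b1 + (a2 * b2 + (e * b + i')) - (a1 * q1 + (a2 * q2 + (e * P + i)))) <=
    2^-1 * r' + (a1 / 2 * q1' + a2 / 2 * q2' + e / 2 * P').
  move=> a1_0 a2_0 e_0 h /(ler_wpM2l a1_0) h1 /(ler_wpM2l a2_0) h2 /(ler_wpM2l e_0) h3.
  by lra.
have aux1 (q1 q2 m1 m2 n1 n2 : R) : 0 <= m1 -> 0 <= m2 -> 0 <= q1 -> 0 <= q2 ->
    n1 ^+ 2 = m1 * q1 -> n2 ^+ 2 = m2 * q2 ->
    (n1 + n2) ^+ 2 <= (2 * m1 + 2 * m2) * (q1 + q2).
  move=> m1_0 m2_0 q1_0 q2_0 e1 e2; have := sqr_ge0 (n1 - n2).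
  have := mulr_ge0 m1_0 q2_0; have := mulr_ge0 m2_0 q1_0.
  move: e1 e2; nra.
have T_bounded : exists K, forall p, `|T p| ^+ 2 <= K * pairdot p p.
  (* Absolute values, because the constants of [bounded_operator] carry no sign. *)
  pose k := `|MD| * `|Mg|; exists (k ^+ 2 * (2 * MB ^+ 2 + 2 * MC ^+ 2)) => p.
  pose nB := `|MB| * H1norm p.1; pose nC := `|MC| * H1norm p.2.
  have h1 : `|T p| <= k * (nB + nC).
    apply: (le_trans (DM _)); apply: (le_trans (ler_wpM2r (normr_ge0 _) (ler_norm MD))).
    rewrite /k -mulrA ler_wpM2l//.
    apply: (le_trans (gM _)); apply: (le_trans (ler_wpM2r (normr_ge0 _) (ler_norm Mg))).
    rewrite ler_wpM2l// (le_trans (ler_normD _ _))// lerD//.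
      by apply: (le_trans (BM _)); rewrite ler_wpM2r ?sqrtr_ge0 ?ler_norm.
    by apply: (le_trans (CM _)); rewrite ler_wpM2r ?sqrtr_ge0 ?ler_norm.
  have h2 : `|T p| ^+ 2 <= (k * (nB + nC)) ^+ 2.
    by rewrite lerXn2r// nnegrE// (le_trans _ h1).
  apply: (le_trans h2); rewrite exprMn -[leRHS]mulrA ler_wpM2l ?sqr_ge0//.
  apply: aux1.
  - exact: sqr_ge0.
  - exact: sqr_ge0.
  - exact: (ip_ge0 (H1dot_inner_product Omega) p.1).
  - exact: (ip_ge0 (H1dot_inner_product Omega) p.2).
  - by rewrite /nB exprMn real_normK ?num_real// H1norm_sqr.
  - by rewrite /nC exprMn real_normK ?num_real// H1norm_sqr.
pose f (p : H1 Omega * H1 Omega) := objective yd D alpha1 alpha2 eps (S p) p.1 p.2.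
have fE p : f p = 2^-1 * `|T p - yd| ^+ 2 + (alpha1 / 2 * dot (H1val p.1) (H1val p.1) +
    alpha2 / 2 * dot (H1val p.2) (H1val p.2) + eps / 2 * pairdot p p).
  by rewrite /pairdot /prod_ip -!H1norm_sqr -!Lnorm2_sqr.
have dot0 (w : L2 Omega) : 0 <= dot w w := ip_ge0 (dot_inner_product _) w.
(* The coercivity constant [eps / 2] is that of the H^1 term; all other terms are nonnegative. *)
have [|||||p Cp pmin] := @convex_minimizer R _ _ (pairdot_inner_product Omega) f
  (@complementarity_set R d Omega) (eps / 2) (pairdot_complete (Omega := Omega)).
- by rewrite divr_gt0.
- move=> p; rewrite fE addrA lerDr; apply: addr_ge0.
    by rewrite mulr_ge0 ?sqr_ge0// invr_ge0.
  by apply: addr_ge0; rewrite mulr_ge0 ?divr_ge0 ?dot0.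
- move=> p; have [K TK] := T_bounded.
  have iP := hilbert_inner_product DD.
  pose X := T p - yd.
  (* The differential of [f] at [p]. The target [yd] enters only through [X], since just the
     difference of values at [z] and [p] counts. *)
  exists (fun z => alpha1 * dot (H1val z.1) (H1val p.1) +
    (alpha2 * dot (H1val z.2) (H1val p.2) + (eps * pairdot p z + inner X (T z)))).
    have bT : bounded_functional (@pairdot R d Omega) (fun z => inner X (T z)).
      split=> [c q r|]; first by rewrite T_linear (ipDr iP) (ipZr iP).
      exists (inner X X * K) => q; rewrite (le_trans (cauchy_schwarz iP X (T q)))//.
      by rewrite -mulrA ler_wpM2l ?(ip_ge0 iP)// innerxx.
    exact: (bounded_functional_linear alpha1 (bounded_functional1 _)
      (bounded_functional_linear alpha2 (bounded_functional2 _)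
      (bounded_functional_linear eps
        (ip_bounded_functional (pairdot_inner_product _) p) bT))).
  move=> z; rewrite !fE; apply: aux => //; first exact: ltW.
  - have := ip_tangent iP X (T z - yd); rewrite -!innerxx.
    congr (_ + 2 * _ <= _).
    by rewrite -(ipNr iP) -(ipDr iP) opprB addrA subrK (ipDr iP) (ipNr iP).
  - rewrite (ipC (dot_inner_product _)).
    exact: (ip_tangent (dot_inner_product _) (H1val p.1) (H1val z.1)).
  - rewrite (ipC (dot_inner_product _)).
    exact: (ip_tangent (dot_inner_product _) (H1val p.2) (H1val z.2)).
  - exact: (ip_tangent (pairdot_inner_product _) p z).
- have h0 : {ae lebesgue_on Omega, forall x, (0 : H1 Omega) x = 0}.
    by apply: filterS (@L2_0E _ _ _ (lebesgue_on Omega)) => x /(_ Logic.I).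
  exists (0, 0); apply/complementarity_setP; split; apply: filterS h0 => x ->//.
  by rewrite mulr0.
- move=> U p_ q M UU; exact: complementarity_weakly_closed.
exists (S p), p.1, p.2; split.
  split; last by case: p Cp {pmin}.
  by rewrite /S gA addrAC addrK subrr.
move=> y u v [Ayuv Cuv].
have -> : y = S (u, v).
  by rewrite /S /= -(Ag y); congr g; apply/eqP; rewrite -subr_eq0 opprD addrA; apply/eqP.
exact: pmin (u, v) Cuv.
Qed.
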